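(* Let $E$ be a simple graph with a finite number of vertices and an infinite number of edges. If $F$ is the graph formed by performing a Cuntz splice at any vertex of $E$ that is the base point of at least two simple cycles, then $E \sim_M F$. In addition, if $K$ is any field, then $L_K(E)$ is Morita equivalent to $L_K(F)$.
   Context: Graphs. A graph $E=(E^0,E^1,r,s)$ consists of a countable (finite or countably infinite) set $E^0$ of vertices, a countable set $E^1$ of edges, and maps $r,s:E^1\to E^0$ (range and source). A vertex $v$ is a sink if $s^{-1}(v)=\emptyset$, a source if $r^{-1}(v)=\emptyset$, an infinite emitter if $|s^{-1}(v)|=\infty$, singular if it is a sink or an infinite emitter, and regular if $0<|s^{-1}(v)|<\infty$; $E^0_{\mathrm{sing}}$, $E^0_{\mathrm{reg}}$ are the sets of singular and regular vertices. A finite path is a vertex (length $0$) or a sequence $\alpha=\alpha_1\cdots \alpha_n$ of edges with $r(\alpha_i)=s(\alpha_{i+1})$, with $s(\alpha)=s(\alpha_1)$, $r(\alpha)=r(\alpha_n)$; a cycle is a path of length $\ge1$ with $s(\alpha)=r(\alpha)$ (its base point); it is a simple cycle if $r(\alpha_i)\ne r(\alpha)$ for $1\le i\le|\alpha|-1$. An exit for a cycle $\alpha$ is an edge $f$ with $s(f)=s(\alpha_i)$ and $f\ne\alpha_i$ for some $i$. A graph $E$ is simple if: (a) for every infinite path $e_1e_2\cdots$ ($r(e_i)=s(e_{i+1})$ for all $i$) and every $v\in E^0$ there is a finite path from $v$ to $s(e_i)$ for some $i$; (b) every cycle has an exit; (c) for every $v\in E^0$ and $w\in E^0_{\mathrm{sing}}$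 there is a path from $v$ to $w$. Cuntz splice. Let $v\in E^0$ be the base point of at least two simple cycles. The graph obtained from $E$ by performing the Cuntz splice at $v$ has vertex set $E^0\cup\{v_1,v_2\}$ and edge set $E^1\cup\{e_1,e_2,f_1,f_2,h_1,h_2\}$, where the new edges are $e_1:v\to v_1$, $e_2:v_1\to v$, $f_1:v_1\to v_2$, $f_2:v_2\to v_1$, $h_1:v_1\to v_1$, $h_2:v_2\to v_2$ (source to range), and the old edges keep their source and range. For a field $K$, the Leavitt path algebra $L_K(E)$ is the free associative $K$-algebra generated by pairwise orthogonal idempotents $\{v:v\in E^0\}$ and elements $\{e,e^*:e\in E^1\}$, modulo the relations $s(e)e=er(e)=e$, $r(e)e^*=e^*s(e)=e^*$, $e^*f=\delta_{e,f}r(e)$, and $v=\sum_{s(e)=v}ee^*$ for $v\in E^0_{\mathrm{reg}}$. Moves. (S): if $w$ is a source that is a regular vertex, delete $w$ and all edges in $s^{-1}(w)$. (O): if $w$ is not a sink and $s^{-1}(w)=\mathcal E_1\sqcup\cdots\sqcup\mathcal E_n$ is a partition into finitely many nonempty sets, at most one of them infinite, form the graph with vertices $\{v^1:v\ne w\}\cup\{w^1,\dots,w^n\}$, edges $\{e^1:r(e)\ne w\}\cup\{e^1,\dots,e^n:r(e)=w\}$, where the range of $e^i$ is $r(e)^1$ if $r(e)\ne w$ and $w^i$ if $r(e)=w$, and the source of $e^i$ is $s(e)^1$ if $s(e)\neq w$ and $w^j$ if $s(e)=w$, $e\in\mathcal E_j$. (I): if $w$ is a regular vertex that is not a source and $r^{-1}(w)=\mathcal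 E_1\sqcup\cdots\sqcup\mathcal E_n$ is a partition into finitely many nonempty sets, form the graph with vertices $\{v^1:v\ne w\}\cup\{w^1,\dots,w^n\}$, edges $\{e^1:s(e)\ne w\}\cup\{e^1,\dots,e^n:s(e)=w\}$, where the range of $e^i$ is $r(e)^1$ if $r(e)\ne w$ and $w^j$ if $r(e)=w$, $e\in\mathcal E_j$, and the source of $e^i$ is $s(e)^1$ if $s(e)\ne w$ and $w^i$ if $s(e)=w$. (R): if $w$ is a regular vertex with $s(r^{-1}(w))=\{x\}$, $s^{-1}(w)=\{f\}$ and $r(f)\ne w$, delete $w$, $f$ and all edges in $r^{-1}(w)$, and for each $e\in r^{-1}(w)$ add an edge $e_f$ from $x$ to $r(f)$. $E\sim_M F$ (move equivalent) means there is a finite sequence of graphs (up to isomorphism) $E=E_0,E_1,\dots,E_n=F$ such that for each $0\le i\le n-1$ one of $E_i,E_{i+1}$ is obtained from the other by one of the moves (S), (O), (I), (R). *)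

(* Defs.v *)
From HB Require Import structures.
From mathcomp Require Import all_boot all_algebra.
From mathcomp Require Import generic_quotient ring_quotient.
From mathcomp.multinomials Require Import monalg.
From mathcomp Require Import boolp classical_sets functions cardinality fsbigop.

Set Implicit Arguments.
Unset Strict Implicit.
Unset Printing Implicit Defensive.

Import GRing.Theory.

Local Open Scope classical_set_scope.
Local Open Scope ring_scope.

Record graph := Graph {
  vert : countType;
  edge : countType;
  src : edge -> vert;
  rng : edge -> vert
}.

Section GraphTheory.
Context (E : graph).
Implicit Types (v w : vert E) (e f : edge E).

Definition out_edges v : set (edge E) := [set e | src e = v].
Definition in_edges v : set (edge E) := [set e | rng e = v].

Definition is_sink v := out_edges v = set0.
Definition is_source v := in_edges v = set0.
Definition infinite_emitter v := infinite_set (out_edges v).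
Definition singular v := is_sink v \/ infinite_emitter v.
Definition regular v := out_edges v !=set0 /\ finite_set (out_edges v).

Definition composable : rel (edge E) := fun e f => rng e == src f.

(* Paths of positive length are nonempty sequences [e :: p]; the first
   disjunct is the path of length 0. *)
Definition has_path v w : Prop :=
  v = w \/
  exists e p, [/\ path composable e p, src e = v & rng (last e p) = w].

Definition infinite_path (p : nat -> edge E) : Prop :=
  forall i, rng (p i) = src (p i.+1).

(* [path.cycle] also requires the last edge to be composable with the first. *)
Definition is_cycle (a : seq (edge E)) : bool :=
  (a != [::]) && cycle composable a.

(* The base point of a cycle [e :: p] is [src e = rng (last e p)];
   [belast e p] lists all its edges but the last. *)
Definition simple_cycle_at v (a : seq (edge E)) : bool :=
  is_cycle a &&
  if a is e :: p then
    (src e == v) && all (fun f => rng f != rng (last e p)) (belast e p)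
  else false.

Definition has_exit (a : seq (edge E)) : Prop :=
  exists f e, [/\ e \in a, src f = src e & f <> e].

Definition simple_graph : Prop :=
  [/\ forall p, infinite_path p -> forall v, exists i, has_path v (src (p i)),
      forall a, is_cycle a -> has_exit a
    & forall v w, singular w -> has_path v w].

Definition base_of_two_simple_cycles v : Prop :=
  exists a b, [/\ simple_cycle_at v a, simple_cycle_at v b & a <> b].

End GraphTheory.

Definition graph_iso (E F : graph) : Prop :=
  exists (phi : vert E -> vert F) (psi : edge E -> edge F),
    [/\ bijective phi, bijective psi,
        forall e, src (psi e) = phi (src e)
      & forall e, rng (psi e) = phi (rng e)].

Variant splice_vert := new_v1 | new_v2.
Variant splice_edge := new_e1 | new_e2 | new_f1 | new_f2 | new_h1 | new_h2.

Definition splice_vert_code (x : splice_vert) : nat :=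
  match x with new_v1 => 0%N | new_v2 => 1%N end.
Definition splice_vert_decode (n : nat) : splice_vert :=
  match n with 0%N => new_v1 | _ => new_v2 end.
Lemma splice_vert_codeK : cancel splice_vert_code splice_vert_decode.
Proof. by case. Qed.
HB.instance Definition _ := Countable.copy splice_vert (can_type splice_vert_codeK).

Definition splice_edge_code (x : splice_edge) : nat :=
  match x with
  | new_e1 => 0%N | new_e2 => 1%N | new_f1 => 2%N
  | new_f2 => 3%N | new_h1 => 4%N | new_h2 => 5%N
  end.
Definition splice_edge_decode (n : nat) : splice_edge :=
  match n with
  | 0%N => new_e1 | 1%N => new_e2 | 2%N => new_f1
  | 3%N => new_f2 | 4%N => new_h1 | _ => new_h2
  end.
Lemma splice_edge_codeK : cancel splice_edge_code splice_edge_decode.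
Proof. by case. Qed.
HB.instance Definition _ := Countable.copy splice_edge (can_type splice_edge_codeK).

Section CuntzSplice.
Context (E : graph) (v : vert E).

Definition splice_src (e : edge E + splice_edge) : vert E + splice_vert :=
  match e with
  | inl e => inl (src e)
  | inr new_e1 => inl v
  | inr new_e2 => inr new_v1
  | inr new_f1 => inr new_v1
  | inr new_f2 => inr new_v2
  | inr new_h1 => inr new_v1
  | inr new_h2 => inr new_v2
  end.

Definition splice_rng (e : edge E + splice_edge) : vert E + splice_vert :=
  match e with
  | inl e => inl (rng e)
  | inr new_e1 => inr new_v1
  | inr new_e2 => inl v
  | inr new_f1 => inr new_v2
  | inr new_f2 => inr new_v1
  | inr new_h1 => inr new_v1
  | inr new_h2 => inr new_v2
  end.

Definition cuntz_splice : graph := Graph splice_src splice_rng.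

End CuntzSplice.

Section Moves.
Context (E : graph) (w : vert E).

Lemma source_rng_neq (hw : is_source w) (e : edge E) : rng e != w.
Proof. by apply/eqP => eqw; have : in_edges w e by []; rewrite hw. Qed.

Definition graph_S (hw : is_source w) : graph :=
  @Graph {u : vert E | u != w} {e : edge E | src e != w}
    (fun e => exist _ (src (val e)) (valP e))
    (fun e => exist _ (rng (val e)) (source_rng_neq hw (val e))).

(* A partition into [n] sets is given by the index [c e : 'I_n] of the block
   containing [e]; the values of [c] outside the partitioned set are unused.
   [split_vert i u] is [u^1] if [u != w] and [w^i] otherwise. *)
Definition split_vert n (i : 'I_n) (u : vert E) : {u : vert E | u != w} + 'I_n :=
  if insub u is Some u' then inl u' else inr i.

Definition block (A : set (edge E)) n (c : edge E -> 'I_n) (i : 'I_n) :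
  set (edge E) := [set e | A e /\ c e = i].

(* [inr (e, i)] is the copy [e^i] of an edge [e] with [rng e = w]. *)
Definition graph_O n (c : edge E -> 'I_n) : graph :=
  @Graph ({u : vert E | u != w} + 'I_n)%type
    ({e : edge E | rng e != w} + {e : edge E | rng e == w} * 'I_n)%type
    (fun x => match x with
              | inl e => split_vert (c (val e)) (src (val e))
              | inr (e, _) => split_vert (c (val e)) (src (val e))
              end)
    (fun x => match x with
              | inl e => inl (exist _ (rng (val e)) (valP e))
              | inr (_, i) => inr i
              end).

(* [inr (e, i)] is the copy [e^i] of an edge [e] with [src e = w]. *)
Definition graph_I n (c : edge E -> 'I_n) : graph :=
  @Graph ({u : vert E | u != w} + 'I_n)%type
    ({e : edge E | src e != w} + {e : edge E | src e == w} * 'I_n)%type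
    (fun x => match x with
              | inl e => inl (exist _ (src (val e)) (valP e))
              | inr (_, i) => inr i
              end)
    (fun x => match x with
              | inl e => split_vert (c (val e)) (rng (val e))
              | inr (e, _) => split_vert (c (val e)) (rng (val e))
              end).

Context (x : vert E) (f : edge E).

Definition can_move_R : Prop :=
  [/\ regular w, [set src e | e in in_edges w] = [set x],
      out_edges w = [set f] & rng f <> w].

Lemma move_R_src_neq : can_move_R -> x != w.
Proof.
case=> _ hx hf rfw; apply/eqP => xw.
have [e re se] : [set src e | e in in_edges w] x by rewrite hx.
have : out_edges w e by rewrite /out_edges /= se.
by rewrite hf => ef; apply: rfw; rewrite -ef.
Qed.

Lemma move_R_rng_neq : can_move_R -> rng f != w.
Proof. by case=> _ _ _ /eqP. Qed.

(* [inr e] is the new edge [e_f], for [e] with [rng e = w]; the edge [f] is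
   removed by the condition [src e != w]. *)
Definition graph_R (h : can_move_R) : graph :=
  @Graph {u : vert E | u != w}
    ({e : edge E | (src e != w) && (rng e != w)} + {e : edge E | rng e == w})%type
    (fun a => match a with
              | inl e => exist _ (src (val e)) (proj1 (andP (valP e)))
              | inr _ => exist _ x (move_R_src_neq h)
              end)
    (fun a => match a with
              | inl e => exist _ (rng (val e)) (proj2 (andP (valP e)))
              | inr _ => exist _ (rng f) (move_R_rng_neq h)
              end).

End Moves.

Inductive one_move (E F : graph) : Prop :=
| one_move_S (w : vert E) (hw : is_source w) of
    regular w & graph_iso (graph_S hw) F
| one_move_O (w : vert E) n (c : edge E -> 'I_n) of
    ~ is_sink w
  & (forall i, block (out_edges w) c i !=set0)
  & (forall i j, infinite_set (block (out_edges w) c i) ->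
                 infinite_set (block (out_edges w) c j) -> i = j)
  & graph_iso (graph_O w c) F
| one_move_I (w : vert E) n (c : edge E -> 'I_n) of
    regular w & ~ is_source w
  & (forall i, block (in_edges w) c i !=set0)
  & graph_iso (graph_I w c) F
| one_move_R (w x : vert E) (f : edge E) (h : can_move_R w x f) of
    graph_iso (graph_R h) F.

Inductive move_equivalent : graph -> graph -> Prop :=
| move_equivalent_iso E F : graph_iso E F -> move_equivalent E F
| move_equivalent_step E E' F :
    one_move E E' \/ one_move E' E -> move_equivalent E' F ->
    move_equivalent E F.

Section TwoSidedQuotient.
Context (R : nzRingType) (relates : R -> R -> Prop).

Inductive gen_ideal : R -> Prop :=
| gen_ideal_rel x y : relates x y -> gen_ideal (x - y)
| gen_ideal0 : gen_ideal 0
| gen_idealD x y : gen_ideal x -> gen_ideal y -> gen_ideal (x + y)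
| gen_idealMl a x : gen_ideal x -> gen_ideal (a * x)
| gen_idealMr a x : gen_ideal x -> gen_ideal (x * a).

Definition gen_idealb : {pred R} := fun x => `[< gen_ideal x >].

Lemma gen_idealb_zmod_closed : zmod_closed gen_idealb.
Proof.
split; first exact/asboolP/gen_ideal0.
move=> x y /asboolP hx /asboolP hy; apply/asboolP; apply: gen_idealD => //.
by rewrite -mulN1r; apply: gen_idealMl.
Qed.
HB.instance Definition _ :=
  GRing.isZmodClosed.Build R gen_idealb gen_idealb_zmod_closed.

(* The library's quotient [Quotient.quot] of an additive group carries a ring
   structure there only for commutative rings. *)
Definition quot_ring : Type := Quotient.quot gen_idealb.
HB.instance Definition _ := Choice.on quot_ring.
HB.instance Definition _ := GRing.Zmodule.on quot_ring.

Definition quot_pi (x : R) : quot_ring := \pi_(Quotient.quot gen_idealb)%qT x.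
Definition quot_repr (x : quot_ring) : R :=
  @repr R (Quotient.quot gen_idealb) x.

Definition quot_one : quot_ring := quot_pi 1.
Definition quot_mul (x y : quot_ring) : quot_ring :=
  quot_pi (quot_repr x * quot_repr y).

Lemma quot_reprK x : quot_pi (quot_repr x) = x.
Proof. exact: reprK. Qed.

Lemma quot_piP x y : quot_pi x = quot_pi y <-> gen_ideal (x - y).
Proof.
split=> [/eqP|h].
  by rewrite -Quotient.idealrBE => /asboolP.
by apply/eqP; rewrite -Quotient.idealrBE; apply/asboolP.
Qed.

Lemma quot_piD x y : quot_pi (x + y) = quot_pi x + quot_pi y.
Proof. exact: raddfD. Qed.

Lemma quot_piM x y : quot_pi (x * y) = quot_mul (quot_pi x) (quot_pi y).
Proof.
apply/quot_piP.
set x' := quot_repr _; set y' := quot_repr _.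
have hx : gen_ideal (x - x') by apply/quot_piP; rewrite quot_reprK.
have hy : gen_ideal (y - y') by apply/quot_piP; rewrite quot_reprK.
have -> : x * y - x' * y' = (x - x') * y + x' * (y - y').
  by rewrite mulrBl mulrBr addrA subrK.
by apply: gen_idealD; [apply: gen_idealMr | apply: gen_idealMl].
Qed.

Lemma quot_mulA : associative quot_mul.
Proof.
move=> x y z; rewrite -[x]quot_reprK -[y]quot_reprK -[z]quot_reprK.
by rewrite -!quot_piM mulrA.
Qed.
Lemma quot_mul1 : left_id quot_one quot_mul.
Proof. by move=> x; rewrite -[x]quot_reprK -quot_piM mul1r. Qed.
Lemma quot_mulr1 : right_id quot_one quot_mul.
Proof. by move=> x; rewrite -[x]quot_reprK -quot_piM mulr1. Qed.
Lemma quot_mulDl : left_distributive quot_mul +%R.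
Proof.
move=> x y z; rewrite -[x]quot_reprK -[y]quot_reprK -[z]quot_reprK.
by rewrite -!quot_piM -!quot_piD -quot_piM mulrDl.
Qed.
Lemma quot_mulDr : right_distributive quot_mul +%R.
Proof.
move=> x y z; rewrite -[x]quot_reprK -[y]quot_reprK -[z]quot_reprK.
by rewrite -!quot_piM -!quot_piD -quot_piM mulrDr.
Qed.
HB.instance Definition _ := GRing.Zmodule_isPzRing.Build quot_ring
  quot_mulA quot_mul1 quot_mulr1 quot_mulDl quot_mulDr.

End TwoSidedQuotient.

Section LeavittPathAlgebra.
Context (K : fieldType) (E : graph).

Definition free_lpa : nzRingType :=
  {malg K[{fmonom (vert E + (edge E + edge E))%type}]}.

Definition gen_vert (v : vert E) : free_lpa := << fmu (inl v) >>.
Definition gen_edge (e : edge E) : free_lpa := << fmu (inr (inl e)) >>.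
Definition gen_ghost (e : edge E) : free_lpa := << fmu (inr (inr e)) >>.

(* The library's free algebra [{malg K[{fmonom I}]}] is unital, whereas a
   Leavitt path algebra is presented as a possibly nonunital algebra.  When
   there are finitely many vertices the sum of the vertices is a unit of the
   latter, and the last relation identifies it with the 1 of the free algebra,
   so that [lpa] is L_K(E) itself.  (For infinitely many vertices [lpa] would be
   its unitization.) *)
Inductive lpa_rel : free_lpa -> free_lpa -> Prop :=
| lpa_vert v w :
    lpa_rel (gen_vert v * gen_vert w) (if v == w then gen_vert v else 0)
| lpa_src_edge e : lpa_rel (gen_vert (src e) * gen_edge e) (gen_edge e)
| lpa_edge_rng e : lpa_rel (gen_edge e * gen_vert (rng e)) (gen_edge e)
| lpa_rng_ghost e : lpa_rel (gen_vert (rng e) * gen_ghost e) (gen_ghost e)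
| lpa_ghost_src e : lpa_rel (gen_ghost e * gen_vert (src e)) (gen_ghost e)
| lpa_ghost_edge e f :
    lpa_rel (gen_ghost e * gen_edge f) (if e == f then gen_vert (rng e) else 0)
| lpa_regular v : regular v ->
    lpa_rel (gen_vert v) (\sum_(e \in out_edges v) gen_edge e * gen_ghost e)
| lpa_unit : finite_set [set: vert E] ->
    lpa_rel 1 (\sum_(v \in [set: vert E]) gen_vert v).

Definition lpa : pzRingType := quot_ring lpa_rel.

End LeavittPathAlgebra.

Record module_functor (R S : pzRingType) := ModuleFunctor {
  fun_obj :> lmodType R -> lmodType S;
  fun_map : forall M N : lmodType R, {linear M -> N} -> {linear fun_obj M -> fun_obj N};
  fun_map_ext : forall (M N : lmodType R) (f g : {linear M -> N}),
    f =1 g -> fun_map f =1 fun_map g;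
  fun_map_id : forall M : lmodType R, fun_map (idfun : {linear M -> M}) =1 idfun;
  fun_map_comp : forall (M N P : lmodType R)
    (g : {linear N -> P}) (f : {linear M -> N}),
    fun_map (g \o f : {linear M -> P}) =1 fun_map g \o fun_map f
}.

Definition comp_iso_id (R S : pzRingType)
    (F : module_functor R S) (G : module_functor S R) : Prop :=
  exists eta : forall M : lmodType R, {linear G (F M) -> M},
    (forall M, bijective (eta M)) /\
    (forall (M N : lmodType R) (f : {linear M -> N}),
       eta N \o fun_map G (fun_map F f) =1 f \o eta M).

Definition morita_equivalent (R S : pzRingType) : Prop :=
  exists (F : module_functor R S) (G : module_functor S R),
    comp_iso_id F G /\ comp_iso_id G F.

(* Main.v *)
(* Let [A] be the adjacency matrix of [E] and [B = A - 1].  Out-splitting an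
   edge [a -> b] off its source and collapsing the vertex obtained adds column
   [a] of [B] to column [b]; collapsing a regular vertex without loops is a
   pivot elimination in [B].  Under both, the Leavitt path algebra passes to or
   from a full corner.  Up to one column addition and one collapse, the Cuntz
   splice at [v] adds to [B] a vertex [z] with row [e_z + zeta] and adds
   [m x] times this row to each row [x], where [zeta = m = e_v].

   By simplicity some vertex [w] is an infinite emitter, and every infinite
   emitter can be made to emit infinitely many edges to every vertex; the
   remaining, regular, rows of [B] then have a common integral kernel vector
   [phi <> 0], and can be made positive.  A further vertex [b] is attached whose
   row [rho - e_b] satisfies [rho . phi = -1], so that [phi b = -1]; column
   additions reach [phi w = 1] and cancel the other entries of [phi].  Columns
   [w] and [b] now agree on regular rows, and then [z] can be absorbed, all
   steps being applied to [B] and to its extension simultaneously. *)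
From HB Require Import structures.
Require Import Defs.
From mathcomp Require Import all_boot all_order all_algebra.
From mathcomp Require Import finmap.
From mathcomp.multinomials Require Import monalg.
From mathcomp Require Import boolp classical_sets functions cardinality fsbigop.
From mathcomp Require Import zify ring.

Set Implicit Arguments.
Unset Strict Implicit.
Unset Printing Implicit Defensive.

Import GRing.Theory.

Local Open Scope classical_set_scope.
Local Open Scope ring_scope.

(** * Leavitt path algebras *)

(** The obstacle is a sign. A collapse eliminates a pivot -1 of [B], while the vertex [z] brings a
    pivot +1. Were every vertex regular, column additions and collapses would preserve
    [det (1 - A)], whereas the extension by [z] negates it. An infinite emitter imposes no relation,
    so only the regular rows count, and they are fewer than the columns: hence the kernel vector.
    Column additions act on [phi] contragrediently, and [phi = e_w - e_b] means exactly that columns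
    [w] and [b] coincide on regular rows; trading one for the other turns the pivot +1 into -1. Only
    nonnegative multiples can be added, so entries of [phi] of both signs need a partner: [b]
    supplies the entry -1. For [rho] to exist, [phi] must be primitive, which is a Bezout argument.
    Additions between old columns change the row [zeta] but not the column [m]; the inductive
    statements therefore let [zeta] vary. Morita equivalence is not deduced from invariance under
    the four moves: it is proved for column additions and collapses and carried along with move
    equivalence. *)

Section FreeAlgebra.
Context (K : fieldType) (I : choiceType).
Local Notation A := {malg K[{fmonom I}]}.

Lemma malg_scaleU k m : << k *g m >> = malgC k * << m >> :> A.
Proof. by rewrite malgM_def /malgC fgmulUU mulr1 mul1m. Qed.
Lemma malg_nilE : << FMonom [::] >> = 1 :> A.
Proof. by rewrite -fmoneE. Qed.
Lemma malg_consE i s : << FMonom (i :: s) >> = << fmu i >> * << FMonom s >> :> A.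
Proof. by rewrite malgM_def fgmulUU mulr1 /mmul /= fmmulE fmuE. Qed.
Lemma malgC_comm k (x : A) : malgC k * x = x * malgC k.
Proof.
rewrite (monalgE x) mulr_suml mulr_sumr; apply: eq_bigr => m _.
by rewrite !malgM_def /malgC !fgmulUU mul1m mulm1 mulrC.
Qed.
End FreeAlgebra.

Lemma finite_enum (I : choiceType) (A : set I) : finite_set A ->
  exists2 s : seq I, uniq s & forall i, A i <-> i \in s.
Proof.
move=> /finite_seqP[s ->]; exists (undup s); first exact: undup_uniq.
by move=> i; rewrite mem_undup.
Qed.

Section LpaGenerators.
Context (K : fieldType) (E : graph).
Local Notation L := (lpa K E).

Definition lpa_pi (x : free_lpa K E) : L := quot_pi (@lpa_rel K E) x.
Definition lv (v : vert E) : L := lpa_pi (gen_vert K v).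
Definition le (e : edge E) : L := lpa_pi (gen_edge K e).
Definition lg (e : edge E) : L := lpa_pi (gen_ghost K e).
Definition lk (k : K) : L := lpa_pi (malgC k).

Lemma lpa_pi_surj (x : L) : exists y, x = lpa_pi y.
Proof. by exists (quot_repr x); rewrite /lpa_pi quot_reprK. Qed.
Lemma lpa_piD x y : lpa_pi (x + y) = lpa_pi x + lpa_pi y.
Proof. exact: quot_piD. Qed.
Lemma lpa_piM x y : lpa_pi (x * y) = lpa_pi x * lpa_pi y.
Proof. exact: quot_piM. Qed.
Lemma lpa_pi1 : lpa_pi 1 = 1. Proof. by []. Qed.
Lemma lpa_pi0 : lpa_pi 0 = 0.
Proof. by apply: (addIr (lpa_pi 0)); rewrite -lpa_piD !add0r. Qed.
Lemma lpa_pi_sum (I : Type) (s : seq I) (F : I -> free_lpa K E) :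
  lpa_pi (\sum_(i <- s) F i) = \sum_(i <- s) lpa_pi (F i).
Proof. by elim/big_rec2: _ => [|i x y _ <-]; rewrite ?lpa_pi0 ?lpa_piD. Qed.
Lemma lpa_pi_rel x y : lpa_rel x y -> lpa_pi x = lpa_pi y.
Proof. by move=> h; apply/quot_piP/gen_ideal_rel. Qed.

Lemma lkD k l : lk (k + l) = lk k + lk l.
Proof. by rewrite -lpa_piD -raddfD. Qed.
Lemma lkM k l : lk (k * l) = lk k * lk l.
Proof. by rewrite -lpa_piM -rmorphM. Qed.
Lemma lk1 : lk 1 = 1.
Proof. by rewrite -lpa_pi1 /lk rmorph1. Qed.

(** This is the uniqueness half of the universal property: identities between additive and
    multiplicative maps need only be checked on scalars and generators. *)
Lemma lpa_ind (P : L -> Prop) :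
  (forall x y, P x -> P y -> P (x + y)) ->
  (forall x y, P x -> P y -> P (x * y)) ->
  (forall k, P (lk k)) -> (forall v, P (lv v)) ->
  (forall e, P (le e)) -> (forall e, P (lg e)) -> forall x, P x.
Proof.
move=> PD PM Pk Pv Pe Pg x; have [y ->] := lpa_pi_surj x.
have P0 : P 0 by rewrite -lpa_pi0 -(raddf0 (@malgC _ _)); exact: Pk.
rewrite (monalgE y) lpa_pi_sum; apply: (big_ind P) => // m _.
move: (_@_m) => k; case: m => s.
rewrite malg_scaleU lpa_piM; apply: (PM); first exact: Pk.
elim: s => [|i s IH]; first by rewrite malg_nilE lpa_pi1 -lk1; exact: Pk.
rewrite malg_consE lpa_piM; apply: (PM) => //.
case: i => [v|[e|e]]; [exact: Pv|exact: Pe|exact: Pg].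
Qed.

Lemma lk_comm k x : lk k * x = x * lk k.
Proof. by have [y ->] := lpa_pi_surj x; rewrite -!lpa_piM malgC_comm. Qed.

Lemma lpa_fsum (I : choiceType) (A : set I) (F : I -> free_lpa K E) (s : seq I) :
  uniq s -> (forall i, A i <-> i \in s) ->
  lpa_pi (\sum_(i \in A) F i) = \sum_(i <- s) lpa_pi (F i).
Proof.
move=> us sA; have -> : A = [set` s] by apply/seteqP; split=> i /= /sA.
by rewrite -fsbig_seq // lpa_pi_sum.
Qed.

Lemma lvM v w : lv v * lv w = if v == w then lv v else 0.
Proof.
rewrite -lpa_piM (lpa_pi_rel (lpa_vert K v w)).
by case: ifP => // _; rewrite lpa_pi0.
Qed.
Lemma lv_le e : lv (src e) * le e = le e.
Proof. by rewrite -lpa_piM; exact/lpa_pi_rel/lpa_src_edge. Qed.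
Lemma le_lv e : le e * lv (rng e) = le e.
Proof. by rewrite -lpa_piM; exact/lpa_pi_rel/lpa_edge_rng. Qed.
Lemma lv_lg e : lv (rng e) * lg e = lg e.
Proof. by rewrite -lpa_piM; exact/lpa_pi_rel/lpa_rng_ghost. Qed.
Lemma lg_lv e : lg e * lv (src e) = lg e.
Proof. by rewrite -lpa_piM; exact/lpa_pi_rel/lpa_ghost_src. Qed.
Lemma lg_le e f : lg e * le f = if e == f then lv (rng e) else 0.
Proof.
rewrite -lpa_piM (lpa_pi_rel (lpa_ghost_edge K e f)).
by case: ifP => // _; rewrite lpa_pi0.
Qed.
Lemma lv_sum v s : uniq s -> s != [::] -> (forall e, (e \in s) = (src e == v)) ->
  lv v = \sum_(e <- s) le e * lg e.
Proof.
move=> us s0 sv; have svP e : out_edges v e <-> e \in s.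
  by rewrite sv; split => [->|/eqP].
have rv : regular v.
  split; first by case: s s0 {us} svP {sv} => // e s _ /(_ e) [_ h]; exists e; apply: h; rewrite mem_head.
  have -> : out_edges v = [set` s] by apply/seteqP; split=> i /= /svP.
  exact: finite_seq.
rewrite /lv (lpa_pi_rel (lpa_regular K rv)) (lpa_fsum _ us svP).
by apply: eq_bigr => e _; rewrite lpa_piM.
Qed.
Lemma lv_unit s : uniq s -> (forall v, v \in s) -> 1 = \sum_(v <- s) lv v.
Proof.
move=> us sv.
have fv : finite_set [set: vert E].
  have -> : [set: vert E] = [set` s] by apply/seteqP; split=> i //= _; exact: sv.
  exact: finite_seq.
by rewrite -lpa_pi1 (lpa_pi_rel (lpa_unit K fv)) (lpa_fsum _ us).
Qed.

End LpaGenerators.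

(** * Universal property: families satisfying the Leavitt relations *)

Section Universal.
Context (K : fieldType) (E : graph) (T : pzRingType) (c : K -> T).
Context (P : vert E -> T) (X Y : edge E -> T) (eps : T).

(** The image [eps] of 1 may be a proper idempotent of [T], so that maps into corners are covered;
    [c] is unital in [T], and the image of the scalar [k] is [eps * c k]. The relations with sums
    range over duplicate-free enumerations, whose existence encodes finiteness. *)
Record leavitt_family := LeavittFamily {
  lf_cD : forall k l, c (k + l) = c k + c l;
  lf_cM : forall k l, c (k * l) = c k * c l;
  lf_c1 : c 1 = 1;
  lf_cP : forall k v, c k * P v = P v * c k;
  lf_cX : forall k e, c k * X e = X e * c k;
  lf_cY : forall k e, c k * Y e = Y e * c k;
  lf_eps : eps * eps = eps;
  lf_epsP : forall v, eps * P v = P v;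
  lf_Peps : forall v, P v * eps = P v;
  lf_PP : forall v w, P v * P w = if v == w then P v else 0;
  lf_PX : forall e, P (src e) * X e = X e;
  lf_XP : forall e, X e * P (rng e) = X e;
  lf_PY : forall e, P (rng e) * Y e = Y e;
  lf_YP : forall e, Y e * P (src e) = Y e;
  lf_YX : forall e f, Y e * X f = if e == f then P (rng e) else 0;
  lf_reg : forall v s, uniq s -> s != [::] ->
    (forall e, (e \in s) = (src e == v)) -> P v = \sum_(e <- s) X e * Y e;
  lf_unit : forall s, uniq s -> (forall v, v \in s) -> eps = \sum_(v <- s) P v
}.

Hypothesis fam : leavitt_family.

Let gen (i : vert E + (edge E + edge E)) : T :=
  match i with inl v => P v | inr (inl e) => X e | inr (inr e) => Y e end.
Let word (m : {fmonom (vert E + (edge E + edge E))%type}) : T :=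
  \prod_(i <- fmonom_val m) gen i.
Definition free_map (x : free_lpa K E) : T :=
  \sum_(m <- msupp x) c (x@_m) * word m.

Lemma lf_c0 : c 0 = 0.
Proof. by apply: (addIr (c 0)); rewrite -lf_cD // !add0r. Qed.

Lemma free_mapEw (d : {fset {fmonom (vert E + (edge E + edge E))%type}}) x :
  (msupp x `<=` d)%fset -> free_map x = \sum_(m <- d) c (x@_m) * word m.
Proof.
move=> h; rewrite /free_map (big_fset_incl _ h) //= => m _ /mcoeff_outdom ->.
by rewrite lf_c0 mul0r.
Qed.

Lemma free_mapD x y : free_map (x + y) = free_map x + free_map y.
Proof.
set d := (msupp x `|` msupp y)%fset.
rewrite (@free_mapEw d (x + y)) ?msuppD_le // (@free_mapEw d x) ?fsubsetUl //.
rewrite (@free_mapEw d y) ?fsubsetUr // -big_split; apply: eq_bigr => m _ /=.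
by rewrite mcoeffD lf_cD // mulrDl.
Qed.
Lemma free_map0 : free_map 0 = 0.
Proof. by rewrite /free_map msupp0 big_seq_fset0. Qed.
Lemma free_mapN x : free_map (- x) = - free_map x.
Proof. by apply: (addIr (free_map x)); rewrite -free_mapD !addNr free_map0. Qed.
Lemma free_map_sum (I : Type) (s : seq I) F :
  free_map (\sum_(i <- s) F i) = \sum_(i <- s) free_map (F i).
Proof. by elim/big_rec2: _ => [|i x y _ <-]; rewrite ?free_map0 ?free_mapD. Qed.
Lemma free_mapU k m : free_map << k *g m >> = c k * word m.
Proof.
by rewrite (@free_mapEw [fset m]%fset) ?msuppU_le // big_seq_fset1 mcoeffUU.
Qed.
Lemma word_comm k m : c k * word m = word m * c k.
Proof.
apply/esym; rewrite /word; elim/big_rec: _ => [|i t _ h]; first by rewrite mulr1 mul1r.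
rewrite -mulrA h !mulrA; congr (_ * _).
by case: i => [v|[e|e]] /=; rewrite ?(lf_cP fam) ?(lf_cX fam) ?(lf_cY fam).
Qed.
Lemma free_mapM x y : free_map (x * y) = free_map x * free_map y.
Proof.
rewrite malgME free_map_sum {2}/free_map mulr_suml; apply: eq_bigr => m _.
rewrite free_map_sum {2}/free_map mulr_sumr; apply: eq_bigr => n _.
rewrite free_mapU lf_cM // {1}/word /mmul /= fmmulE big_cat /= -/(word m) -/(word n).
by rewrite -!mulrA; congr (_ * _); rewrite !mulrA word_comm.
Qed.
Lemma free_map1 : free_map 1 = 1.
Proof.
have -> : (1 : free_lpa K E) = << 1 *g fmone _ >> by [].
by rewrite free_mapU lf_c1 // mul1r /word fmoneE big_nil.
Qed.
Lemma free_map_gen i : free_map << fmu i >> = gen i.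
Proof. by rewrite free_mapU lf_c1 // mul1r /word fmuE big_seq1. Qed.
Lemma free_map_vert v : free_map (gen_vert K v) = P v.
Proof. exact: free_map_gen. Qed.
Lemma free_map_edge e : free_map (gen_edge K e) = X e.
Proof. exact: free_map_gen. Qed.
Lemma free_map_ghost e : free_map (gen_ghost K e) = Y e.
Proof. exact: free_map_gen. Qed.
Let freeE := (free_map_vert, free_map_edge, free_map_ghost).
Lemma free_mapC k : free_map (malgC k) = c k.
Proof. by rewrite free_mapU /word /mone /= fmoneE big_nil mulr1. Qed.

Lemma eps_gen i : eps * gen i = gen i * eps.
Proof.
case: i => [v|[e|e]] /=; first by rewrite (lf_epsP fam) (lf_Peps fam).
  by rewrite -{1}(lf_PX fam) mulrA (lf_epsP fam) (lf_PX fam)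
             -{2}(lf_XP fam) -mulrA (lf_Peps fam) (lf_XP fam).
by rewrite -{1}(lf_PY fam) mulrA (lf_epsP fam) (lf_PY fam)
           -{2}(lf_YP fam) -mulrA (lf_Peps fam) (lf_YP fam).
Qed.
Hypothesis eps_c : forall k, eps * c k = c k * eps.
Lemma eps_free x : eps * free_map x = free_map x * eps.
Proof.
rewrite /free_map mulr_suml mulr_sumr; apply: eq_bigr => m _.
rewrite mulrA eps_c -!mulrA; congr (_ * _).
rewrite /word; elim/big_rec: _ => [|i t _ h]; first by rewrite mulr1 mul1r.
by rewrite mulrA eps_gen -!mulrA h.
Qed.

Lemma free_map_fsum (I : choiceType) (A : set I) (F : I -> free_lpa K E) (s : seq I) :
  uniq s -> (forall i, A i <-> i \in s) ->
  free_map (\sum_(i \in A) F i) = \sum_(i <- s) free_map (F i).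
Proof.
move=> us sA; have -> : A = [set` s] by apply/seteqP; split=> i /= /sA.
by rewrite -fsbig_seq // free_map_sum.
Qed.

Lemma free_map_rel x y : lpa_rel x y -> eps * free_map x = eps * free_map y.
Proof.
case=> [v w|e|e|e|e|e f|v [[e0 he0] /finite_enum[s us hs]]|/finite_enum[s us hs]].
- rewrite free_mapM !freeE (lf_PP fam).
  by case: ifP; rewrite ?freeE ?free_map0.
- by rewrite free_mapM !freeE (lf_PX fam).
- by rewrite free_mapM !freeE (lf_XP fam).
- by rewrite free_mapM !freeE (lf_PY fam).
- by rewrite free_mapM !freeE (lf_YP fam).
- rewrite free_mapM !freeE (lf_YX fam).
  by case: ifP; rewrite ?freeE ?free_map0.
- rewrite (free_map_fsum _ us hs) freeE (@lf_reg fam v s) //.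
  + by congr (_ * _); apply: eq_bigr => e _; rewrite free_mapM !freeE.
  + by case: s us hs => // _ /(_ e0) [/(_ he0)].
  + by move=> e; apply/idP/eqP => [/hs|/hs].
- rewrite (free_map_fsum _ us hs) free_map1 mulr1.
  have {hs}hs i : i \in s by apply/hs.
  by under eq_bigr do rewrite freeE; rewrite -(lf_unit fam us hs) (lf_eps fam).
Qed.

Lemma free_map_ideal x : gen_ideal (@lpa_rel K E) x -> eps * free_map x = 0.
Proof.
elim=> [a b h||a b _ ha _ hb|a b _ h|a b _ h].
- by rewrite free_mapD free_mapN mulrDr mulrN (free_map_rel h) subrr.
- by rewrite free_map0 mulr0.
- by rewrite free_mapD mulrDr ha hb addr0.
- by rewrite free_mapM mulrA eps_free -mulrA h mulr0.
- by rewrite free_mapM mulrA h mul0r.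
Qed.

(** [free_map] is unital, hence sends 1 to 1 even if the [P v] add up to a smaller idempotent.
    Multiplying by [eps], which commutes with the image, repairs the relation [lpa_unit] and keeps
    the map multiplicative. *)
Definition lpa_map (x : lpa K E) : T := eps * free_map (quot_repr x).

Lemma lpa_map_pi x : lpa_map (lpa_pi x) = eps * free_map x.
Proof.
apply/eqP; rewrite -subr_eq0 /lpa_map -mulrBr -free_mapN -free_mapD.
by apply/eqP/free_map_ideal/quot_piP; rewrite quot_reprK.
Qed.
Lemma lpa_mapD x y : lpa_map (x + y) = lpa_map x + lpa_map y.
Proof.
have [[a ->] [b ->]] := (lpa_pi_surj x, lpa_pi_surj y); rewrite -lpa_piD !lpa_map_pi.
by rewrite free_mapD mulrDr.
Qed.
Lemma lpa_mapM x y : lpa_map (x * y) = lpa_map x * lpa_map y.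
Proof.
have [[a ->] [b ->]] := (lpa_pi_surj x, lpa_pi_surj y); rewrite -lpa_piM !lpa_map_pi.
rewrite free_mapM -[in LHS](lf_eps fam) -!mulrA; congr (eps * _).
by rewrite !mulrA eps_free.
Qed.
Lemma lpa_map_lv v : lpa_map (lv K v) = P v.
Proof. by rewrite lpa_map_pi freeE (lf_epsP fam). Qed.
Lemma lpa_map_le e : lpa_map (le K e) = X e.
Proof. by rewrite lpa_map_pi freeE -(lf_PX fam) mulrA (lf_epsP fam). Qed.
Lemma lpa_map_lg e : lpa_map (lg K e) = Y e.
Proof. by rewrite lpa_map_pi freeE -(lf_PY fam) mulrA (lf_epsP fam). Qed.
Lemma lpa_map_lk k : lpa_map (lk E k) = eps * c k.
Proof. by rewrite lpa_map_pi free_mapC. Qed.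
End Universal.

(** * Full corners and Morita equivalence *)

(* [q + f g = 1] makes the idempotent [q] full, and [psi], [chi] identify [S]
   with the corner [q R q]. *)
Record full_corner (R S : pzRingType) := FullCorner {
  fc_psi : S -> R;
  fc_chi : R -> S;
  fc_f : R;
  fc_g : R;
  fc_psiD : forall s t, fc_psi (s + t) = fc_psi s + fc_psi t;
  fc_psiM : forall s t, fc_psi (s * t) = fc_psi s * fc_psi t;
  fc_chiD : forall a b, fc_chi (a + b) = fc_chi a + fc_chi b;
  fc_psiK : forall s, fc_chi (fc_psi s) = s;
  fc_chiK : forall r, fc_psi (fc_chi r) = fc_psi 1 * r * fc_psi 1;
  fc_split : fc_psi 1 + fc_f * fc_g = 1;
  fc_fq : fc_f * fc_psi 1 = fc_f;
  fc_qg : fc_psi 1 * fc_g = fc_g;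
  fc_qf : fc_psi 1 * fc_f = 0;
  fc_gq : fc_g * fc_psi 1 = 0
}.

Section FullCornerMorita.
Context (R S : pzRingType).
Implicit Types (d : full_corner R S) (M : lmodType R) (N : lmodType S).

Local Notation psi := fc_psi.
Local Notation chi := fc_chi.
Local Notation q d := (psi d 1).
Local Notation f := fc_f.
Local Notation g := fc_g.

Lemma fc_qq d : q d * q d = q d.
Proof. by rewrite -fc_psiM mulr1. Qed.
Lemma fc_q_psi d s : q d * psi d s = psi d s.
Proof. by rewrite -fc_psiM mul1r. Qed.
Lemma fc_psi_inj d : injective (psi d).
Proof. exact: can_inj (fc_psiK d). Qed.
Lemma fc_chi0 d : chi d 0 = 0.
Proof. by apply: (addIr (chi d 0)); rewrite -fc_chiD !add0r. Qed.
Lemma fc_chiM d a b : chi d a * chi d b = chi d (a * q d * b).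
Proof. by apply: (@fc_psi_inj d); rewrite fc_psiM !fc_chiK -!mulrA (mulrA (q d) (q d)) fc_qq. Qed.
(** Insert [1 = q + f g] between [a] and [b]. This is the multiplication rule for the block matrices
    that act on induced modules. *)
Lemma fc_chi_mul d a b :
  chi d a * chi d b + chi d (a * f d) * chi d (g d * b) = chi d (a * b).
Proof.
rewrite !fc_chiM -fc_chiD -(mulrA a (f d)) fc_fq -!mulrA -mulrDr (mulrA (f d)).
by rewrite -mulrDl fc_split mul1r.
Qed.
Lemma fc_gfg d : g d * f d * g d = g d.
Proof.
rewrite -mulrA; have -> : f d * g d = 1 - q d by rewrite -(fc_split d) addrC addKr.
by rewrite mulrBr mulr1 fc_gq subr0.
Qed.
Lemma fc_chi1 d : chi d 1 = 1.
Proof. by apply: (@fc_psi_inj d); rewrite fc_chiK mulr1 fc_qq. Qed.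
Lemma fc_chif d : chi d (f d) = 0.
Proof. by apply: (@fc_psi_inj d); rewrite fc_chiK fc_qf mul0r -(fc_chi0 d) fc_chiK mulr0 mul0r. Qed.
Lemma fc_chig d : chi d (g d) = 0.
Proof. by apply: (@fc_psi_inj d); rewrite fc_chiK -mulrA fc_gq mulr0 -(fc_chi0 d) fc_chiK mulr0 mul0r. Qed.

Definition fixed_by d M : {pred M} := fun m => q d *: m == m.
Lemma fixed_zmod d M : zmod_closed (@fixed_by d M).
Proof.
split=> [|x y]; rewrite /fixed_by !unfold_in; first by rewrite scaler0.
by move=> /eqP hx /eqP hy; rewrite scalerBr hx hy.
Qed.
HB.instance Definition _ d M :=
  GRing.isZmodClosed.Build M (@fixed_by d M) (@fixed_zmod d M).

Definition corner d M := {m : M | m \in @fixed_by d M}.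
HB.instance Definition _ d M := [isSub of corner d M for @sval _ _].
HB.instance Definition _ d M := [Choice of corner d M by <:].
HB.instance Definition _ d M := [SubChoice_isSubZmodule of corner d M by <:].

Lemma fixedP d M (m : M) : reflect (q d *: m = m) (m \in @fixed_by d M).
Proof. exact: eqP. Qed.
Lemma corner_scale_subproof d M s (m : corner d M) :
  psi d s *: (val m : M) \in @fixed_by d M.
Proof. by apply/fixedP; rewrite scalerA fc_q_psi. Qed.
Definition corner_scale d M s (m : corner d M) : corner d M :=
  Sub (psi d s *: (val m : M)) (corner_scale_subproof s m).
Lemma corner_qE d M (m : corner d M) : q d *: (val m : M) = val m.
Proof. exact/fixedP/valP. Qed.
Lemma corner_scaleA d M s t (m : corner d M) :
  corner_scale s (corner_scale t m) = corner_scale (s * t) m.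
Proof. by apply: val_inj; rewrite /= scalerA fc_psiM. Qed.
Lemma corner_scale1 d M : left_id 1 (@corner_scale d M).
Proof. by move=> m; apply: val_inj; rewrite /= corner_qE. Qed.
Lemma corner_scaleDr d M : right_distributive (@corner_scale d M) +%R.
Proof. by move=> s m n; apply: val_inj; rewrite /= scalerDr. Qed.
Lemma corner_scaleDl d M (m : corner d M) :
  {morph (@corner_scale d M)^~ m : a b / a + b}.
Proof. by move=> s t; apply: val_inj; rewrite /= fc_psiD scalerDl. Qed.
HB.instance Definition _ d M := GRing.Zmodule_isLmodule.Build S (corner d M)
  (@corner_scaleA d M) (@corner_scale1 d M) (@corner_scaleDr d M) (@corner_scaleDl d M).

Section CornerMap.
Context d M M' (h : {linear M -> M'}).
Lemma corner_map_subproof (m : corner d M) : h (val m) \in @fixed_by d M'.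
Proof. by apply/fixedP; rewrite -linearZ corner_qE. Qed.
Definition corner_map (m : corner d M) : corner d M' := Sub (h (val m)) (corner_map_subproof m).
Lemma corner_map_linear : linear corner_map.
Proof. by move=> s m n; apply: val_inj; rewrite /= linearD linearZ. Qed.
HB.instance Definition _ := GRing.isLinear.Build S (corner d M) (corner d M') *:%R
  corner_map corner_map_linear.
End CornerMap.

Definition corner_functor d : module_functor R S.
Proof.
refine (@ModuleFunctor R S (fun M => corner d M)
  (fun M M' h => @corner_map d M M' h) _ _ _).
- by move=> M M' h k hk m; apply: val_inj; rewrite /= hk.
- by move=> M m; apply: val_inj.
- by move=> M M' M'' k h m; apply: val_inj.
Defined.

(** Since [1 = q + f g], a module [M] over [R] is recovered from [q M] and [g M], and [g M] is the
    part of [q M] fixed by the idempotent [g f]. The pairs below are thus a concrete model of the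
    tensor product of [R q] with [N] over [S]. *)
Definition induced_pred d N : {pred N * N} := fun p => chi d (g d * f d) *: p.2 == p.2.
Lemma induced_zmod d N : zmod_closed (@induced_pred d N).
Proof.
split=> [|x y]; rewrite /induced_pred !unfold_in /=; first by rewrite scaler0.
by move=> /eqP hx /eqP hy; rewrite scalerBr hx hy.
Qed.
HB.instance Definition _ d N :=
  GRing.isZmodClosed.Build (N * N)%type (@induced_pred d N) (@induced_zmod d N).

Definition induced d N := {p : N * N | p \in @induced_pred d N}.
HB.instance Definition _ d N := [isSub of induced d N for @sval _ _].
HB.instance Definition _ d N := [Choice of induced d N by <:].
HB.instance Definition _ d N := [SubChoice_isSubZmodule of induced d N by <:].

Lemma inducedP d N (p : N * N) :
  reflect (chi d (g d * f d) *: p.2 = p.2) (p \in @induced_pred d N).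
Proof. exact: eqP. Qed.
(** The block matrix of [r] with entries [q r q], [q r f], [g r q], [g r f], read in [S] through
    [chi]. *)
Definition induced_act d N r (p : N * N) : N * N :=
  (chi d r *: p.1 + chi d (r * f d) *: p.2,
   chi d (g d * r) *: p.1 + chi d (g d * r * f d) *: p.2).
Lemma induced_scale_subproof d N r (p : induced d N) :
  induced_act d r (val p) \in @induced_pred d N.
Proof.
apply/inducedP; rewrite /= scalerDr !scalerA.
have e b : chi d (g d * f d) * chi d (g d * b) = chi d (g d * b).
  have := fc_chi_mul d (g d) b.
  by rewrite fc_chig mul0r add0r.
by rewrite e -[X in chi d (_ * _) * chi d X]mulrA e mulrA.
Qed.
Definition induced_scale d N r (p : induced d N) : induced d N :=
  Sub (induced_act d r (val p)) (induced_scale_subproof r p).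
Lemma induced_scaleA d N s t (m : induced d N) :
  induced_scale s (induced_scale t m) = induced_scale (s * t) m.
Proof.
apply: val_inj; rewrite /= /induced_act /= !scalerDr !scalerA.
have e a b c : chi d a * chi d b + chi d (a * f d) * chi d (g d * b) = c ->
  forall n : N, (chi d a * chi d b) *: n + (chi d (a * f d) * chi d (g d * b)) *: n = c *: n.
  by move=> <- n; rewrite scalerDl.
congr (_, _); rewrite addrACA -!scalerDl; congr (_ *: _ + _ *: _).
- exact: fc_chi_mul.
- by rewrite -(mulrA (g d) t) fc_chi_mul mulrA.
- by rewrite fc_chi_mul mulrA.
- by rewrite -(mulrA (g d) t) fc_chi_mul !mulrA.
Qed.
Lemma induced_scale1 d N : left_id 1 (@induced_scale d N).
Proof.
move=> m; apply: val_inj; rewrite /= /induced_act mul1r mulr1.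
rewrite fc_chi1 fc_chif fc_chig !scale0r addr0 add0r scale1r.
by rewrite (inducedP _ _ (valP m)) -surjective_pairing.
Qed.
Lemma induced_scaleDr d N : right_distributive (@induced_scale d N) +%R.
Proof.
move=> s m n; apply: val_inj; rewrite /= /induced_act /= !scalerDr.
by congr (_, _); rewrite addrACA.
Qed.
Lemma induced_scaleDl d N (m : induced d N) :
  {morph (@induced_scale d N)^~ m : a b / a + b}.
Proof.
move=> s t; apply: val_inj; rewrite /= /induced_act /=.
by congr (_, _); rewrite ?mulrDr ?mulrDl !fc_chiD !scalerDl addrACA.
Qed.
HB.instance Definition _ d N := GRing.Zmodule_isLmodule.Build R (induced d N)
  (@induced_scaleA d N) (@induced_scale1 d N) (@induced_scaleDr d N) (@induced_scaleDl d N).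

Section InducedMap.
Context d N N' (h : {linear N -> N'}).
Lemma induced_map_subproof (m : induced d N) :
  (h (val m).1, h (val m).2) \in @induced_pred d N'.
Proof. by apply/inducedP; rewrite /= -linearZ (inducedP _ _ (valP m)). Qed.
Definition induced_map (m : induced d N) : induced d N' :=
  Sub (h (val m).1, h (val m).2) (induced_map_subproof m).
Lemma induced_map_linear : linear induced_map.
Proof.
move=> s m n; apply: val_inj; rewrite /= /induced_act /=.
by rewrite !linearD !linearZ.
Qed.
HB.instance Definition _ := GRing.isLinear.Build R (induced d N) (induced d N') *:%R
  induced_map induced_map_linear.
End InducedMap.

Definition induced_functor d : module_functor S R.
Proof.
refine (@ModuleFunctor S R (fun N => induced d N)
  (fun N N' h => @induced_map d N N' h) _ _ _).
- by move=> M M' h k hk m; apply: val_inj; rewrite /= !hk.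
- by move=> M m; apply: val_inj; rewrite /= -surjective_pairing.
- by move=> M M' M'' k h m; apply: val_inj.
Defined.

Definition counit1 d M (p : induced d (corner d M)) : M :=
  val (val p).1 + f d *: (val (val p).2 : M).
Lemma counit1_linear d M : linear (@counit1 d M).
Proof.
have e a (x : corner d M) : (q d * a * q d) *: (val x : M) = q d *: (a *: (val x : M)).
  by rewrite -!scalerA corner_qE.
have sp (u : M) : u = q d *: u + f d *: (g d *: u).
  by rewrite scalerA -scalerDl fc_split scale1r.
move=> r m n; rewrite /counit1 /= !fc_chiK !e.
rewrite -!scalerA (scalerA (q d) (g d)) (scalerA (q d) (g d)) !fc_qg.
rewrite [in RHS]scalerDr [in RHS](sp (r *: val (val m).1)).
rewrite [in RHS](sp (r *: (f d *: val (val m).2))).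
rewrite !(scalerDr (f d)) !addrA.
rewrite [LHS](ACl (1*4*2*5*3*6))/=.
by [].
Qed.
HB.instance Definition _ d M := GRing.isLinear.Build R _ M *:%R (@counit1 d M) (@counit1_linear d M).

Definition counit2 d N (p : corner d (induced d N)) : N := (val (val p)).1.
(** The second coordinate is reached only through [g], and [g q = 0]. *)
Lemma corner_snd d N (p : corner d (induced d N)) : (val (val p)).2 = 0.
Proof.
have /(congr1 val)/(congr1 snd) /= <- := corner_qE p.
by rewrite fc_gq mul0r fc_chi0 !scale0r addr0.
Qed.
Lemma counit2_linear d N : linear (@counit2 d N).
Proof.
move=> s m n; rewrite /counit2 /= fc_psiK.
by rewrite corner_snd scaler0 addr0.
Qed.
HB.instance Definition _ d N := GRing.isLinear.Build S _ N *:%R (@counit2 d N) (@counit2_linear d N).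

Lemma full_corner_morita d : morita_equivalent R S.
Proof.
exists (corner_functor d), (induced_functor d); split.
- exists (fun M => @counit1 d M); split=> [M|M M' h m]; last first.
    by rewrite /= /counit1 /= linearD linearZ.
  have qm (m : M) : q d *: m \in @fixed_by d M by apply/fixedP; rewrite scalerA fc_qq.
  have gm (m : M) : g d *: m \in @fixed_by d M by apply/fixedP; rewrite scalerA fc_qg.
  (* The inverse of the counit splits [m] as [q m + f g m]. *)
  pose pr m := (Sub (q d *: m) (qm m) : corner d M, Sub (g d *: m) (gm m) : corner d M).
  have hm (m : M) : pr m \in @induced_pred d (corner d M).
    apply/inducedP; apply: val_inj; rewrite /= fc_chiK scalerA.
    by rewrite -!mulrA fc_qg (mulrA (q d)) fc_qg mulrA fc_gfg.
  exists (fun m => Sub (pr m) (hm m) : induced d (corner d M)) => [[[m1 m2] hp]|m].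
    have h2 : g d *: (f d *: (val m2 : M)) = val m2.
      have /(congr1 val) /= := inducedP d _ hp.
      by rewrite fc_chiK -!scalerA corner_qE (scalerA (q d) (g d)) fc_qg.
    apply: val_inj; rewrite /= /counit1 /=; congr (_, _); apply: val_inj; rewrite /= scalerDr.
      by rewrite corner_qE scalerA fc_qf scale0r addr0.
    by rewrite h2 -[val m1]corner_qE scalerA fc_gq scale0r add0r.
  change (q d *: m + f d *: (g d *: m) = m).
  by rewrite scalerA -scalerDl fc_split scale1r.
- exists (fun N => @counit2 d N); split=> // N.
  have hn (n : N) : (n, 0) \in @induced_pred d N by apply/inducedP; rewrite scaler0.
  have hn' (n : N) : (Sub (n, 0) (hn n) : induced d N) \in @fixed_by d (induced d N).
    apply/fixedP; apply: val_inj; rewrite /= /induced_act /= !scaler0 !addr0.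
    by rewrite fc_gq fc_chi0 scale0r fc_psiK scale1r.
  exists (fun n => Sub (Sub (n, 0) (hn n)) (hn' n) : corner d (induced d N)) => [p|n] //.
  apply: val_inj; apply: val_inj.
  by rewrite /= /counit2 -(corner_snd p) -surjective_pairing.
Qed.

End FullCornerMorita.

Lemma fun_map_bijective (R S : pzRingType) (F : module_functor R S)
  (M N : lmodType R) (h : {linear M -> N}) : bijective h -> bijective (fun_map F h).
Proof.
case=> k hk kh; have k_lin : linear k := can2_linear hk kh.
pose k' : {linear N -> M} := HB.pack k (GRing.isLinear.Build R N M *:%R k k_lin).
exists (fun_map F k') => x.
  have /= <- := @fun_map_comp _ _ F _ _ _ k' h x.
  by rewrite -[RHS](@fun_map_id _ _ F M x); apply: fun_map_ext.
have /= <- := @fun_map_comp _ _ F _ _ _ h k' x.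
by rewrite -[RHS](@fun_map_id _ _ F N x); apply: fun_map_ext.
Qed.

Definition functor_comp (R S T : pzRingType) (F : module_functor R S)
  (F' : module_functor S T) : module_functor R T.
Proof.
refine (@ModuleFunctor R T (fun M => F' (F M))
  (fun M N h => fun_map F' (fun_map F h)) _ _ _).
- by move=> M N h k hk; do 2! apply: fun_map_ext.
- move=> M x; rewrite -[RHS](@fun_map_id _ _ F' (F M) x).
  by apply: fun_map_ext => y; rewrite fun_map_id.
- move=> M N P g f x /=.
  have /= <- := @fun_map_comp _ _ F' _ _ _ (fun_map F g) (fun_map F f) x.
  by apply: fun_map_ext => y; rewrite fun_map_comp.
Defined.

Lemma comp_iso_id_trans (R S T : pzRingType) (F : module_functor R S)
  (G : module_functor S R) (F' : module_functor S T) (G' : module_functor T S) :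
  comp_iso_id F G -> comp_iso_id F' G' ->
  comp_iso_id (functor_comp F F') (functor_comp G' G).
Proof.
move=> [eta [eta_bij eta_nat]] [eta' [eta'_bij eta'_nat]].
exists (fun M => eta M \o fun_map G (eta' (F M))); split=> [M|M N f x] /=.
  exact: (bij_comp (eta_bij M) (fun_map_bijective _ (eta'_bij _))).
have := eta_nat _ _ f (fun_map G (eta' (F M)) x) => /= <-; congr (eta N _).
have /= <- := @fun_map_comp _ _ G _ _ _ (eta' (F N)) (fun_map G' (fun_map F' (fun_map F f))) x.
have /= <- := @fun_map_comp _ _ G _ _ _ (fun_map F f) (eta' (F M)) x.
by apply: fun_map_ext => y /=; have := eta'_nat _ _ (fun_map F f) y.
Qed.

Lemma morita_trans (R S T : pzRingType) :
  morita_equivalent R S -> morita_equivalent S T -> morita_equivalent R T.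
Proof.
move=> [F [G [h1 h2]]] [F' [G' [h1' h2']]].
exists (functor_comp F F'), (functor_comp G' G).
by split; apply: comp_iso_id_trans.
Qed.

Lemma morita_sym (R S : pzRingType) : morita_equivalent R S -> morita_equivalent S R.
Proof. by move=> [F [G [h1 h2]]]; exists G, F. Qed.

(** * Shifting an edge: the algebras *)

Section Mx2.
Context (S : pzRingType).
Implicit Types a b c d : S.
Definition mx2 a b c d : 'M[S]_2 :=
  \matrix_(i, j) if i == 0 then (if j == 0 then a else b) else (if j == 0 then c else d).
Lemma mx2D a b c d a' b' c' d' :
  mx2 a b c d + mx2 a' b' c' d' = mx2 (a + a') (b + b') (c + c') (d + d').
Proof. by apply/matrixP=> i j; rewrite !mxE; do 2 case: ifP. Qed.
Lemma mx2N a b c d : - mx2 a b c d = mx2 (- a) (- b) (- c) (- d).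
Proof. by apply/matrixP=> i j; rewrite !mxE; do 2 case: ifP. Qed.
Lemma mx2M a b c d a' b' c' d' :
  mx2 a b c d * mx2 a' b' c' d' =
  mx2 (a * a' + b * c') (a * b' + b * d') (c * a' + d * c') (c * b' + d * d').
Proof.
apply/matrixP=> i j; rewrite !mxE !big_ord_recl big_ord0 addr0 !mxE /=.
by do 2 case: ifP.
Qed.
Lemma mx2_0 : mx2 0 0 0 0 = 0.
Proof. by apply/matrixP=> i j; rewrite !mxE; do 2 case: ifP. Qed.
Lemma mx2_scalar a : mx2 a 0 0 a = a%:M.
Proof. by apply/matrixP; move=> [[|[|//]] ?] [[|[|//]] ?]; rewrite !mxE. Qed.
Lemma mx2_sum (I : Type) (s : seq I) (A B C D : I -> S) :
  \sum_(i <- s) mx2 (A i) (B i) (C i) (D i) =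
  mx2 (\sum_(i <- s) A i) (\sum_(i <- s) B i) (\sum_(i <- s) C i) (\sum_(i <- s) D i).
Proof.
elim: s => [|x s IH]; first by rewrite !big_nil mx2_0.
by rewrite !big_cons IH mx2D.
Qed.
Lemma mx2_diag_sum (I : Type) (s : seq I) (A D : I -> S) :
  \sum_(i <- s) mx2 (A i) 0 0 (D i) = mx2 (\sum_(i <- s) A i) 0 0 (\sum_(i <- s) D i).
Proof. by rewrite mx2_sum !big1_eq. Qed.
Lemma mx2_00 a b c d : mx2 a b c d 0 0 = a. Proof. by rewrite mxE. Qed.
Lemma mx2_01 a b c d : mx2 a b c d 0 1 = b. Proof. by rewrite mxE. Qed.
Lemma mx2_10 a b c d : mx2 a b c d 1 0 = c. Proof. by rewrite mxE. Qed.
Lemma mx2_11 a b c d : mx2 a b c d 1 1 = d. Proof. by rewrite mxE. Qed.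
End Mx2.

(** Passing from [E] to [E'] cuts the algebra down by [q = 1 - f g], where [f] is [e0] and [g] its
    ghost: an edge coded [(h, false)] is [h] itself, one coded [(h, true)] is the path [h e0]. The
    source of [e0] disappears exactly when it emits nothing else. Collapses and column additions are
    both instances, so one Morita argument serves both. *)
Record shift (E E' : graph) (e0 : edge E) := Shift {
  sh_v : vert E' -> vert E;
  sh_iv : vert E -> option (vert E');
  sh_e : edge E' -> edge E * bool;
  sh_ie : edge E * bool -> option (edge E');
  sh_ab : src e0 != rng e0;
  sh_vK : pcancel sh_v sh_iv;
  sh_ivK : ocancel sh_iv sh_v;
  sh_eK : pcancel sh_e sh_ie;
  sh_ieK : ocancel sh_ie sh_e;
  sh_ivN : forall x, sh_iv x = None <-> x = src e0 /\ (forall h, src h = src e0 -> h = e0);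
  sh_ie0 : forall h, sh_ie (h, false) = None <-> h = e0 \/ sh_iv (rng h) = None;
  sh_ie1 : forall h, sh_ie (h, true) = None <-> rng h != src e0;
  sh_src : forall k, sh_v (src k) = src (sh_e k).1;
  sh_rng : forall k, sh_v (rng k) = if (sh_e k).2 then rng e0 else rng (sh_e k).1
}.

Lemma mem_tagged (T : eqType) (t : seq T) h i :
  ((h, i) \in [seq (h, i) | h <- t, i <- [:: false; true]]) = (h \in t).
Proof.
by elim: t => //= h' t IH; rewrite !inE IH !xpair_eqE; case: (h == h'); case: (i).
Qed.

Section ShiftEnum.
Context (E E' : graph) (e0 : edge E) (d : shift E' e0).
Local Notation a := (src e0).
Local Notation b := (rng e0).

Lemma sh_ba : (b == a) = false. Proof. by rewrite eq_sym (negbTE (sh_ab d)). Qed.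
Lemma sh_ivS x x' : sh_iv d x = Some x' -> sh_v d x' = x.
Proof. by move=> h; have := sh_ivK d x; rewrite h. Qed.
Lemma sh_ieS p k : sh_ie d p = Some k -> sh_e d k = p.
Proof. by move=> h; have := sh_ieK d p; rewrite h. Qed.
Lemma sh_eN0 k : (sh_e d k).1 != e0.
Proof.
apply/eqP => h; have := sh_eK d k; move: h; case: (sh_e d k) => h [] /= ->.
  by have /sh_ie1 -> : rng e0 != a by rewrite sh_ba.
by have /sh_ie0 -> : e0 = e0 \/ sh_iv d b = None by left.
Qed.
Lemma sh_eT k : (sh_e d k).2 -> rng (sh_e d k).1 = a.
Proof.
move=> h; have := sh_eK d k; move: h; case: (sh_e d k) => h [] //= _ kh.
by apply/eqP/negPn/negP => /(sh_ie1 d); rewrite kh.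
Qed.

Lemma sh_pair_enum (x : vert E) (x' : vert E') (t : seq (edge E)) :
  sh_v d x' = x -> uniq t -> (forall h, (h \in t) = (src h == x)) ->
  let s := pmap (sh_ie d) [seq (h, i) | h <- t, i <- [:: false; true]] in
  uniq s /\ forall k, (k \in s) = (src k == x').
Proof.
move=> xx' ut ht; split.
  apply: (pmap_uniq (sh_ieK d)); apply: allpairs_uniq => //.
  by move=> [h i] [h' i'].
move=> k; rewrite mem_pmap.
apply/mapP/eqP => [[[h i] hh kk]|sk].
  have := sh_src d k; rewrite (sh_ieS (esym kk)) /=; move: hh; rewrite mem_tagged ht => /eqP ->.
  by rewrite -xx' => /(pcan_inj (sh_vK d)).
exists (sh_e d k); last by rewrite (sh_eK d).
have : (sh_e d k).1 \in t by rewrite ht -sh_src sk xx'.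
by case: (sh_e d k) => h i /= hht; rewrite mem_tagged.
Qed.

Lemma sh_pair_sum (V : nmodType) (F : edge E' -> V) t :
  \sum_(k <- pmap (sh_ie d) [seq (h, i) | h <- t, i <- [:: false; true]]) F k =
  \sum_(h <- t) (oapp F 0 (sh_ie d (h, false)) + oapp F 0 (sh_ie d (h, true))).
Proof.
elim: t => [|h t IH] /=; first by rewrite !big_nil.
rewrite big_cons -IH; move: (sh_ie d (h, false)) (sh_ie d (h, true)) => [k|] [k'|] /=;
  by rewrite ?big_cons ?addr0 ?add0r ?addrA.
Qed.

Lemma sh_ieN h : h != e0 -> sh_ie d (h, false) = None -> sh_ie d (h, true) = None -> False.
Proof.
move=> h0 /sh_ie0[/eqP|/sh_ivN[ra _]]; first by rewrite (negbTE h0).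
by move=> /sh_ie1; rewrite ra eqxx.
Qed.

(** [e0] leaves no edge of [E'] behind, so it is put back by hand at its source; every other edge
    survives in at least one copy, by [sh_ieN]. *)
Lemma sh_out_enum x' s : uniq s -> s != [::] -> (forall k, (k \in s) = (src k == x')) ->
  exists t, [/\ uniq t, t != [::] & forall h, (h \in t) = (src h == sh_v d x')].
Proof.
move=> us s0 hs; pose t0 := undup [seq (sh_e d k).1 | k <- s].
exists ((if sh_v d x' == a then [:: e0] else [::]) ++ t0).
have e0t : e0 \notin t0.
  rewrite mem_undup; apply/negP => /mapP[k _ /eqP]; apply/negP.
  by rewrite eq_sym sh_eN0.
split.
- rewrite cat_uniq undup_uniq andbT; case: ifP => _ //=.
    by apply/hasPn => h ht; rewrite inE; apply: contraNN e0t => /eqP <-.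
  by apply/hasPn.
- case: s s0 {us hs e0t} @t0 => // k s _ t0.
  have : (sh_e d k).1 \in t0 by rewrite mem_undup /= mem_head.
  by case: (t0) => // h t _; rewrite -size_eq0 size_cat addnS.
move=> h; rewrite mem_cat mem_undup; apply/orP/eqP => [[]|hx].
- by case: eqP => // ->; rewrite inE => /eqP ->.
- by move=> /mapP[k]; rewrite hs => /eqP <- ->; rewrite sh_src.
have [he|h0] := eqVneq h e0; first by left; rewrite -hx he eqxx mem_head.
right; have kP k i : sh_ie d (h, i) = Some k -> h \in [seq (sh_e d k).1 | k <- s].
  move=> /sh_ieS kh; apply/mapP; exists k; last by rewrite kh.
  rewrite hs; apply/eqP/(pcan_inj (sh_vK d)).
  by rewrite sh_src kh.
case h1 : (sh_ie d (h, false)) => [k|]; first exact: kP h1.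
case h2 : (sh_ie d (h, true)) => [k|]; first exact: kP h2.
by case: (sh_ieN h0 h1 h2).
Qed.

Lemma sh_vert_enum s : uniq s -> (forall x', x' \in s) ->
  exists2 t, uniq t & (forall x, x \in t) /\ perm_eq s (pmap (sh_iv d) t).
Proof.
move=> us hs; pose t := undup (a :: [seq sh_v d x' | x' <- s]).
exists t; first exact: undup_uniq.
have ht x : x \in t.
  rewrite mem_undup inE; case e : (sh_iv d x) => [x'|].
    by rewrite -(sh_ivS e) map_f ?orbT.
  by move/sh_ivN: e => [-> _]; rewrite eqxx.
split=> //; apply: uniq_perm => //.
  exact/(pmap_uniq (sh_ivK d))/undup_uniq.
by move=> x'; rewrite hs mem_pmap; apply/esym/mapP; exists (sh_v d x'); rewrite ?(sh_vK d).
Qed.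

End ShiftEnum.

Section ShiftPsi.
Context (K : fieldType) (E E' : graph) (e0 : edge E) (d : shift E' e0).
Context (R : pzRingType) (c : K -> R) (lv : vert E -> R) (le lg : edge E -> R).
Hypothesis fam : leavitt_family c lv le lg 1.
Local Notation a := (src e0).
Local Notation b := (rng e0).
Local Notation f := (le e0).
Local Notation g := (lg e0).

Let lvM := lf_PP fam.
Let lv_le := lf_PX fam.
Let le_lv := lf_XP fam.
Let lv_lg := lf_PY fam.
Let lg_lv := lf_YP fam.
Let lg_le := lf_YX fam.
Let lv_sum := lf_reg fam.
Let lv_unit := lf_unit fam.

Let ba : (b == a) = false := sh_ba d.
Let q : R := 1 - f * g.

Lemma sh_gf : g * f = lv b. Proof. by rewrite lg_le eqxx. Qed.
Lemma sh_qf : q * f = 0.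
Proof. by rewrite mulrBl mul1r -mulrA sh_gf le_lv subrr. Qed.
Lemma sh_gq : g * q = 0.
Proof. by rewrite mulrBr mulr1 mulrA sh_gf lv_lg subrr. Qed.
Lemma sh_qq : q * q = q.
Proof. by rewrite {1}/q mulrBl mul1r -mulrA sh_gq mulr0 subr0. Qed.
Lemma sh_lv_q x : x != a -> lv x * q = lv x.
Proof.
by move=> xa; rewrite mulrBr mulr1 -(lv_le e0) !mulrA lvM (negbTE xa) !mul0r subr0.
Qed.
Lemma sh_fb x : f * lv x = if x == b then f else 0.
Proof. by rewrite -[in LHS]le_lv -mulrA lvM (eq_sym x); case: ifP; rewrite ?le_lv ?mulr0. Qed.
Lemma sh_lvf x : lv x * f = if x == a then f else 0.
Proof. by rewrite -[in LHS]lv_le mulrA lvM; case: eqP => [->|]; rewrite ?lv_le ?mul0r. Qed.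
Lemma sh_glv x : g * lv x = if x == a then g else 0.
Proof. by rewrite -[in LHS]lg_lv -mulrA lvM (eq_sym x); case: ifP; rewrite ?lg_lv ?mulr0. Qed.
Lemma sh_qlv x : q * lv x = lv x * q.
Proof.
rewrite mulrBl mulrBr mul1r mulr1 -mulrA sh_glv mulrA sh_lvf.
by case: ifP; rewrite ?mulr0 ?mul0r.
Qed.
Lemma sh_ff : f * f = 0.
Proof. by rewrite -{2}(lv_le e0) mulrA sh_fb eq_sym ba mul0r. Qed.
Lemma sh_gg : g * g = 0.
Proof. by rewrite -{2}(lv_lg e0) mulrA sh_glv ba mul0r. Qed.
Lemma sh_fq : f * q = f.
Proof. by rewrite mulrBr mulr1 mulrA sh_ff mul0r subr0. Qed.
Lemma sh_qg : q * g = g.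
Proof. by rewrite mulrBl mul1r -mulrA sh_gg mulr0 subr0. Qed.
Lemma sh_split : q + f * g = 1. Proof. by rewrite subrK. Qed.
Lemma sh_qle h : h != e0 -> q * le h = le h.
Proof. by move=> h0; rewrite mulrBl mul1r -mulrA lg_le eq_sym (negbTE h0) mulr0 subr0. Qed.
Lemma sh_lgq h : h != e0 -> lg h * q = lg h.
Proof. by move=> h0; rewrite mulrBr mulr1 mulrA lg_le (negbTE h0) mul0r subr0. Qed.
Lemma sh_gle h : h != e0 -> g * le h = 0.
Proof. by move=> h0; rewrite lg_le eq_sym (negbTE h0). Qed.
Lemma sh_lgf h : h != e0 -> lg h * f = 0.
Proof. by move=> h0; rewrite lg_le (negbTE h0). Qed.
Lemma sh_lef h : rng h != a -> le h * f = 0.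
Proof. by move=> ra; rewrite -le_lv -mulrA sh_lvf (negbTE ra) mulr0. Qed.
Lemma sh_glg h : rng h != a -> g * lg h = 0.
Proof. by move=> ra; rewrite -(lv_lg h) mulrA sh_glv (negbTE ra) mul0r. Qed.
Lemma sh_lvN x : sh_iv d x = None -> lv x * q = 0.
Proof.
move=> /sh_ivN[-> ha]; rewrite mulrBr mulr1 mulrA lv_le (@lv_sum a [:: e0]) //.
  by rewrite big_seq1 subrr.
by move=> e; rewrite inE; apply/eqP/eqP => [->|/ha].
Qed.
Lemma sh_leN h : sh_iv d (rng h) = None -> le h * q = 0.
Proof. by move=> hN; rewrite -le_lv -mulrA sh_lvN ?mulr0. Qed.
Lemma sh_lgN h : sh_iv d (rng h) = None -> q * lg h = 0.
Proof. by move=> hN; rewrite -(lv_lg h) mulrA sh_qlv sh_lvN ?mul0r. Qed.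

Let z k : R := if (sh_e d k).2 then f else q.
Let z' k : R := if (sh_e d k).2 then g else q.
(** Vertices, edges [h] and paths [h e0], cut down by [q]. Range projections still add up because
    [q + f g = 1] can be inserted between [h] and its ghost, which splits the contribution of [h]
    into those of its two copies. *)
Definition psiP x : R := lv (sh_v d x) * q.
Definition psiX k : R := le (sh_e d k).1 * z k.
Definition psiY k : R := z' k * lg (sh_e d k).1.

Lemma sh_psi_term h :
  oapp (fun k => psiX k * psiY k) 0 (sh_ie d (h, false)) +
  oapp (fun k => psiX k * psiY k) 0 (sh_ie d (h, true)) = le h * lg h * q.
Proof.
have [->|h0] := eqVneq h e0.
  have -> : sh_ie d (e0, false) = None by apply/sh_ie0; left.
  have -> : sh_ie d (e0, true) = None by apply/sh_ie1; rewrite ba.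
  by rewrite -mulrA sh_gq mulr0 addr0.
have -> : oapp (fun k => psiX k * psiY k) 0 (sh_ie d (h, false)) = le h * q * lg h.
  case e: (sh_ie d (h, false)) => [k|] /=.
    by rewrite /psiX /psiY /z /z' (sh_ieS e) /= mulrA -(mulrA (le h)) sh_qq.
  case/sh_ie0: e => [/eqP|/sh_leN ->]; first by rewrite (negbTE h0).
  by rewrite mul0r.
have -> : oapp (fun k => psiX k * psiY k) 0 (sh_ie d (h, true)) = le h * (f * g) * lg h.
  case e: (sh_ie d (h, true)) => [k|] /=.
    by rewrite /psiX /psiY /z /z' (sh_ieS e) /= !mulrA.
  by move/sh_ie1: e => ra; rewrite !mulrA sh_lef // !mul0r.
by rewrite -mulrDl -mulrDr sh_split mulr1 -mulrA sh_lgq.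
Qed.

Lemma psi_family : leavitt_family c psiP psiX psiY q.
Proof.
have cf k : c k * f = f * c k by rewrite (lf_cX fam).
have cg k : c k * g = g * c k by rewrite (lf_cY fam).
have cq k : c k * q = q * c k.
  by rewrite mulrBl mulrBr mul1r mulr1 mulrA cf -mulrA cg mulrA.
split.
- exact: lf_cD fam.
- exact: lf_cM fam.
- exact: lf_c1 fam.
- by move=> k v; rewrite /psiP mulrA (lf_cP fam) -mulrA cq mulrA.
- move=> k v; rewrite /psiX mulrA (lf_cX fam) -mulrA /z.
  by case: ifP; rewrite ?cf ?cq !mulrA.
- move=> k v; rewrite /psiY -mulrA -(lf_cY fam) !mulrA /z'.
  by case: ifP; rewrite ?cg ?cq.
- exact: sh_qq.
- by move=> v; rewrite /psiP mulrA sh_qlv -mulrA sh_qq.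
- by move=> v; rewrite /psiP -mulrA sh_qq.
- move=> v w; rewrite /psiP -mulrA (mulrA q) sh_qlv -mulrA sh_qq mulrA lvM.
  by rewrite (inj_eq (pcan_inj (sh_vK d))); case: ifP; rewrite ?mul0r.
- move=> k; rewrite /psiP /psiX sh_src -mulrA (mulrA q) (sh_qle (sh_eN0 d k)).
  by rewrite mulrA lv_le.
- move=> k; rewrite /psiX /psiP sh_rng /z; case: ifP => _.
    by rewrite -mulrA (mulrA f) le_lv sh_fq.
  by rewrite -mulrA -sh_qlv (mulrA q q) sh_qq sh_qlv mulrA le_lv.
- move=> k; rewrite /psiY /psiP sh_rng /z'; case: ifP => _.
    by rewrite -mulrA (mulrA q) sh_qg mulrA lv_lg.
  by rewrite -mulrA (mulrA q) sh_qq mulrA -sh_qlv -mulrA lv_lg.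
- move=> k; rewrite /psiY /psiP sh_src mulrA -(mulrA (z' k)) lg_lv -mulrA.
  by rewrite (sh_lgq (sh_eN0 d k)).
- move=> k k'; rewrite /psiX /psiY -mulrA (mulrA (lg _)) lg_le.
  have [<-|kk'] := eqVneq k k'.
    rewrite eqxx /psiP sh_rng /z /z'; case: ifP => [/sh_eT ->|_].
      by rewrite sh_lvf eqxx sh_gf sh_lv_q // ba.
    by rewrite mulrA sh_qlv -mulrA sh_qq.
  have [h|] := eqVneq; last by rewrite mul0r mulr0.
  (* Two distinct edges over the same [h] carry different flags, and then [g q = 0] or [q f = 0]
     makes the product vanish. *)
  have : (sh_e d k).2 != (sh_e d k').2.
    apply: contra kk' => /eqP h2; apply/eqP/(pcan_inj (sh_eK d)).
    by rewrite [LHS]surjective_pairing h h2 -surjective_pairing.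
  rewrite /z /z'; have := @sh_eT _ _ _ d k; have := @sh_eT _ _ _ d k'; rewrite h.
  case: (sh_e d k).2; case: (sh_e d k').2 => // r1 r2 _.
    by rewrite r2 // mulrA sh_glv eqxx sh_gq.
  by rewrite r1 // sh_lvf eqxx sh_qf.
- move=> x' s us s0 hs; have [t [ut t0 ht]] := sh_out_enum d us s0 hs.
  have [us' hs'] := @sh_pair_enum _ _ _ d _ _ _ (erefl _) ut ht.
  have pss := uniq_perm us us' (fun k => etrans (hs k) (esym (hs' k))).
  rewrite (perm_big _ pss) sh_pair_sum.
  rewrite /psiP (lv_sum ut t0 ht) mulr_suml; apply: eq_bigr => h _.
  by rewrite sh_psi_term.
- move=> s us hs.
  have [t ut [ht hp]] := sh_vert_enum d us hs.
  rewrite (perm_big _ hp) big_pmap -[LHS]mul1r (lv_unit ut ht) mulr_suml.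
  apply: eq_bigr => x _.
  case ivx : (sh_iv d x) => [x'|] /=; first by rewrite /psiP (sh_ivS ivx).
  by rewrite sh_lvN.
Qed.

End ShiftPsi.

Section ShiftTheta.
Context (K : fieldType) (E E' : graph) (e0 : edge E) (d : shift E' e0).
Context (S : pzRingType) (c : K -> S) (lv : vert E' -> S) (le lg : edge E' -> S).
Hypothesis fam : leavitt_family c lv le lg 1.
Local Notation a := (src e0).
Local Notation b := (rng e0).

Definition theta_v x : S := oapp lv 0 (sh_iv d x).
Definition theta_e h i : S := oapp le 0 (sh_ie d (h, i)).
Definition theta_g h i : S := oapp lg 0 (sh_ie d (h, i)).
Local Notation V := theta_v.
Local Notation B := (theta_v b).
(** The matrices with entries [q x q], [q x f], [g x q], [g x f] of the generators [x], rewritten in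
    the generators of [E']. The unit of the image is [theta_eps], because [g f] is the range of [e0]
    rather than 1. *)
Definition thetaP x := mx2 (V x) 0 0 (if x == a then B else 0).
Definition thetaX h :=
  if h == e0 then mx2 0 0 B 0 else mx2 (theta_e h false) (theta_e h true) 0 0.
Definition thetaY h :=
  if h == e0 then mx2 0 B 0 0 else mx2 (theta_g h false) 0 (theta_g h true) 0.
Definition theta_eps := mx2 1 0 0 B.

Lemma theta_vM x y : V x * V y = if x == y then V x else 0.
Proof.
rewrite /V; case ex: (sh_iv d x) => [x'|]; case ey: (sh_iv d y) => [y'|] /=;
  rewrite ?mul0r ?mulr0.
- rewrite (lf_PP fam) -(inj_eq (pcan_inj (sh_vK d))).
  by rewrite (sh_ivS ex) (sh_ivS ey).
- by case: eqP => // xy; move: ey; rewrite -xy ex.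
- by case: ifP.
- by case: ifP.
Qed.
Lemma theta_v_sh x' : V (sh_v d x') = lv x'.
Proof. by rewrite /V (sh_vK d). Qed.
Lemma theta_ve h i : V (src h) * theta_e h i = theta_e h i.
Proof.
rewrite /theta_e; case e: (sh_ie d (h, i)) => [k|] /=; last by rewrite mulr0.
by have := sh_src d k; rewrite (sh_ieS e) /= => <-; rewrite theta_v_sh (lf_PX fam).
Qed.
Lemma theta_gv h i : theta_g h i * V (src h) = theta_g h i.
Proof.
rewrite /theta_g; case e: (sh_ie d (h, i)) => [k|] /=; last by rewrite mul0r.
by have := sh_src d k; rewrite (sh_ieS e) /= => <-; rewrite theta_v_sh (lf_YP fam).
Qed.
Lemma theta_rng h i k : sh_ie d (h, i) = Some k ->
  lv (rng k) = if i then B else V (rng h).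
Proof. by move=> e; rewrite -theta_v_sh sh_rng (sh_ieS e) /=; case: ifP. Qed.
Lemma theta_e0v h : theta_e h false * V (rng h) = theta_e h false.
Proof.
rewrite /theta_e; case e: (sh_ie d (h, false)) => [k|] /=; last by rewrite mul0r.
by rewrite -(theta_rng e) (lf_XP fam).
Qed.
Lemma theta_vg0 h : V (rng h) * theta_g h false = theta_g h false.
Proof.
rewrite /theta_g; case e: (sh_ie d (h, false)) => [k|] /=; last by rewrite mulr0.
by rewrite -(theta_rng e) (lf_PY fam).
Qed.
Lemma theta_e1v h : theta_e h true * (if rng h == a then B else 0) = theta_e h true.
Proof.
rewrite /theta_e; case e: (sh_ie d (h, true)) => [k|] /=; last by rewrite mul0r.
have [_|/(sh_ie1 d)] := eqVneq; last by rewrite e.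
by rewrite -(theta_rng e) (lf_XP fam).
Qed.
Lemma theta_vg1 h : (if rng h == a then B else 0) * theta_g h true = theta_g h true.
Proof.
rewrite /theta_g; case e: (sh_ie d (h, true)) => [k|] /=; last by rewrite mulr0.
have [_|/(sh_ie1 d)] := eqVneq; last by rewrite e.
by rewrite -(theta_rng e) (lf_PY fam).
Qed.
Lemma theta_ge h h' i i' :
  theta_g h i * theta_e h' i' =
  if (h == h') && (i == i') then oapp (fun k => lv (rng k)) 0 (sh_ie d (h, i)) else 0.
Proof.
rewrite /theta_g /theta_e; case e: (sh_ie d (h, i)) => [k|] /=; last by rewrite mul0r; case: ifP.
case e': (sh_ie d (h', i')) => [k'|] /=.
  rewrite (lf_YX fam) -(inj_eq (pcan_inj (sh_eK d))).
  by rewrite (sh_ieS e) (sh_ieS e') xpair_eqE.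
by rewrite mulr0; case: ifP => // /andP[/eqP hh /eqP ii]; move: e; rewrite hh ii e'.
Qed.

Lemma theta_family : leavitt_family (fun k => mx2 (c k) 0 0 (c k)) thetaP thetaX thetaY theta_eps.
Proof.
have cv k x : c k * V x = V x * c k.
  by rewrite /V; case: (sh_iv d x) => [x'|] /=; rewrite ?mul0r ?mulr0 ?(lf_cP fam).
have ce k h i : c k * theta_e h i = theta_e h i * c k.
  by rewrite /theta_e; case: (sh_ie _ _) => [x'|] /=; rewrite ?mul0r ?mulr0 ?(lf_cX fam).
have cg k h i : c k * theta_g h i = theta_g h i * c k.
  by rewrite /theta_g; case: (sh_ie _ _) => [x'|] /=; rewrite ?mul0r ?mulr0 ?(lf_cY fam).
have ab : (a == b) = false by rewrite (negbTE (sh_ab d)).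
have ba : (b == a) = false by rewrite eq_sym.
have BB : B * B = B by rewrite theta_vM eqxx.
split.
- by move=> k l; rewrite mx2D !addr0 (lf_cD fam).
- by move=> k l; rewrite mx2M !(mul0r, mulr0, addr0, add0r) (lf_cM fam).
- by rewrite (lf_c1 fam) mx2_scalar.
- move=> k x; rewrite !mx2M !(mul0r, mulr0, addr0, add0r) cv.
  by case: ifP => _; rewrite ?mul0r ?mulr0 ?cv.
- by move=> k h; rewrite /thetaX; case: ifP => _;
    rewrite !mx2M !(mul0r, mulr0, addr0, add0r) ?cv ?ce.
- by move=> k h; rewrite /thetaY; case: ifP => _;
    rewrite !mx2M !(mul0r, mulr0, addr0, add0r) ?cv ?cg.
- by rewrite mx2M !(mul0r, mulr0, addr0, add0r) mul1r BB.
- move=> x; rewrite /thetaP mx2M !(mul0r, mulr0, addr0, add0r) mul1r.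
  by case: ifP; rewrite ?mulr0 ?BB.
- move=> x; rewrite /thetaP mx2M !(mul0r, mulr0, addr0, add0r) mulr1.
  by case: ifP; rewrite ?mul0r ?BB.
- move=> x y; rewrite /thetaP mx2M !(mul0r, mulr0, addr0, add0r) theta_vM.
  case: eqP => [->|xy]; first by case: ifP; rewrite ?mul0r ?BB.
  case: eqP => [xa|_]; last by rewrite mul0r mx2_0.
  by case: eqP => [ya|_]; rewrite ?mulr0 ?mx2_0 //; case: xy; rewrite xa ya.
- move=> h; rewrite /thetaX /thetaP; case: (eqVneq h e0) => [->|_].
    by rewrite mx2M !(mul0r, mulr0, addr0, add0r) eqxx BB.
  by rewrite mx2M !(mul0r, mulr0, addr0, add0r) !theta_ve.
- move=> h; rewrite /thetaX /thetaP; case: (eqVneq h e0) => [->|_].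
    by rewrite mx2M !(mul0r, mulr0, addr0, add0r) BB.
  by rewrite mx2M !(mul0r, mulr0, addr0, add0r) theta_e0v theta_e1v.
- move=> h; rewrite /thetaY /thetaP; case: (eqVneq h e0) => [->|_].
    by rewrite mx2M !(mul0r, mulr0, addr0, add0r) BB.
  by rewrite mx2M !(mul0r, mulr0, addr0, add0r) theta_vg0 theta_vg1.
- move=> h; rewrite /thetaY /thetaP; case: (eqVneq h e0) => [->|_].
    by rewrite mx2M !(mul0r, mulr0, addr0, add0r) eqxx BB.
  by rewrite mx2M !(mul0r, mulr0, addr0, add0r) !theta_gv.
- move=> h h'; rewrite /thetaX /thetaY /thetaP; have [->|h0] := eqVneq h e0.
    rewrite (eq_sym e0); case: eqP => h'0; rewrite mx2M !(mul0r, mulr0, addr0, add0r) ?mx2_0 //.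
    by rewrite BB ba.
  have [->|h'0] := eqVneq h' e0.
    by rewrite (negbTE h0) mx2M !(mul0r, mulr0, addr0, add0r) mx2_0.
  rewrite mx2M !(mul0r, mulr0, addr0, add0r) !theta_ge !andbF !andbT.
  case: eqP => [_|_] //=; last by rewrite mx2_0.
  congr (mx2 _ 0 0 _).
    case e: (sh_ie d _) => [k|] /=; first by rewrite (theta_rng e).
    by case/sh_ie0: e => [/eqP|]; rewrite ?(negbTE h0) // /V => ->.
  case e: (sh_ie d _) => [k|] /=.
    rewrite (theta_rng e); have [_|/(sh_ie1 d)] := eqVneq (rng h) a => //.
    by rewrite e.
  by move/sh_ie1: e => /negbTE ->.
- move=> x t ut t0 ht.
  pose s := pmap (sh_ie d) [seq (h, i) | h <- t, i <- [:: false; true]].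
  have -> : \sum_(h <- t) thetaX h * thetaY h =
     mx2 (\sum_(h <- t) (oapp (fun k => le k * lg k) 0 (sh_ie d (h, false)) +
                         oapp (fun k => le k * lg k) 0 (sh_ie d (h, true))))
         0 0 (if x == a then B else 0).
    (* Only the term of [e0] contributes to the lower right entry, and [e0] occurs in [t] exactly
       when [x] is its source. *)
    have -> : (if x == a then B else 0) = \sum_(h <- t) (if h == e0 then B else 0).
      rewrite -big_mkcond -big_filter eq_sym -ht.
      have [e0t|e0t] := boolP (e0 \in t).
        by rewrite filter_pred1_uniq // big_seq1.
      rewrite (_ : filter _ _ = [::]) ?big_nil //; apply/eqP.
      by rewrite -size_eq0 size_filter -leqn0 leqNgt -has_count has_pred1.
    rewrite -mx2_diag_sum; apply: eq_bigr => h _.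
    rewrite /thetaX /thetaY; case: (eqVneq h e0) => [->|h0].
      have -> : sh_ie d (e0, false) = None by apply/sh_ie0; left.
      have -> : sh_ie d (e0, true) = None by apply/sh_ie1; rewrite ba.
      by rewrite mx2M !(mul0r, mulr0, addr0, add0r) BB.
    rewrite mx2M !(mul0r, mulr0, addr0, add0r) /theta_e /theta_g; congr (mx2 (_ + _) _ _ _).
      by case: (sh_ie d _) => [k|] /=; rewrite ?mul0r.
    by case: (sh_ie d _) => [k|] /=; rewrite ?mul0r.
  congr (mx2 _ 0 0 _); rewrite -sh_pair_sum -/s.
  rewrite /V; case ex: (sh_iv d x) => [x'|] /=; last first.
    case/sh_ivN: ex => xa hx.
    have te0 h : h \in t -> h = e0 by rewrite ht xa => /eqP/hx.
    rewrite sh_pair_sum big_seq big1 // => h /te0 ->.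
    have -> : sh_ie d (e0, false) = None by apply/sh_ie0; left.
    have -> : sh_ie d (e0, true) = None by apply/sh_ie1; rewrite ba.
    by rewrite addr0.
  have [us hs] := sh_pair_enum (sh_ivS ex) ut ht.
  apply: (lf_reg fam us _ hs).
  (* A vertex that survives in [E'] cannot have [e0] as its only outgoing edge. *)
  have /allPn[h ht' h0] : ~~ all (pred1 e0) t.
    apply/negP => /allP hall.
    have xa : x = a.
      by case: t t0 ht {ut us hs s} hall => // h t _ /(_ h); rewrite mem_head => /esym/eqP <- /(_ h (mem_head _ _))/eqP ->.
    suff : sh_iv d x = None by rewrite ex.
    by apply/sh_ivN; split=> // h ha; apply/eqP/hall; rewrite ht ha xa.
  have ks i k : sh_ie d (h, i) = Some k -> s != [::].
    move=> e; have : k \in s by rewrite mem_pmap -e map_f // mem_tagged.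
    by case: (s).
  case h1 : (sh_ie d (h, false)) => [k|]; first exact: ks h1.
  case h2 : (sh_ie d (h, true)) => [k|]; first exact: ks h2.
  by case: (sh_ieN h0 h1 h2).
- move=> t ut ht; rewrite mx2_diag_sum; congr (mx2 _ 0 0 _).
    rewrite -big_pmap; apply: (lf_unit fam).
      exact: pmap_uniq (sh_ivK d) _ _.
    by move=> x'; rewrite mem_pmap; apply/mapP; exists (sh_v d x'); rewrite ?(sh_vK d).
  rewrite -big_mkcond -big_filter filter_pred1_uniq // big_seq1 //.
Qed.
Lemma theta_eps_comm k :
  theta_eps * mx2 (c k) 0 0 (c k) = mx2 (c k) 0 0 (c k) * theta_eps.
Proof.
rewrite !mx2M !(mul0r, mulr0, addr0, add0r) mul1r mulr1 /V.
by congr (mx2 _ 0 0 _); case: (sh_iv d _) => [x'|] /=; rewrite ?mul0r ?mulr0 ?(lf_cP fam).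
Qed.
End ShiftTheta.

Lemma mx2_mulE (S : pzRingType) (A C : 'M[S]_2) i j :
  (A * C) i j = A i 0 * C 0 j + A i 1 * C 1 j.
Proof.
rewrite !mxE !big_ord_recl big_ord0 addr0; congr (_ + A _ _ * C _ _); exact: val_inj.
Qed.

Section ShiftCorner.
Context (K : fieldType) (E E' : graph) (e0 : edge E) (d : shift E' e0).
Context (R : pzRingType) (c : K -> R) (lv : vert E -> R) (le lg : edge E -> R).
Hypothesis fam : leavitt_family c lv le lg 1.
Context (S : pzRingType) (c' : K -> S) (lv' : vert E' -> S) (le' lg' : edge E' -> S).
Hypothesis fam' : leavitt_family c' lv' le' lg' 1.
Hypothesis indR : forall P : R -> Prop,
  (forall x y, P x -> P y -> P (x + y)) -> (forall x y, P x -> P y -> P (x * y)) ->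
  (forall k, P (c k)) -> (forall v, P (lv v)) ->
  (forall e, P (le e)) -> (forall e, P (lg e)) -> forall x, P x.
Hypothesis indS : forall P : S -> Prop,
  (forall x y, P x -> P y -> P (x + y)) -> (forall x y, P x -> P y -> P (x * y)) ->
  (forall k, P (c' k)) -> (forall v, P (lv' v)) ->
  (forall e, P (le' e)) -> (forall e, P (lg' e)) -> forall x, P x.

Local Notation f := (le e0).
Local Notation g := (lg e0).
Local Notation q := (1 - f * g).
Local Notation B := (theta_v d lv' (rng e0)).

Context (psi : S -> R) (theta : R -> 'M[S]_2).
Hypothesis psiD : forall s t, psi (s + t) = psi s + psi t.
Hypothesis psiM : forall s t, psi (s * t) = psi s * psi t.
Hypothesis psi_v : forall x, psi (lv' x) = lv (sh_v d x) * q.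
Hypothesis psi_e : forall k, psi (le' k) = le (sh_e d k).1 * (if (sh_e d k).2 then f else q).
Hypothesis psi_g : forall k, psi (lg' k) = (if (sh_e d k).2 then g else q) * lg (sh_e d k).1.
Hypothesis psi_c : forall k, psi (c' k) = q * c k.
Hypothesis thetaD : forall s t, theta (s + t) = theta s + theta t.
Hypothesis thetaM : forall s t, theta (s * t) = theta s * theta t.
Hypothesis theta_v' : forall x, theta (lv x) = thetaP d lv' x.
Hypothesis theta_e' : forall h, theta (le h) = thetaX d lv' le' h.
Hypothesis theta_g' : forall h, theta (lg h) = thetaY d lv' lg' h.
Hypothesis theta_c : forall k, theta (c k) = theta_eps d lv' * mx2 (c' k) 0 0 (c' k).

Let BB : B * B = B. Proof. by rewrite (theta_vM d fam') eqxx. Qed.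
Let simp := (mul0r, mulr0, addr0, add0r).

Lemma sc_thetaq : theta q = mx2 1 0 0 0.
Proof.
have theta0 : theta 0 = 0 by apply: (addIr (theta 0)); rewrite -thetaD !add0r.
have thetaN x : theta (- x) = - theta x.
  by apply: (addIr (theta x)); rewrite -thetaD !addNr.
have theta1 : theta 1 = theta_eps d lv'.
  by rewrite -(lf_c1 fam) theta_c (lf_c1 fam') mx2_scalar mulr1.
rewrite thetaD thetaN theta1 thetaM theta_e' theta_g' /thetaX /thetaY eqxx.
by rewrite mx2M !simp mx2N mx2D !oppr0 !simp BB subrr.
Qed.

(** Reading off the upper left entry of [theta] is therefore a left inverse [chi] of [psi]. *)
Lemma sc_theta_psi s : theta (psi s) = mx2 s 0 0 0.
Proof.
elim/indS: s => [x y hx hy|x y hx hy|k|x|k|k].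
- by rewrite psiD thetaD hx hy mx2D !simp.
- by rewrite psiM thetaM hx hy mx2M !simp.
- by rewrite psi_c thetaM sc_thetaq theta_c mulrA !mx2M !simp !mul1r.
- by rewrite psi_v thetaM sc_thetaq theta_v' mx2M !simp mulr1 theta_v_sh.
- rewrite psi_e thetaM theta_e' /thetaX (negbTE (sh_eN0 d k)).
  case ek : (sh_e d k) => [h i] /=; have iek := sh_eK d k; rewrite ek in iek.
  case: i ek iek => ek iek; last by rewrite sc_thetaq mx2M !simp mulr1 /theta_e iek.
  rewrite theta_e' /thetaX eqxx mx2M !simp /theta_e iek /=.
  by rewrite -(theta_rng lv' iek) (lf_XP fam').
- rewrite psi_g thetaM theta_g' /thetaY (negbTE (sh_eN0 d k)).
  case ek : (sh_e d k) => [h i] /=; have iek := sh_eK d k; rewrite ek in iek.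
  case: i ek iek => ek iek; last by rewrite sc_thetaq mx2M !simp mul1r /theta_g iek.
  rewrite theta_g' /thetaY eqxx mx2M !simp /theta_g iek /=.
  by rewrite -(theta_rng lv' iek) (lf_PY fam').
Qed.

Let ba := sh_ba d.
Let psi0 : psi 0 = 0.
Proof. by apply: (addIr (psi 0)); rewrite -psiD !add0r. Qed.
Let psi_B : psi B = lv (rng e0).
Proof.
rewrite /theta_v; case e: (sh_iv d _) => [x'|] /=.
  by rewrite psi_v (sh_ivS e) (sh_lv_q fam) // ba.
by move: e => /sh_ivN[/eqP]; rewrite ba.
Qed.

(** The corner property is the first identity; products mix the four entries, so the induction on
    [r] carries them together. *)
Lemma sc_psi_theta r :
  [/\ psi (theta r 0 0) = q * r * q, psi (theta r 0 1) = q * r * f,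
      psi (theta r 1 0) = g * r * q & psi (theta r 1 1) = g * r * f].
Proof.
have qf := sh_qf e0 fam; have gq := sh_gq e0 fam; have gf := sh_gf e0 fam.
have cq k : c k * q = q * c k.
  rewrite mulrBl mulrBr mul1r mulr1 mulrA (lf_cX fam) -mulrA (lf_cY fam).
  by rewrite mulrA.
elim/indR: r => [x y [x1 x2 x3 x4] [y1 y2 y3 y4]|x y [x1 x2 x3 x4] [y1 y2 y3 y4]|k|x|h|h].
- have D u w : u * (x + y) * w = u * x * w + u * y * w by rewrite mulrDr mulrDl.
  by rewrite thetaD !mxE !psiD x1 x2 x3 x4 y1 y2 y3 y4 !D.
- have e u w : u * x * q * (q * y * w) + u * x * f * (g * y * w) = u * (x * y) * w.
    rewrite -!mulrA (mulrA q q) (sh_qq e0 fam) (mulrA f g) -!mulrDr -(mulrDl q _ (y * w)).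
    by rewrite (sh_split e0 le lg) mul1r.
  by rewrite thetaM !mx2_mulE !psiD !psiM x1 x2 x3 x4 y1 y2 y3 y4 !e.
- rewrite theta_c mx2M !simp mul1r mx2_00 mx2_01 mx2_10 mx2_11 psi0 psiM psi_B !psi_c.
  split.
  + by rewrite -mulrA cq mulrA (sh_qq e0 fam).
  + by rewrite -mulrA (lf_cX fam) mulrA qf mul0r.
  + by rewrite -mulrA cq mulrA gq mul0r.
  + by rewrite mulrA (sh_lv_q fam) ?ba // -mulrA (lf_cX fam) mulrA gf.
- rewrite theta_v' mx2_00 mx2_01 mx2_10 mx2_11 psi0 (sh_qlv e0 fam); split.
  + rewrite -mulrA (sh_qq e0 fam) /theta_v; case e: (sh_iv d x) => [x'|] /=.
      by rewrite psi_v (sh_ivS e).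
    by rewrite psi0 (sh_lvN fam e).
  + by rewrite -mulrA qf mulr0.
  + by rewrite (sh_glv e0 fam); case: ifP; rewrite ?mul0r.
  + by rewrite (sh_glv e0 fam); case: ifP; rewrite ?psi0 ?mul0r // gf psi_B.
- rewrite theta_e' /thetaX; case: (eqVneq h e0) => [->|h0].
    rewrite mx2_00 mx2_01 mx2_10 mx2_11 psi0 qf gf psi_B !mul0r (sh_lv_q fam) ?ba //.
    by split=> //; rewrite (sh_lvf e0 fam) ba.
  rewrite mx2_00 mx2_01 mx2_10 mx2_11 psi0 (sh_qle fam h0) (sh_gle fam h0) !mul0r.
  split=> //; rewrite /theta_e; case e: (sh_ie d _) => [k|] /=.
  + by rewrite psi_e (sh_ieS e).
  + case/sh_ie0: e => [/eqP|/(sh_leN fam) ->] //; by rewrite (negbTE h0).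
  + by rewrite psi_e (sh_ieS e).
  + by move/sh_ie1: e => ra; rewrite psi0 (sh_lef fam ra).
- rewrite theta_g' /thetaY; case: (eqVneq h e0) => [->|h0].
    rewrite mx2_00 mx2_01 mx2_10 mx2_11 psi0 (sh_qg d fam) gf psi_B (sh_gg d fam) !mul0r gq.
    by split.
  rewrite mx2_00 mx2_01 mx2_10 mx2_11 psi0 -!mulrA (sh_lgq fam h0) (sh_lgf fam h0) !mulr0.
  split=> //; rewrite /theta_g; case e: (sh_ie d _) => [k|] /=.
  + by rewrite psi_g (sh_ieS e).
  + case/sh_ie0: e => [/eqP|/(sh_lgN fam) ->] //; by rewrite (negbTE h0).
  + by rewrite psi_g (sh_ieS e).
  + by move/sh_ie1: e => ra; rewrite psi0 (sh_glg fam ra).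
Qed.

Lemma shift_full_corner : exists _ : full_corner R S, True.
Proof.
have psi1 : psi 1 = q by rewrite -(lf_c1 fam') psi_c (lf_c1 fam) mulr1.
have hq := (sh_fq d fam, sh_qg d fam, sh_qf e0 fam, sh_gq e0 fam, sh_split e0 le lg).
pose chi r := theta r 0 0.
have chiD x y : chi (x + y) = chi x + chi y by rewrite /chi thetaD mxE.
have psiK x : chi (psi x) = x by rewrite /chi sc_theta_psi mx2_00.
have chiK r : psi (chi r) = psi 1 * r * psi 1.
  by rewrite psi1; case: (sc_psi_theta r).
have h1 : psi 1 + f * g = 1 by rewrite psi1 hq.
have h2 : f * psi 1 = f by rewrite psi1 hq.
have h3 : psi 1 * g = g by rewrite psi1 hq.
have h4 : psi 1 * f = 0 by rewrite psi1 hq.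
have h5 : g * psi 1 = 0 by rewrite psi1 hq.
by exists (FullCorner psiD psiM chiD psiK chiK h1 h2 h3 h4 h5).
Qed.
End ShiftCorner.

Lemma lpa_family (K : fieldType) (E : graph) :
  leavitt_family (@lk K E) (@lv K E) (@le K E) (@lg K E) 1.
Proof.
split.
- exact: lkD.
- exact: lkM.
- exact: lk1.
- by move=> *; apply: lk_comm.
- by move=> *; apply: lk_comm.
- by move=> *; apply: lk_comm.
- by rewrite mulr1.
- by move=> v; rewrite mul1r.
- by move=> v; rewrite mulr1.
- exact: lvM.
- exact: lv_le.
- exact: le_lv.
- exact: lv_lg.
- exact: lg_lv.
- exact: lg_le.
- exact: lv_sum.
- exact: lv_unit.
Qed.

Lemma shift_morita (K : fieldType) (E E' : graph) (e0 : edge E) :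
  shift E' e0 -> morita_equivalent (lpa K E) (lpa K E').
Proof.
move=> d; have fam := lpa_family K E; have fam' := lpa_family K E'.
have fp := psi_family d fam; have ft := theta_family d fam'.
have comq k : (1 - le K e0 * lg K e0) * lk E k = lk E k * (1 - le K e0 * lg K e0).
  exact/esym/lk_comm.
have comt := theta_eps_comm d fam'.
have [fc _] := shift_full_corner fam fam' (@lpa_ind K E) (@lpa_ind K E')
  (lpa_mapD fp comq) (lpa_mapM fp comq) (lpa_map_lv fp comq) (lpa_map_le fp comq)
  (lpa_map_lg fp comq) (lpa_map_lk fp comq) (lpa_mapD ft comt) (lpa_mapM ft comt)
  (lpa_map_lv ft comt) (lpa_map_le ft comt) (lpa_map_lg ft comt) (lpa_map_lk ft comt).
exact: full_corner_morita fc.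
Qed.

(** * Isomorphic graphs and move equivalence *)

Lemma graph_iso_refl E : graph_iso E E.
Proof. by exists id, id; split=> //; exists id. Qed.

Lemma graph_iso_sym E F : graph_iso E F -> graph_iso F E.
Proof.
move=> [phi [psi [[phi' h1 h2] [psi' h3 h4] hs hr]]].
exists phi', psi'; split; [by exists phi|by exists psi| |] => e.
  by rewrite -[LHS]h1 -hs h4.
by rewrite -[LHS]h1 -hr h4.
Qed.

Lemma graph_iso_trans E F G : graph_iso E F -> graph_iso F G -> graph_iso E G.
Proof.
move=> [phi [psi [h1 h2 h3 h4]]] [phi' [psi' [h1' h2' h3' h4']]].
exists (phi' \o phi), (psi' \o psi); split; try exact: bij_comp; move=> e /=.
  by rewrite h3' h3.
by rewrite h4' h4.
Qed.

Section IsoFamily.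
Context (K : fieldType) (E F : graph) (phi : vert E -> vert F) (psi : edge E -> edge F).
Hypotheses (phi_bij : bijective phi) (psi_bij : bijective psi).
Hypotheses (hs : forall e, src (psi e) = phi (src e)) (hr : forall e, rng (psi e) = phi (rng e)).
Context (T : pzRingType) (c : K -> T) (lv : vert F -> T) (le lg : edge F -> T).
Hypothesis fam : leavitt_family c lv le lg 1.

Lemma iso_family : leavitt_family c (lv \o phi) (le \o psi) (lg \o psi) 1.
Proof.
have [phi_inj psi_inj] := (bij_inj phi_bij, bij_inj psi_bij).
split => /=.
- exact: lf_cD fam.
- exact: lf_cM fam.
- exact: lf_c1 fam.
- by move=> *; apply: lf_cP fam _ _.
- by move=> *; apply: lf_cX fam _ _.
- by move=> *; apply: lf_cY fam _ _.
- by rewrite mulr1.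
- by move=> v; rewrite mul1r.
- by move=> v; rewrite mulr1.
- by move=> v w; rewrite (lf_PP fam) (inj_eq phi_inj).
- by move=> e; rewrite -hs (lf_PX fam).
- by move=> e; rewrite -hr (lf_XP fam).
- by move=> e; rewrite -hr (lf_PY fam).
- by move=> e; rewrite -hs (lf_YP fam).
- by move=> e f; rewrite (lf_YX fam) (inj_eq psi_inj) hr.
- move=> v s us s0 sv; rewrite (@lf_reg _ _ _ _ _ _ _ _ fam _ (map psi s)) ?big_map //.
  + by rewrite map_inj_uniq.
  + by case: s s0 {us sv}.
  + have [psi' h1 h2] := psi_bij.
    by move=> e; rewrite -[e]h2 (mem_map psi_inj) hs (inj_eq phi_inj) sv.
- move=> s us sv; rewrite (@lf_unit _ _ _ _ _ _ _ _ fam (map phi s)) ?big_map //.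
    by rewrite map_inj_uniq.
  by have [phi' h1 h2] := phi_bij; move=> v; rewrite -[v]h2 map_f.
Qed.
End IsoFamily.

Section IsoCorner.
Context (K : fieldType) (E F : graph) (phi : vert E -> vert F) (psi : edge E -> edge F).
Context (phi' : vert F -> vert E) (psi' : edge F -> edge E).
Hypotheses (phiK : cancel phi phi') (phiK' : cancel phi' phi).
Hypotheses (psiK : cancel psi psi') (psiK' : cancel psi' psi).
Context (R : pzRingType) (c : K -> R) (lv : vert E -> R) (le lg : edge E -> R).
Hypothesis fam : leavitt_family c lv le lg 1.
Context (S : pzRingType) (c' : K -> S) (lv' : vert F -> S) (le' lg' : edge F -> S).
Hypothesis fam' : leavitt_family c' lv' le' lg' 1.
Hypothesis indR : forall P : R -> Prop,
  (forall x y, P x -> P y -> P (x + y)) -> (forall x y, P x -> P y -> P (x * y)) ->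
  (forall k, P (c k)) -> (forall v, P (lv v)) ->
  (forall e, P (le e)) -> (forall e, P (lg e)) -> forall x, P x.
Hypothesis indS : forall P : S -> Prop,
  (forall x y, P x -> P y -> P (x + y)) -> (forall x y, P x -> P y -> P (x * y)) ->
  (forall k, P (c' k)) -> (forall v, P (lv' v)) ->
  (forall e, P (le' e)) -> (forall e, P (lg' e)) -> forall x, P x.
Context (a : R -> S) (b : S -> R).
Hypotheses (aD : forall x y, a (x + y) = a x + a y) (aM : forall x y, a (x * y) = a x * a y).
Hypotheses (av : forall v, a (lv v) = lv' (phi v)) (ae : forall e, a (le e) = le' (psi e)).
Hypotheses (ag : forall e, a (lg e) = lg' (psi e)) (ak : forall k, a (c k) = 1 * c' k).
Hypotheses (bD : forall x y, b (x + y) = b x + b y) (bM : forall x y, b (x * y) = b x * b y).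
Hypotheses (bv : forall v, b (lv' v) = lv (phi' v)) (be : forall e, b (le' e) = le (psi' e)).
Hypotheses (bg : forall e, b (lg' e) = lg (psi' e)) (bk : forall k, b (c' k) = 1 * c k).

(** An isomorphism is the degenerate corner with [q = 1] and [f = g = 0]. *)
Lemma iso_rings_morita : morita_equivalent R S.
Proof.
have b1 : b 1 = 1 by rewrite -(lf_c1 fam') bk mul1r (lf_c1 fam).
have ab x : a (b x) = x.
  elim/indS: x => [x y hx hy|x y hx hy|k|v|e|e].
  - by rewrite bD aD hx hy.
  - by rewrite bM aM hx hy.
  - by rewrite bk mul1r ak mul1r.
  - by rewrite bv av phiK'.
  - by rewrite be ae psiK'.
  - by rewrite bg ag psiK'.
have ba x : b (a x) = b 1 * x * b 1.
  rewrite b1 mul1r mulr1.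
  elim/indR: x => [x y hx hy|x y hx hy|k|v|e|e].
  - by rewrite aD bD hx hy.
  - by rewrite aM bM hx hy.
  - by rewrite ak mul1r bk mul1r.
  - by rewrite av bv phiK.
  - by rewrite ae be psiK.
  - by rewrite ag bg psiK.
have z1 : b 1 + 0 * 0 = 1 by rewrite mulr0 addr0.
have z2 : 0 * b 1 = 0 by rewrite mul0r.
have z3 : b 1 * 0 = 0 by rewrite mulr0.
exact: full_corner_morita (FullCorner bD bM aD ab ba z1 z2 z3 z3 z2).
Qed.
End IsoCorner.

Lemma one_comm (T : pzRingType) (x : T) : 1 * x = x * 1.
Proof. by rewrite mul1r mulr1. Qed.

Lemma iso_morita (K : fieldType) (E F : graph) :
  graph_iso E F -> morita_equivalent (lpa K E) (lpa K F).
Proof.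
move=> [phi [psi [[phi' h1 h2] [psi' h3 h4] hs hr]]].
have hs' e : src (psi' e) = phi' (src e) by rewrite -[LHS]h1 -hs h4.
have hr' e : rng (psi' e) = phi' (rng e) by rewrite -[LHS]h1 -hr h4.
have bphi : bijective phi by exists phi'.
have bpsi : bijective psi by exists psi'.
have bphi' : bijective phi' by exists phi.
have bpsi' : bijective psi' by exists psi.
have fa := iso_family bphi bpsi hs hr (lpa_family K F).
have fb := iso_family bphi' bpsi' hs' hr' (lpa_family K E).
have ca (k : K) := one_comm (lk F k).
have cb (k : K) := one_comm (lk E k).
exact: (iso_rings_morita h1 h2 h3 h4 (lpa_family K E) (lpa_family K F)
  (@lpa_ind K E) (@lpa_ind K F)
  (lpa_mapD fa ca) (lpa_mapM fa ca) (lpa_map_lv fa ca) (lpa_map_le fa ca)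
  (lpa_map_lg fa ca) (lpa_map_lk fa ca)
  (lpa_mapD fb cb) (lpa_mapM fb cb) (lpa_map_lv fb cb) (lpa_map_le fb cb)
  (lpa_map_lg fb cb) (lpa_map_lk fb cb)).
Qed.

Section Dsum.
Context (T : eqType) (P : pred T).
Definition dsum (x : T) : {x | ~~ P x} + {x | P x} :=
  match Sumbool.sumbool_of_bool (P x) with
  | left p => inr (exist _ x p)
  | right p => inl (exist _ x (negbT p))
  end.
Lemma dsumT x (p : P x) : dsum x = inr (exist _ x p).
Proof.
rewrite /dsum; case: Sumbool.sumbool_of_bool => q; last by case/negP: (negbT q).
by congr inr; apply: val_inj.
Qed.
Lemma dsumF x (p : ~~ P x) : dsum x = inl (exist _ x p).
Proof.
rewrite /dsum; case: Sumbool.sumbool_of_bool => q; last by congr inl; apply: val_inj.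
by case/negP: (p).
Qed.
End Dsum.

(* The trivial out-split, into a single block, turns an isomorphism of graphs
   with an edge into a move. *)
Lemma iso_one_move_O E F (e : edge E) : graph_iso E F -> one_move E F.
Proof.
move=> EF; pose w := src e; pose c (_ : edge E) : 'I_1 := ord0.
apply: (@one_move_O E F w 1 c).
- by move=> h; have : out_edges w e by []; rewrite h.
- by move=> i; exists e; split; rewrite ?ord1.
- by move=> i j _ _; rewrite !ord1.
apply: graph_iso_trans EF; apply: graph_iso_sym.
pose phi (u : vert E) := split_vert w (ord0 : 'I_1) u.
pose psi (h : edge E) : edge (graph_O w c) :=
  match dsum (fun h => rng h == w) h with inr h => inr (h, ord0) | inl h => inl h end.
have psiT h (p : rng h == w) : psi h = inr (exist _ h p, ord0).
  by rewrite /psi (@dsumT _ (fun h => rng h == w) h p).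
have psiF h (p : rng h != w) : psi h = inl (exist _ h p).
  by rewrite /psi (@dsumF _ (fun h => rng h == w) h p).
have phiE u (p : u != w) : phi u = inl (exist _ u p).
  by rewrite /phi /split_vert insubT.
have phiw : phi w = inr ord0 by rewrite /phi /split_vert insubF ?eqxx.
exists phi, psi; split.
- exists (fun x : vert (graph_O w c) => match x with inl u => val u | inr _ => w end).
    by move=> u; have [->|p] := eqVneq u w; rewrite ?phiw ?phiE.
  by case=> [[u p]|i] /=; [rewrite phiE|rewrite phiw [i]ord1].
- exists (fun x : edge (graph_O w c) => match x with inl h => val h | inr h => val h.1 end).
    by move=> h; have [p|p] := boolP (rng h == w); rewrite ?(psiT _ p) ?(psiF _ p).
  case=> [[h p]|[[h p] i]] /=; first by rewrite psiF.
  by rewrite psiT [i]ord1.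
- by move=> h; have [p|p] := boolP (rng h == w); rewrite ?(psiT _ p) ?(psiF _ p).
- move=> h; have [p|p] := boolP (rng h == w); rewrite ?(psiT _ p) ?(psiF _ p) /=.
    by rewrite (eqP p) phiw.
  by rewrite (phiE _ p); congr inl; apply: val_inj.
Qed.

Lemma one_move_edge E F : one_move E F -> exists e : edge E, True.
Proof.
have aux (w : vert E) : regular w -> exists e : edge E, True by move=> [[e _] _]; exists e.
case=> [w _ r _|w n c h _ _ _|w n c r _ _ _|w x f [r _ _ _] _]; try exact: aux r.
have /set0P[e _] : out_edges w != set0 by apply/eqP.
by exists e.
Qed.

Lemma one_move_iso E F G : one_move E F -> graph_iso F G -> one_move E G.
Proof.
case=> [w hw r i|w n c h1 h2 h3 i|w n c h1 h2 h3 i|w x f h i] j.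
- by apply: (one_move_S r); apply: graph_iso_trans i j.
- by apply: (one_move_O h1 h2 h3); apply: graph_iso_trans i j.
- by apply: (one_move_I h1 h2 h3); apply: graph_iso_trans i j.
- by apply: (@one_move_R _ _ w x f h); apply: graph_iso_trans i j.
Qed.

(** [move_equivalent] admits an isomorphism only at its end. One in front of a backward move is
    absorbed into the target of that move; one in front of a forward move becomes a trivial
    out-split, since a graph that admits a move has an edge. *)
Lemma move_equivalent_iso_l E E' F :
  graph_iso E E' -> move_equivalent E' F -> move_equivalent E F.
Proof.
move=> i m; case: m i => {E' F} [E' F i'|E' E'' F [m|m] mF] i.
- by apply: move_equivalent_iso; apply: graph_iso_trans i i'.
- have [e _] := one_move_edge m.
  apply: (@move_equivalent_step _ E') => //.
    by right; apply: (iso_one_move_O e); apply: graph_iso_sym.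
  by apply: move_equivalent_step mF; left.
- apply: move_equivalent_step mF; right.
  by apply: one_move_iso m _; apply: graph_iso_sym.
Qed.

Lemma move_equivalent_trans E F G :
  move_equivalent E F -> move_equivalent F G -> move_equivalent E G.
Proof.
elim=> {E F} [E F i|E E' F m _ IH] h; first exact: move_equivalent_iso_l i h.
by apply: move_equivalent_step m _; apply: IH.
Qed.

Lemma move_equivalent_refl E : move_equivalent E E.
Proof. by apply: move_equivalent_iso; apply: graph_iso_refl. Qed.

Lemma move_equivalent_sym E F : move_equivalent E F -> move_equivalent F E.
Proof.
elim=> {E F} [E F i|E E' F m _ IH].
  by apply: move_equivalent_iso; apply: graph_iso_sym.
apply: (move_equivalent_trans IH); apply: (@move_equivalent_step _ E).
  by case: m; [right|left].
exact: move_equivalent_refl.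
Qed.

Lemma one_move_equivalent E F : one_move E F -> move_equivalent E F.
Proof. by move=> m; apply: move_equivalent_step (move_equivalent_refl F); left. Qed.

(** Both conclusions of the theorem travel together, so each graph operation is treated once. *)
Definition meq E F :=
  move_equivalent E F /\ forall K : fieldType, morita_equivalent (lpa K E) (lpa K F).

Lemma meq_iso E F : graph_iso E F -> meq E F.
Proof. by move=> i; split=> [|K]; [apply: move_equivalent_iso|apply: iso_morita]. Qed.
Lemma meq_trans E F G : meq E F -> meq F G -> meq E G.
Proof.
move=> [h1 h2] [h3 h4]; split=> [|K]; first exact: move_equivalent_trans h1 h3.
exact: morita_trans (h2 K) (h4 K).
Qed.
Lemma meq_sym E F : meq E F -> meq F E.
Proof.
move=> [h1 h2]; split=> [|K]; first exact: move_equivalent_sym.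
exact: morita_sym.
Qed.

(** * Collapsing a vertex *)

Local Close Scope ring_scope.

Section PartialInverse.
Context (T U : Type) (f : T -> U).
Definition pinv_opt (u : U) : option T :=
  if pselect (exists x, f x = u) is left h then Some (projT1 (cid h)) else None.
Lemma pinv_optK : ocancel pinv_opt f.
Proof. by move=> u; rewrite /pinv_opt; case: pselect => //= h; case: cid. Qed.
Lemma pinv_optN u : pinv_opt u = None <-> ~ exists x, f x = u.
Proof. by rewrite /pinv_opt; case: pselect => h; split. Qed.
Lemma pinv_opt_pcan : injective f -> pcancel f pinv_opt.
Proof.
move=> fI x; rewrite /pinv_opt; case: pselect => [h|[]]; last by exists x.
by congr Some; apply: fI; case: cid.
Qed.
Lemma inj_surj_bij : injective f -> (forall u, exists x, f x = u) -> bijective f.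
Proof.
move=> fI fS; exists (fun u => projT1 (cid (fS u))) => [x|u].
  by apply: fI; case: cid.
by case: cid.
Qed.
End PartialInverse.

(* [F] is the graph with vertex set [V0], edge set [E0], source map [s] and
   range map [r]; this determines [F] up to isomorphism. *)
Record coding (A B : Type) (V0 : set A) (E0 : set B) (s r : B -> A) (F : graph) := Coding {
  cd_v : vert F -> A;
  cd_e : edge F -> B;
  cd_v_inj : injective cd_v;
  cd_e_inj : injective cd_e;
  cd_v_im : forall u, V0 u <-> exists x, cd_v x = u;
  cd_e_im : forall h, E0 h <-> exists k, cd_e k = h;
  cd_src : forall k, cd_v (src k) = s (cd_e k);
  cd_rng : forall k, cd_v (rng k) = r (cd_e k)
}.

Lemma coding_iso A B (V0 : set A) (E0 : set B) s r F G :
  coding V0 E0 s r F -> coding V0 E0 s r G -> graph_iso F G.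
Proof.
move=> c d.
have hv x : exists y, cd_v d y = cd_v c x by apply/(cd_v_im d)/(cd_v_im c); exists x.
have he x : exists y, cd_e d y = cd_e c x by apply/(cd_e_im d)/(cd_e_im c); exists x.
pose phi x := projT1 (cid (hv x)); pose psi x := projT1 (cid (he x)).
have phiE x : cd_v d (phi x) = cd_v c x by rewrite /phi; case: cid.
have psiE x : cd_e d (psi x) = cd_e c x by rewrite /psi; case: cid.
exists phi, psi; split.
- apply: inj_surj_bij => [x y xy|y].
    by apply: (cd_v_inj (c := c)); rewrite -!phiE xy.
  have [x hx] : exists x, cd_v c x = cd_v d y by apply/(cd_v_im c)/(cd_v_im d); exists y.
  by exists x; apply: (cd_v_inj (c := d)); rewrite phiE.
- apply: inj_surj_bij => [x y xy|y].
    by apply: (cd_e_inj (c := c)); rewrite -!psiE xy.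
  have [x hx] : exists x, cd_e c x = cd_e d y by apply/(cd_e_im c)/(cd_e_im d); exists y.
  by exists x; apply: (cd_e_inj (c := d)); rewrite psiE.
- by move=> e; apply: (cd_v_inj (c := d)); rewrite cd_src psiE phiE cd_src.
- by move=> e; apply: (cd_v_inj (c := d)); rewrite cd_rng psiE phiE cd_rng.
Qed.

Section Collapse.
Context (E : graph) (w : vert E) (f : edge E).

Definition retarget (h : edge E) : vert E := if rng h == w then rng f else rng h.

Definition collapses (F : graph) :=
  coding [set u | u != w] [set h | h != f] (@src E) retarget F.

Hypothesis out_w : forall e, src e = w <-> e = f.
Hypothesis loop_f : rng f != w.

Lemma collapse_out : out_edges w = [set f].
Proof. by apply/seteqP; split=> e /out_w. Qed.
Lemma collapse_regular : regular w.
Proof. by split; rewrite collapse_out; [exists f|exact: finite_set1]. Qed.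
Lemma collapse_src_f : src f = w. Proof. exact/out_w. Qed.
Lemma collapse_src_neq e : rng e = w -> src e != w.
Proof. by move=> re; apply/eqP => /out_w ef; move: loop_f; rewrite -ef re eqxx. Qed.

Lemma collapse_S F (hw : is_source w) : collapses F -> one_move E F.
Proof.
move=> c; apply: (@one_move_S _ _ w hw collapse_regular); apply: coding_iso c.
have rw e : rng e != w by apply: source_rng_neq.
exists (fun x : vert (graph_S hw) => val x) (fun x : edge (graph_S hw) => val x).
- exact: val_inj.
- exact: val_inj.
- move=> u; split=> [p|[[x p] <-] //]; by exists (exist _ u p).
- move=> h; split=> [p|[[x p] <-] /=].
    have q : src h != w by apply: contra p => /eqP/out_w ->.
    by exists (exist _ h q).
  by apply: contra p => /eqP ->; rewrite collapse_src_f.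
- by [].
- by move=> k; rewrite /retarget (negbTE (rw _)).
Qed.

Lemma collapse_R F x e1 : rng e1 = w -> (forall e, rng e = w -> src e = x) ->
  collapses F -> one_move E F.
Proof.
move=> re1 hx c.
have hR : can_move_R w x f.
  split; [exact: collapse_regular| |exact: collapse_out|exact/eqP].
  apply/seteqP; split=> [u [e he <-]|u ->]; first by apply: hx.
  by exists e1 => //; apply: hx.
apply: (@one_move_R _ _ w x f hR); apply: coding_iso c.
exists (fun x : vert (graph_R hR) => val x)
  (fun k : edge (graph_R hR) => match k with inl k => val k | inr k => val k end).
- exact: val_inj.
- move=> [[k p]|[k p]] [[k' p']|[k' p']] /= kk'; try by congr (_ _); apply: val_inj.
    by exfalso; move: p; rewrite kk' p' andbF.
  by exfalso; move: p'; rewrite -kk' p andbF.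
- move=> u; split=> [p|[[y p] <-] //]; by exists (exist _ u p).
- move=> h; split=> [p|[[[k p]|[k p]] <-] /=].
  + have q : src h != w by apply: contra p => /eqP/out_w ->.
    have [r|r] := boolP (rng h == w); first by exists (inr (exist _ h r)).
    have qr : (src h != w) && (rng h != w) by rewrite q r.
    by exists (inl (exist _ h qr)).
  + by apply: contraTneq p => ->; rewrite collapse_src_f eqxx.
  + by apply: contraTneq p => ->.
- by case=> [k|[k p]] //=; rewrite (hx k) //; apply/eqP.
- case=> [[k p]|[k p]] /=; rewrite /retarget /=; last by rewrite p.
  by case/andP: (p) => _ /negbTE ->.
Qed.

(** A partial collapse: only the edges from [p] into [w] are prolonged along [f], and [w] stays. *)
Definition retarget_from (p : vert E) : graph :=
  @Graph (vert E) (edge E) (@src E)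
    (fun h => if (src h == p) && (rng h == w) then rng f else rng h).

Lemma split_vert_neq (i : 'I_2) u (p : u != w) : split_vert w i u = inl (exist _ u p).
Proof. by rewrite /split_vert insubT. Qed.
Lemma split_vert_w (i : 'I_2) : split_vert w i w = inr i.
Proof. by rewrite /split_vert insubF ?eqxx. Qed.

End Collapse.

Lemma split_vertK E (w : vert E) (i : 'I_2) :
  cancel (split_vert w i) (fun x => match x with inl u => val u | inr _ => w end).
Proof.
move=> u; have [/eqP ->|q] := boolP (u == w); first by rewrite split_vert_w.
by rewrite (split_vert_neq _ q).
Qed.

(** An in-split of [w] separates the edges coming from [src e1] from the rest; [e2] keeps the second
    block nonempty. All edges into the first copy of [w] have the same source, so move (R) removes
    that copy. *)
Lemma retarget_move E (w : vert E) f (out_w : forall e, src e = w <-> e = f)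
  (loop_f : rng f != w) e1 e2 : rng e1 = w -> rng e2 = w -> src e1 <> src e2 ->
  move_equivalent E (retarget_from w f (src e1)).
Proof.
move=> re1 re2 ne; set p := src e1.
have pw : p != w by apply: (collapse_src_neq out_w loop_f).
have sN := @split_vert_neq E w; have sw := @split_vert_w E w.
pose c (h : edge E) : 'I_2 := if src h == p then ord0 else ord_max.
pose G := graph_I w c.
have EG : one_move E G.
  apply: (@one_move_I _ _ w 2 c); last exact: graph_iso_refl.
  - exact: collapse_regular out_w.
  - by move=> h; have : in_edges w e1 by []; rewrite h.
  - move=> i; have [->|i1] := eqVneq i ord0.
      by exists e1; split=> //; rewrite /c eqxx.
    exists e2; split=> //; rewrite /c; case: eqP => [h|_]; first by case: ne.
    by apply: val_inj; move: i i1; case; case=> [|[|]].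
apply: (@move_equivalent_step _ G); first by left.
apply: one_move_equivalent.
pose f0 : edge G := inr (exist (fun h => src h == w) f (introT eqP (collapse_src_f out_w)), ord0).
have rngI (h : edge G) : rng h = split_vert w (c (match h with inl h => val h | inr h => val h.1 end))
   (rng (match h with inl h => val h | inr h => val h.1 end)).
  by case: h => [h|[h i]].
have rf0 : rng f0 = inl (exist _ (rng f) loop_f) by rewrite rngI (sN _ _ loop_f).
(* The edge [f] is represented by its copy at the second copy of [w]; its other copy [f0] is removed
   together with the first copy of [w]. *)
pose k (h : edge E) : edge G :=
  match dsum (fun h => src h == w) h with inr h => inr (h, ord_max) | inl h => inl h end.
have kT h (q : src h == w) : k h = inr (exist _ h q, ord_max).
  by rewrite /k (@dsumT _ (fun h => src h == w) h q).
have kF h (q : src h != w) : k h = inl (exist _ h q).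
  by rewrite /k (@dsumF _ (fun h => src h == w) h q).
have kK : cancel k (fun x : edge G => match x with inl h => val h | inr h => val h.1 end).
  by move=> h; have [q|q] := boolP (src h == w); rewrite ?(kT _ q) ?(kF _ q).
have e1w : src e1 != w by [].
apply: (@collapse_R G (inr ord0) f0 _ _ _ (inl (exist _ p pw)) (inl (exist _ e1 e1w))).
- case=> [h|[[h q] i]]; split=> //=.
    by case=> ->; congr (inr (_, _)); apply: val_inj; apply/out_w/eqP.
  by case=> _ ->.
- by rewrite rf0.
- by rewrite rngI /= re1 sw /c eqxx.
- move=> h; rewrite rngI.
  set h' := match h with inl h => _ | inr h => _ end.
  have [rw|rw] := eqVneq (rng h') w; last by rewrite (sN _ _ rw).
  rewrite rw sw /c; case: eqP => // sp _.
  rewrite /h' {rngI} in rw sp; clear h'; move: h rw sp => [[h q]|[[h q] i]] /= rw sp.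
    by congr inl; apply: val_inj.
  by have := collapse_src_neq out_w loop_f rw; rewrite (eqP q) eqxx.
exists (fun u : vert (retarget_from w f p) => split_vert w (ord_max : 'I_2) u) k.
- exact: can_inj (split_vertK w _).
- exact: can_inj kK.
- case=> [[u q]|i]; split=> //.
  + by exists u; rewrite (sN _ _ q).
  + move=> i0; exists w; rewrite sw; congr inr; apply: val_inj.
    by move: i i0; case; case=> [|[|]].
  + case=> u /=; have [/eqP ->|q] := boolP (u == w).
      by rewrite sw => -[<-].
    by rewrite (sN _ _ q).
- case=> [[h q]|[[h q] i]]; split=> //.
  + by exists h; rewrite (kF _ q).
  + move=> i0; exists h; rewrite (kT _ q); congr (inr (_, _)); apply: val_inj.
    have hf : h = f by apply/out_w/eqP.
    move: i0; rewrite /f0 /=; case: i; case=> [|[|]] //= j /eqP[].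
    by congr (inr (_, _)); apply: val_inj.
  + case=> h'; have [q'|q'] := boolP (src h' == w); rewrite ?(kT _ q') ?(kF _ q') // => -[_ <-].
    by apply/eqP; case.
- move=> h; have [q|q] := boolP (src h == w); rewrite ?(kT _ q) ?(kF _ q) /=.
    by rewrite (eqP q) sw.
  by rewrite (sN _ _ q); congr inl; apply: val_inj.
- change (forall h : edge E, split_vert w ord_max
    (if (src h == p) && (rng h == w) then rng f else rng h) = retarget (inr ord0 : vert G) f0 (k h)).
  move=> h; have kv := kK h.
  rewrite /retarget rngI kv rf0 /= /c.
  have [/eqP rw|rw] := boolP (rng h == w); last by rewrite andbF !(sN _ _ rw).
  rewrite rw andbT sw; case: (src h == p) => /=; first by rewrite (sN _ _ loop_f).
  by rewrite sw.
Qed.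

(** An edge into [w] ends at [rng f] after the collapse, whether or not it was prolonged
    beforehand. *)
Lemma coding_retarget (E : graph) (w : vert E) f p F (loop_f : rng f != w) :
  collapses w f F -> @collapses (retarget_from w f p) w f F.
Proof.
move=> [cv ce h1 h2 h3 h4 h5 h6].
have rf : (if (src f == p) && (rng f == w) then rng f else rng f) = rng f by case: ifP.
exists cv ce => //.
move=> k; rewrite h6 /retarget /= rf.
have [rw|rw] := boolP (rng (ce k) == w); rewrite ?andbF ?andbT.
  by case: (src (ce k) == p); rewrite ?rw ?if_same.
by rewrite (negbTE rw).
Qed.

Lemma count_lt (T : eqType) (a b : pred T) (s : seq T) x :
  (forall y, a y -> b y) -> x \in s -> b x -> ~~ a x -> (count a s < count b s)%N.
Proof.
move=> ab; elim: s => //= y s IH; rewrite inE => /orP[/eqP <-|xs] bx ax.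
  by rewrite bx (negbTE ax) add0n add1n ltnS sub_count.
by rewrite -addnS leq_add ?IH //; case: (a y) (ab y) => // ->.
Qed.

(** Moves (S) and (R) collapse [w] only if the edges into it come from at most one vertex. The
    induction is on the number of vertices with an edge to [w], which [retarget_move] lowers without
    changing the final collapse. *)
Lemma collapse_move (E : graph) (w : vert E) f F (s : seq (vert E)) :
  (forall u, u \in s) -> (forall e, src e = w <-> e = f) -> rng f != w ->
  collapses w f F -> move_equivalent E F.
Proof.
move=> hs; have [n] := ubnP (count (fun p => `[< exists e, rng e = w /\ src e = p >]) s).
elim: n => // n IH in E w f F s hs * => hn out_w loop_f c.
have [[e1 re1]|no] := pselect (exists e1, rng e1 = w); last first.
  have hw : is_source w by apply/seteqP; split=> // e he; case: no; exists e.
  by apply: one_move_equivalent; apply: (collapse_S out_w hw c).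
have [[e2 [re2 ne]]|no] := pselect (exists e2, rng e2 = w /\ src e1 <> src e2); last first.
  apply: one_move_equivalent; apply: (@collapse_R _ _ _ out_w loop_f _ (src e1) e1 re1 _ c).
  move=> e re; apply/eqP; case: eqP => // ne; case: no; exists e; split=> //.
  by move=> h; apply: ne; rewrite h.
apply: move_equivalent_trans (retarget_move out_w loop_f re1 re2 ne) _.
have rf : (if (src f == src e1) && (rng f == w) then rng f else rng f) = rng f by case: ifP.
apply: (IH (retarget_from w f (src e1)) w f F s hs) => //=; last 2 first.
- by rewrite rf.
- exact: coding_retarget.
apply: leq_trans _ (hn : (_ <= n)%N).
apply: (@count_lt _ _ _ _ (src e1)) => //.
- move=> u /asboolP[e [re se]]; apply/asboolP; exists e; split=> //.
  by move: re => /=; case: ifP => // _ h; move: loop_f; rewrite h eqxx.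
- by apply/asboolP; exists e1.
- apply/asboolP => -[e [/= re se]]; move: re; rewrite se eqxx /=.
  by case: eqP => // _ h; move: loop_f; rewrite h eqxx.
Qed.

Lemma collapse_morita (K : fieldType) (E : graph) (w : vert E) f F :
  (forall e, src e = w <-> e = f) -> rng f != w -> collapses w f F ->
  morita_equivalent (lpa K E) (lpa K F).
Proof.
move=> out_w loop_f [cv ce h1 h2 h3 h4 h5 h6].
have sf : src f = w by apply/out_w.
pose e' k := (ce k, rng (ce k) == w).
have e'I : injective e' by move=> k k' [/h2].
apply: (@shift_morita K E F f).
apply: (@Shift E F f cv (pinv_opt cv) e' (pinv_opt e')).
- by rewrite sf eq_sym.
- exact: pinv_opt_pcan.
- exact: pinv_optK.
- exact: pinv_opt_pcan.
- exact: pinv_optK.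
- move=> x; rewrite pinv_optN -h3 sf; split=> [/negP|[-> _]].
    by rewrite negbK => /eqP ->; split=> // h /out_w.
  by rewrite /= eqxx.
- move=> h; rewrite !pinv_optN -h3 /=; split=> [nh|].
    have [->|hf] := eqVneq h f; [by left|right].
    have [k hk] : exists k, ce k = h by apply/h4.
    by move=> rw; apply: nh; exists k; rewrite /e' hk (negbTE rw).
  move=> hh [k [kh rk]]; case: hh => [hf|]; last by rewrite -kh rk.
  have /= /eqP := (h4 f).2 (ex_intro _ k (etrans kh hf)); exact.
- move=> h; rewrite pinv_optN sf; split=> [nh|rw [k [kh]]].
    apply/negP => /eqP rw; apply: nh.
    have hf : h != f by apply: contraNneq loop_f => <-; rewrite rw.
    have [k hk] : exists k, ce k = h by apply/h4.
    by exists k; rewrite /e' hk rw eqxx.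
  by rewrite kh (negbTE rw).
- by move=> k; rewrite h5.
- by move=> k; rewrite h6 /retarget /e' /=.
Qed.

(** * Column additions as graph operations *)

Section Colshift.
Context (E : graph) (e0 : edge E).
Local Notation a := (src e0).
Local Notation b := (rng e0).

(* The edges [(h, true)] are the second copies, in the out-split that separates
   [e0] from the other edges at its source, of the edges into that source;
   collapsing the source of [e0] then redirects them to [b]. *)
Definition colshift (F : graph) :=
  coding [set: vert E] [set p : edge E * bool | if p.2 then rng p.1 == a else p.1 != e0]
    (fun p => src p.1) (fun p => if p.2 then b else rng p.1) F.

Hypothesis ab : a != b.
Context (h1 : edge E).
Hypotheses (h1a : src h1 = a) (h1e : h1 != e0).

Lemma colshift_morita (K : fieldType) F :
  colshift F -> morita_equivalent (lpa K E) (lpa K F).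
Proof.
move=> [cv ce i1 i2 i3 i4 i5 i6]; apply: (@shift_morita K E F e0).
have ivN x : pinv_opt cv x <> None by rewrite pinv_optN -i3; case.
apply: (@Shift E F e0 cv (pinv_opt cv) ce (pinv_opt ce)) => //.
- exact: pinv_opt_pcan.
- exact: pinv_optK.
- exact: pinv_opt_pcan.
- exact: pinv_optK.
- by move=> x; split=> [/ivN//|[_ /(_ _ h1a)/eqP]]; rewrite (negbTE h1e).
- move=> h; rewrite pinv_optN -i4 /=; split=> [/negP|[->|/ivN//]]; rewrite ?eqxx //.
  by rewrite negbK => /eqP; left.
- by move=> h; rewrite pinv_optN -i4 /=; split=> /negP.
Qed.

Lemma colshift_move F (s : seq (vert E)) : (forall u, u \in s) ->
  colshift F -> move_equivalent E F.
Proof.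
move=> hs [cv ce i1 i2 i3 i4 i5 i6].
have ba : b != a by rewrite eq_sym.
have sN := @split_vert_neq E a; have sw := @split_vert_w E a.
pose c (h : edge E) : 'I_2 := if h == e0 then ord_max else ord0.
pose G := graph_O a c.
have EG : one_move E G.
  apply: (@one_move_O _ _ a 2 c); last exact: graph_iso_refl.
  - by move=> h; have : out_edges a e0 by []; rewrite h.
  - move=> i; have [->|i1'] := eqVneq i ord0.
      by exists h1; split=> //; rewrite /c (negbTE h1e).
    exists e0; split=> //; rewrite /c eqxx; apply: val_inj.
    by move: i i1'; case; case=> [|[|]].
  - have fin1 i : i != ord0 -> finite_set (block (out_edges a) c i).
      move=> i0; apply: (sub_finite_set _ (finite_set1 e0)) => h [_ ch].
      by move: i0; rewrite -ch /c; case: (eqVneq h e0).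
    move=> i j hi hj; have [->|/fin1//] := eqVneq i ord0.
    by have [->|/fin1//] := eqVneq j ord0.
apply: (@move_equivalent_step _ G); first by left.
(* The only edge leaving the second copy of the source of [e0], so that this copy can be
   collapsed. *)
pose f0 : edge G := inl (exist (fun h => rng h != a) e0 ba).
pose ed (h : edge G) : edge E := match h with inl h => val h | inr h => val h.1 end.
have srcO (h : edge G) : src h = split_vert a (c (ed h)) (src (ed h)).
  by case: h => [h|[h i]].
pose k (p : edge E * bool) : edge G :=
  match dsum (fun h => rng h == a) p.1 with
  | inr h => inr (h, if p.2 then ord_max else ord0) | inl h => inl h end.
have kT h i (q : rng h == a) : k (h, i) = inr (exist _ h q, if i then ord_max else ord0).
  by rewrite /k (@dsumT _ (fun h => rng h == a) h q).
have kF h i (q : rng h != a) : k (h, i) = inl (exist _ h q).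
  by rewrite /k (@dsumF _ (fun h => rng h == a) h q).
have ce0 x : if (ce x).2 then rng (ce x).1 == a else (ce x).1 != e0.
  by apply/i4; exists x.
have ceN x : (ce x).1 != e0.
  have := ce0 x; case: (ce x) => h [] //= ra.
  by apply/eqP => he; move: ra; rewrite he (negbTE ba).
have edk p : ed (k p) = p.1.
  case: p => h i; have [q|q] := boolP (rng h == a); first by rewrite (kT _ _ q).
  by rewrite (kF _ _ q).
pose sG : seq (vert G) := [seq inl u | u <- pmap insub s] ++ [seq inr i | i <- enum 'I_2].
have hsG u : u \in sG.
  rewrite mem_cat; case: u => [u|i]; apply/orP; [left|right]; apply/mapP.
    by exists u => //; rewrite mem_pmap_sub.
  by exists i => //; rewrite mem_enum.
apply: (@collapse_move G (inr ord_max) f0 F sG hsG).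
- move=> h; rewrite srcO; split=> [|->]; last by rewrite /= sw /c eqxx.
  have [/eqP sa|sa] := boolP (src (ed h) == a); last by rewrite (sN _ _ sa).
  rewrite sa sw /c; case: (eqVneq (ed h) e0) => // he _.
  case: h {sa} he => [h|[[h q] i]] /= he; first by congr inl; apply: val_inj.
  by exfalso; move: q; rewrite he (negbTE ba).
- by [].
exists (fun x => split_vert a (ord0 : 'I_2) (cv x)) (fun x => k (ce x)).
- exact: inj_comp (can_inj (split_vertK a ord0)) i1.
- move=> x y xy; apply: i2.
  have e1 : (ce x).1 = (ce y).1 by rewrite -!edk xy.
  move: (ce0 x) (ce0 y) xy e1; case: (ce x) => h i; case: (ce y) => h' i' /= c1 c2 + hh'.
  rewrite -{}hh' in c2 *; have [q|q] := boolP (rng h == a).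
    rewrite !(kT _ _ q) => -[ii]; congr (_, _).
    by move: ii; case: (i); case: (i').
  by rewrite (negbTE q) in c1 c2; case: i c1; case: i' c2.
- case=> [[u q]|i]; split=> //.
  + have [x hx] : exists x, cv x = u by apply/i3.
    by exists x; rewrite hx (sN _ _ q).
  + move=> i0; have [x hx] : exists x, cv x = a by apply/i3.
    exists x; rewrite hx sw; congr inr; apply: val_inj.
    by move: i i0; case; case=> [|[|]] //= j /eqP[]; congr inr; apply: val_inj.
  + case=> x /=; have [/eqP ->|q] := boolP (cv x == a).
      by rewrite sw => -[<-].
    by rewrite (sN _ _ q).
- move=> h; split=> [hf|[x <-]]; last first.
    by apply/eqP => /(congr1 ed); rewrite edk /= => xe; move: (ceN x); rewrite xe eqxx.
  suff [p kp cp] : exists2 p, k p = h & (if p.2 then rng p.1 == a else p.1 != e0).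
    by have [x cx] := (i4 p).1 cp; exists x; rewrite cx.
  case: h hf => [[h q]|[[h q] i]] /= hf.
    exists (h, false); first by rewrite (kF _ _ q).
    by apply: contraNneq hf => he; apply/eqP; congr inl; apply: val_inj.
  exists (h, i == ord_max); rewrite /= ?q.
    rewrite (kT _ _ q); congr (inr (_, _)); apply: val_inj.
    by case: i {hf}; case=> [|[|]].
  by case: ifP => // _; apply/eqP => he; move: q; rewrite he (negbTE ba).
- move=> x; rewrite srcO edk i5 /c (negbTE (ceN x)) //.
- move=> x; rewrite i6 /retarget; move: (ce0 x) (ceN x); case: (ce x) => h i /= c1 c2.
  have [q|q] := boolP (rng h == a).
    rewrite (kT _ _ q) /=; case: i c1 => c1 /=.
      by rewrite (sN _ _ ba); congr inl; apply: val_inj.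
    by rewrite (eqP q) sw.
  by rewrite (kF _ _ q) /=; case: i c1; rewrite ?(negbTE q) // (sN _ _ q) => _; congr inl; apply: val_inj.
Qed.

Lemma colshift_meq F (s : seq (vert E)) : (forall u, u \in s) -> colshift F -> meq E F.
Proof.
by move=> hs c; split=> [|K]; [apply: colshift_move hs c|apply: colshift_morita].
Qed.

End Colshift.

Lemma collapse_meq (E : graph) (w : vert E) f F (s : seq (vert E)) :
  (forall u, u \in s) -> (forall e, src e = w <-> e = f) -> rng f != w ->
  collapses w f F -> meq E F.
Proof.
move=> hs out_w loop_f c; split=> [|K]; first exact: collapse_move hs out_w loop_f c.
exact: collapse_morita out_w loop_f c.
Qed.

(** * Graphs given by adjacency matrices *)

Local Open Scope card_scope.

(* [None] is an infinite cardinal. *)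
Definition enat := option nat.
Definition below (k : nat) (n : enat) : bool := if n is Some m then (k < m)%N else true.
Definition eadd (m n : enat) : enat :=
  if m is Some m then (if n is Some n then Some (m + n)%N else None) else None.
Definition epred (m : enat) : enat := omap predn m.
(** Zero times infinity is 0: edges into a collapsed vertex yield nothing towards a vertex to which
    it emits nothing. *)
Definition emul (m : enat) (n : nat) : enat :=
  if n is 0 then Some 0 else if m is Some m then Some (m * n)%N else None.

Lemma eaddn0 m : eadd m (Some 0) = m.
Proof. by case: m => //= m; rewrite addn0. Qed.
Lemma eaddN m : eadd m None = None. Proof. by case: m. Qed.
Lemma eaddA m n p : eadd m (eadd n p) = eadd (eadd m n) p.
Proof. by case: m n p => [m|] [n|] [p|] //=; rewrite addnA. Qed.
Lemma emul0 m : emul m 0 = Some 0. Proof. by []. Qed.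
Lemma emul1 m : emul m 1 = m. Proof. by case: m => //= m; rewrite muln1. Qed.
Lemma emulS m n : emul m n.+1 = eadd m (emul m n).
Proof. by case: m n => [m|] [|n] //=; rewrite ?muln0 ?addn0 ?muln1 ?mulnS. Qed.
Lemma below_ex n : below 0 n = (n != Some 0).
Proof. by case: n => [[|n]|]. Qed.

Section Cardinals.
Implicit Types T U : choiceType.

Definition has_card T (S : set T) (n : enat) : Prop :=
  if n is Some m then exists s : seq T, [/\ uniq s, size s = m & forall x, S x <-> x \in s]
  else infinite_set S.

Lemma has_card_finite T (S : set T) n : has_card S (Some n) -> finite_set S.
Proof. by case=> s [_ _ h]; apply/finite_seqP; exists s; apply/seteqP; split=> x /h. Qed.

Lemma finite_has_card T (S : set T) : finite_set S -> exists n, has_card S (Some n).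
Proof.
by move=> /finite_enum[s us hs]; exists (size s), s.
Qed.

Lemma has_card_ex T (S : set T) : exists n, has_card S n.
Proof.
have [/finite_has_card[n h]|h] := pselect (finite_set S); first by exists (Some n).
by exists None.
Qed.

Lemma has_card_image T U (f : T -> U) (S : set T) (S' : set U) n :
  (forall x y, S x -> S y -> f x = f y -> x = y) ->
  (forall u, S' u <-> exists2 x, S x & f x = u) -> has_card S n -> has_card S' n.
Proof.
move=> fI hS; case: n => [n [s [us <- hs]]|hn] /=.
  exists (map f s); rewrite size_map; split=> //.
    by rewrite map_inj_in_uniq // => x y /hs ? /hs ?; apply: fI.
  move=> u; rewrite hS; split=> [[x /hs xs <-]|/mapP[x /hs xs ->]]; first exact: map_f.
  by exists x.
move=> fin; have [x0 x0S] : S !=set0 by apply: infinite_setN0.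
pose g u := if pselect (exists2 x, S x & f x = u) is left h then projT1 (cid2 h) else x0.
apply: hn; apply: (sub_finite_set _ (finite_image g fin)) => x xS.
exists (f x); first by apply/hS; exists x.
rewrite /g; case: pselect => [h|[]]; last by exists x.
by case: cid2 => y yS fy; apply: fI.
Qed.

Lemma has_cardU T (S S' : set T) m n : (forall x, S x -> S' x -> False) ->
  has_card S m -> has_card S' n -> has_card (fun x => S x \/ S' x) (eadd m n).
Proof.
move=> dis; case: m => [m|]; case: n => [n|] /=.
- move=> [s [us <- hs]] [t [ut <- ht]]; exists (s ++ t); rewrite size_cat cat_uniq us ut.
  split=> //; last by move=> x; rewrite mem_cat hs ht; split=> /orP.
  by rewrite andbT; apply/hasPn => x /ht xt; apply/negP => /hs xs; apply: dis xs xt.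
- by move=> _; apply: sub_infinite_set => x; right.
- by move=> h _; move: h; apply: sub_infinite_set => x; left.
- by move=> h _; move: h; apply: sub_infinite_set => x; left.
Qed.

Lemma has_cardD1 T (S : set T) n x0 : S x0 -> has_card S n ->
  has_card (fun x => S x /\ x != x0) (epred n).
Proof.
move=> x0S; case: n => [n [s [us <- hs]]|hn] /=.
  exists (rem x0 s); rewrite rem_uniq // size_rem; last exact/hs.
  by split=> // x; rewrite mem_rem_uniq // !inE andbC; split=> [[/hs -> ->]|/andP[/hs]].
move=> fin; apply: hn; apply: (@sub_finite_set _ _ (fun x => (S x /\ x != x0) \/ x = x0)).
  by move=> x xS; have [->|] := eqVneq x x0; [right|left].
by have := finite_set1 x0; rewrite finite_setU => h; split.
Qed.

Lemma has_card0 T (S : set T) : (forall x, ~ S x) -> has_card S (Some 0).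
Proof. by move=> h; exists [::]; split=> // x; split=> // /h. Qed.

Lemma has_card_below n : has_card [set k | below k n] n.
Proof.
case: n => [n|] /=; last by move=> h; apply: infinite_nat; apply: sub_finite_set h.
exists (iota 0 n); rewrite iota_uniq size_iota; split=> // k.
by rewrite mem_iota.
Qed.

Lemma eq_has_card T (S S' : set T) n : (forall x, S x <-> S' x) -> has_card S n -> has_card S' n.
Proof. by move=> h; rewrite (_ : S = S') //; apply/seteqP; split=> x /h. Qed.

Lemma has_card_uniq T (S : set T) m n : has_card S m -> has_card S n -> m = n.
Proof.
case: m => [m|]; case: n => [n|] //.
- move=> [s [us <- hs]] [t [ut <- ht]]; congr Some.
  have st : s =i t by move=> x; apply/idP/idP => [/hs/ht|/ht/hs].
  by apply/esym/eqP; rewrite -(uniq_size_uniq us st).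
- by move=> /has_card_finite h [].
- by move=> h /has_card_finite /h.
Qed.

Lemma has_card_preimage T U (f : T -> U) (S : set T) (S' : set U) n :
  (forall x y, S x -> S y -> f x = f y -> x = y) ->
  (forall u, S' u <-> exists2 x, S x & f x = u) -> has_card S' n -> has_card S n.
Proof.
move=> fI hS hn; have [m hm] := has_card_ex S.
by rewrite (has_card_uniq hn (has_card_image fI hS hm)).
Qed.
End Cardinals.

(** Countability enters here: all infinite edge sets are equinumerous, so a matrix with a single
    infinite value determines the graph up to isomorphism. *)
Lemma has_card_enum (T : countType) (S : set T) n : has_card S n ->
  exists g : T -> nat, (forall x y, S x -> S y -> g x = g y -> x = y) /\
    forall k, below k n <-> exists2 x, S x & g x = k.
Proof.
case: n => [n [s [us <- hs]]|hn].
  exists (index^~ s); split=> [x y /hs xs /hs ys|k] /=; first exact: index_inj.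
  split=> [ks|[x /hs xs <-]]; last by rewrite index_mem.
  case: s us hs ks => // x0 s us hs ks.
  by exists (nth x0 (x0 :: s) k); [apply/hs; rewrite mem_nth|rewrite index_uniq].
have /card_set_bijP[g [_ gI gS]] : S #= [set: nat].
  by apply/eq_card_nat => //; apply: countableP.
exists g; split=> [x y xS yS|k]; first by apply: gI; rewrite inE.
by split=> // _; have [x xS <-] := gS k I; exists x.
Qed.

Definition mx (V : finType) := V -> V -> enat.

Section MatrixGraph.
Context (V : finType).
Implicit Types A : mx V.

Definition mx_edge A : pred (V * V * nat) := fun t => below t.2 (A t.1.1 t.1.2).
Definition mg A : graph :=
  @Graph V {t : V * V * nat | mx_edge A t} (fun t => (val t).1.1) (fun t => (val t).1.2).

Lemma mg_iso A (E : graph) (phi : vert E -> V) : bijective phi ->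
  (forall x y, has_card [set e : edge E | phi (src e) = x /\ phi (rng e) = y] (A x y)) ->
  graph_iso E (mg A).
Proof.
move=> phi_bij hA.
pose g x y := projT1 (cid (has_card_enum (hA x y))).
have gI x y e e' : phi (src e) = x -> phi (rng e) = y -> phi (src e') = x ->
    phi (rng e') = y -> g x y e = g x y e' -> e = e'.
  move=> h1 h2 h3 h4; rewrite /g; case: cid => /= g' [h _]; exact: h.
have gS x y k : below k (A x y) <-> exists2 e, phi (src e) = x /\ phi (rng e) = y & g x y e = k.
  by rewrite /g; case: cid => /= g' [_ h].
pose ce e := (phi (src e), phi (rng e), g (phi (src e)) (phi (rng e)) e).
apply: (@coding_iso V (V * V * nat)%type setT (mx_edge A) (fun t => t.1.1) (fun t => t.1.2)).
- exists phi ce => //.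
  + exact: bij_inj.
  + by move=> e e' [h1 h2]; rewrite -h1 -h2; apply: gI.
  + by move=> u; split=> // _; have [psi h1 h2] := phi_bij; exists (psi u).
  + case=> [[x y] k]; rewrite /mx_edge /=; split=> [/gS[e [hx hy] he]|[e [<- <- <-]]].
      by exists e; rewrite /ce hx hy he.
    by apply/gS; exists e.
exists (fun u : vert (mg A) => u : V) (fun e : edge (mg A) => val e) => //.
- by move=> u; split=> // _; exists u.
- by move=> t; split=> [h|[[t' h] <-] //]; exists (exist _ t h).
Qed.

Lemma mg_hom A x y : has_card [set e : edge (mg A) | src e = x /\ rng e = y] (A x y).
Proof.
apply: (@has_card_preimage _ _ (fun e : edge (mg A) => (val e).2) _ _ _ _ _ (has_card_below (A x y))).
- move=> [[[x1 y1] k] h] [[[x2 y2] k'] h'] /= [p1 p2] [p3 p4] kk; apply: val_inj => /=.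
  by rewrite p1 p2 p3 p4 kk.
- move=> k; split=> [h|[[[[x1 y1] k'] h] /= [<- <-] <-] //].
  by exists (exist _ (x, y, k) h).
Qed.

Lemma mg_eq A A' : (forall x y, A x y = A' x y) -> graph_iso (mg A) (mg A').
Proof.
move=> h; apply: (@mg_iso A' (mg A) id); first by exists id.
by move=> x y; rewrite -h; apply: mg_hom.
Qed.

(** [epred] accounts for the removed edge. In row [a] it matches the diagonal -1 of [B = A - 1], so
    that in [B] column [a] is added to column [b] uniformly in all rows. *)
Definition colshift_mx A (a b : V) : mx V := fun x y =>
  if y == b then eadd (if x == a then epred (A a b) else A x b) (A x a) else A x y.

Lemma colshift_mg A a b : a != b -> below 0 (A a b) ->
  (exists c k, (c, k) != (b, 0%N) /\ below k (A a c)) -> meq (mg A) (mg (colshift_mx A a b)).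
Proof.
move=> ab hab [c [k [ck hk]]].
pose e0 : edge (mg A) := exist _ (a, b, 0%N) hab.
pose h1 : edge (mg A) := exist _ (a, c, k) hk.
have h1e : h1 != e0.
  by apply: contraNneq ck => /(congr1 val) [-> ->].
pose P (p : edge (mg A) * bool) := if p.2 then rng p.1 == a else p.1 != e0.
pose F := @Graph V {p | P p} (fun p => src (val p).1)
  (fun p => if (val p).2 then b else rng (val p).1).
have cF : colshift e0 F.
  exists (fun u : vert F => u : V) (fun e : edge F => val e) => //.
  - by move=> u; split=> // _; exists u.
  - by move=> t; split=> [h|[[t' h] <-] //]; exists (exist _ t h).
have hs (u : vert (mg A)) : u \in enum V by rewrite mem_enum.
apply: meq_trans (@colshift_meq (mg A) e0 ab h1 erefl h1e F _ hs cF) (meq_iso _).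
apply: (@mg_iso _ F id); first by exists id.
move=> x y; apply: (@has_card_preimage _ _ (fun e : edge F => val e) _
  (fun p : edge (mg A) * bool => P p /\ src p.1 = x /\ (if p.2 then b else rng p.1) = y)).
- by move=> ? ? _ _; apply: val_inj.
- move=> p; split=> [[h1' h2]|[[p' h] h2 <-]] //.
  by exists (exist _ p h1').
have imf : has_card (fun p : edge (mg A) * bool => p.2 = false /\ P p /\ src p.1 = x /\ rng p.1 = y)
    (if (x == a) && (y == b) then epred (A a b) else A x y).
  apply: (@has_card_image _ _ (fun h : edge (mg A) => (h, false))
    (fun h => (src h = x /\ rng h = y) /\ h != e0)).
  - by move=> ? ? _ _ [].
  - move=> [h i] /=; split=> [[-> [h2 h3]]|[h' [h2 h3] [<- <-]]] //.
    by exists h.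
  case: ifP => [/andP[/eqP-> /eqP->]|xy].
    by apply: has_cardD1 => //; apply: mg_hom.
  apply: (eq_has_card _ (mg_hom x y)) => h; split=> [[h2 h3]|[//]]; split=> //.
  by apply: contraFneq xy => he; rewrite -h2 -h3 he /= !eqxx.
have imt : has_card (fun p : edge (mg A) * bool => p.2 = true /\ P p /\ src p.1 = x /\ b = y)
    (if y == b then A x a else Some 0).
  case: (eqVneq y b) => [->|yb]; last first.
    by apply: has_card0 => p [_ [_ [_ h]]]; rewrite h eqxx in yb.
  apply: (@has_card_image _ _ (fun h : edge (mg A) => (h, true)) _ _ _ _ _ (mg_hom x a)).
  - by move=> ? ? _ _ [].
  - move=> [h i]; rewrite /P /=; split=> [[-> [/eqP h2 [h3 _]]]|[h' [h2 h3] [<- <-]]] //.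
      by exists h.
    by rewrite h3 eqxx.
have := has_cardU _ imf imt; rewrite (_ : eadd _ _ = colshift_mx A a b x y); last first.
  rewrite /colshift_mx; case: (eqVneq y b) => [->|yb]; last by rewrite andbF eaddn0.
  by rewrite andbT.
move=> hU; apply: (eq_has_card _ (hU _)); last by move=> p [-> _] [].
move=> [h []]; rewrite /P /=; split.
- by case=> [[//]|[_ [? [? ?]]]].
- by move=> [? [? ?]]; right.
- by case=> [[_ [? [? ?]]]|[//]].
- by move=> [? [? ?]]; left.
Qed.

End MatrixGraph.

Section CollapseMatrix.
Context (V : finType).

Definition collapse_mx (A : mx (option V)) (n : V -> nat) : mx V :=
  fun x y => eadd (A (Some x) (Some y)) (emul (A (Some x) None) (n y)).

Lemma collapse1_mg (A : mx (option V)) (x0 : V) :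
  A None None = Some 0 -> (forall y, A None (Some y) = Some (y == x0 : nat)) ->
  meq (mg A) (mg (collapse_mx A (fun y => y == x0))).
Proof.
move=> AN AS.
have hf : below 0 (A None (Some x0)) by rewrite AS eqxx.
pose f : edge (mg A) := exist _ (None, Some x0, 0%N) hf.
pose F := @Graph V {h : edge (mg A) | h != f}
  (fun h => odflt x0 (src (val h))) (fun h => odflt x0 (rng (val h))).
have out_f (e : edge (mg A)) : src e = None <-> e = f.
  split=> [|-> //]; move: e => [[[u y] k] h] /= u0; apply: val_inj => /=.
  move: h; rewrite /mx_edge u0 /=; case: y => [y|]; last by rewrite AN.
  by rewrite AS; case: (y =P x0) => [->|//]; case: k.
have srcS (h : edge (mg A)) : h != f -> Some (odflt x0 (src h)) = src h.
  by move=> hn; case e : (src h) => //; move/out_f : e hn => ->; rewrite eqxx.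
have cF : collapses (None : vert (mg A)) f F.
  exists (fun u : vert F => Some u : vert (mg A)) (fun h : edge F => val h) => //.
  - case=> [u|]; split=> //; first by exists u.
    by case.
  - by move=> h; split=> [hn|[[h' hn] <-] //]; exists (exist _ h hn).
  - by case=> h hn; apply: srcS.
  - case=> h hn; change (Some (odflt x0 (rng h)) = if rng h == None then rng f else rng h).
    by case: (rng h).
have hs (u : vert (mg A)) : u \in enum {: option V} by rewrite mem_enum.
apply: meq_trans (@collapse_meq (mg A) None f F _ hs out_f _ cF) (meq_iso _) => //.
apply: (@mg_iso _ _ F id); first by exists id.
move=> x y; apply: (@has_card_preimage _ _ (fun e : edge F => val e) _
  (fun h : edge (mg A) => src h = Some x /\ odflt x0 (rng h) = y)).
- by move=> ? ? _ _; apply: val_inj.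
- move=> h; split=> [[h1 h2]|[[h' hn] [h1 h2] <-]].
    have hn : h != f by apply: contra_eq_neq h1 => ->.
    exists (exist _ h hn) => //; split; last exact: h2.
    by change (odflt x0 (src h) = x); rewrite h1.
  change (odflt x0 (src h') = x) in h1.
  by split; [rewrite -h1; apply/esym/srcS|exact: h2].
pose S1 (h : edge (mg A)) := src h = Some x /\ rng h = Some y.
pose S2 (h : edge (mg A)) := src h = Some x /\ rng h = None /\ y = x0.
have h1 : has_card S1 (A (Some x) (Some y)) by apply: (@mg_hom _ A).
have h2 : has_card S2 (emul (A (Some x) None) (y == x0)).
  case: (eqVneq y x0) => [yx|yx]; rewrite ?emul1 ?emul0 /S2.
    by apply: (eq_has_card _ (@mg_hom _ A (Some x) None)) => h; split=> [[? ?]|[? [? ?]]].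
  by apply: has_card0 => h [_ [_ h']]; rewrite h' eqxx in yx.
apply: (eq_has_card _ (has_cardU _ h1 h2)) => [h|h [_ r1] [_ [r2 _]]]; last by rewrite r1 in r2.
rewrite /S1 /S2; case: (rng h) => [r|] /=; split.
- by case=> [[? [->]]|[? []]].
- by case=> ? ->; left.
- by case=> [[]|[? [_ ->]]].
- by case=> ? ->; right.
Qed.

(** Each column addition from the collapsed vertex to one of its targets uses up one edge and
    compensates for it in the other rows, until a single edge is left and [collapse1_mg] applies. *)
Lemma collapse_mg (A : mx (option V)) (n : V -> nat) :
  A None None = Some 0 -> (forall y, A None (Some y) = Some (n y)) ->
  (exists y, n y != 0) -> meq (mg A) (mg (collapse_mx A n)).
Proof.
have [N] := ubnP (\sum_y n y); elim: N => // N IH in A n * => hN AN AS [y0 ny0].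
(* [y1] certifies a second outgoing edge besides the one to [y0] that the column addition uses
   up. *)
have [/existsP[y1 /andP[y1n hy1]]|] := boolP [exists y, ((y != y0) || (1 < n y)%N) && (n y != 0)].
  have e1 : exists (c : option V) k, (c, k) != (Some y0, 0%N) /\ below k (A None c).
    case/orP: y1n => [yy|n1].
      exists (Some y1), 0; rewrite AS /= lt0n hy1; split=> //.
      by rewrite xpair_eqE negb_and /= (inj_eq Some_inj) yy.
    by exists (Some y1), 1; rewrite AS /= n1 xpair_eqE andbF.
  have b0 : below 0 (A None (Some y0)) by rewrite AS /= lt0n.
  have h1 := @colshift_mg _ A None (Some y0) isT b0 e1.
  pose n' y := if y == y0 then (n y).-1 else n y.
  have sn : (\sum_y n' y < \sum_y n y)%N.
    rewrite (bigD1 y0) //= [X in (_ < X)%N](bigD1 y0) //= /n' eqxx.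
    rewrite (eq_bigr n); last by move=> y /negbTE ->.
    by rewrite ltn_add2r prednK ?leqnn // lt0n.
  apply: meq_trans h1 _; apply: meq_trans (IH _ n' _ _ _ _) (meq_iso _).
  - exact: leq_trans sn _.
  - by rewrite /colshift_mx /=.
  - move=> y; rewrite /colshift_mx /= (inj_eq Some_inj) /n' !AS AN.
    by case: eqP => [->|_] //=; rewrite addn0.
  - move: y1n hy1 ; rewrite -lt0n => y1n hy1; exists y1; rewrite /n'; case: eqP y1n => [->|_] //= h.
      by rewrite -lt0n -ltnS prednK // (leq_trans _ h).
    by rewrite -lt0n.
  - apply: mg_eq => x y; rewrite /collapse_mx /colshift_mx /= (inj_eq Some_inj) /n'.
    case: eqP => [->|_] //; rewrite -eaddA; congr eadd.
    by rewrite -emulS prednK // lt0n.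
rewrite negb_exists => /forallP hy.
have ny y : n y = (y == y0).
  have := hy y; rewrite negb_and negb_or !negbK; case: eqP => [->|_] /=.
    by rewrite (negbTE ny0) orbF -leqNgt; case: (n y0) ny0 => // [[]].
  by move/eqP.
have -> : n = (fun y => y == y0 : nat) by apply/funext => y; rewrite ny.
by apply: collapse1_mg => // y; rewrite AS ny.
Qed.

End CollapseMatrix.

Lemma graph_matrix (E : graph) : finite_set [set: vert E] ->
  exists (V : finType) (phi : vert E -> V) (A : mx V), bijective phi /\
    forall x y, has_card [set e : edge E | phi (src e) = x /\ phi (rng e) = y] (A x y).
Proof.
move=> /finite_enum[s us hs].
have {}hs x : x \in s by apply/hs.
have ixP x : (index x s < size s)%N by rewrite index_mem.
pose phi x : 'I_(size s) := Ordinal (ixP x).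
exists 'I_(size s), phi.
have h x y : {n | has_card [set e : edge E | phi (src e) = x /\ phi (rng e) = y] n}.
  by apply: cid; apply: has_card_ex.
exists (fun x y => projT1 (h x y)); split; last by move=> x y; case: (h x y).
apply: inj_surj_bij => [x y /(congr1 val) /=|i]; first exact: index_inj.
case: s us hs ixP @phi {h} i => [|x0 s] us hs ixP phi i; first by case: i.
exists (nth x0 (x0 :: s) i); apply: val_inj.
exact: (index_uniq x0 (ltn_ord i) us).
Qed.

(** * The Cuntz splice in matrix form *)

Section Splice.
Context (V : finType).
Implicit Types A : mx V.

(* [None] is the new vertex [v_1] and [Some None] the new vertex [v_2]; [l] is
   the number of loops at [v_1]. *)
Definition splice_mx A (v : V) (l : nat) : mx (option (option V)) := fun x y =>
  match x, y with
  | Some (Some x), Some (Some y) => A x y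
  | Some (Some x), None => Some (x == v : nat)
  | Some (Some x), Some None => Some 0
  | None, Some (Some y) => Some (y == v : nat)
  | None, Some None => Some 1
  | None, None => Some l
  | Some None, Some (Some _) => Some 0
  | Some None, _ => Some 1
  end.

(* With [B = A - 1], the extra vertex [None] has row [e_None + zeta] and row [x]
   of [B] is increased by [m x] times this row. *)
Definition ext_mx A (zeta m : V -> nat) : mx (option V) := fun x y =>
  match x, y with
  | Some x, Some y => eadd (A x y) (Some (m x * zeta y)%N)
  | Some x, None => Some (m x)
  | None, Some y => Some (zeta y)
  | None, None => Some 2
  end.

Definition delta (v x : V) : nat := x == v.

(** Adding column [v_2] to column [v_1] creates the loop at [v_1], so this loop may be dropped. The
    then loopless [v_1] is collapsed, and [v_2], now with two loops, one edge to [v] and one from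
    [v], is the vertex [z]. *)
Lemma splice_ext A v : meq (mg (splice_mx A v 1)) (mg (ext_mx A (delta v) (delta v))).
Proof.
apply: (@meq_trans _ (mg (splice_mx A v 0))).
  apply: meq_sym.
  have e1 : exists (c : option (option V)) k, (c, k) != (None, 0%N) /\
      below k (splice_mx A v 0 (Some None) c) by exists (Some None), 0.
  apply: meq_trans (@colshift_mg _ (splice_mx A v 0) (Some None) None isT isT e1) (meq_iso _).
  apply: mg_eq => -[[x|]|] [[y|]|] //=; rewrite /colshift_mx //=.
  by rewrite addn0.
pose n (y : option V) : nat := if y is Some y then y == v else 1.
apply: meq_trans (@collapse_mg _ (splice_mx A v 0) n _ _ _) (meq_iso _) => //.
- by case=> [y|].
- by exists None.
apply: mg_eq => -[x|] [y|] //; rewrite /collapse_mx /ext_mx /delta /=.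
- by congr eadd; case: (y == v) => //=; rewrite muln0.
- by rewrite muln1.
- by case: (y == v).
Qed.

End Splice.

Lemma splice_matrix (E : graph) (v : vert E) (V : finType) (phi : vert E -> V) (A : mx V) :
  bijective phi ->
  (forall x y, has_card [set e : edge E | phi (src e) = x /\ phi (rng e) = y] (A x y)) ->
  graph_iso (cuntz_splice v) (mg (splice_mx A (phi v) 1)).
Proof.
move=> phi_bij hA.
pose ph (u : vert (cuntz_splice v)) : option (option V) :=
  match u with inl u => Some (Some (phi u)) | inr new_v1 => None | inr new_v2 => Some None end.
have [psi h1 h2] := phi_bij.
have phI x y : (phi x == phi y) = (x == y) by rewrite (inj_eq (can_inj h1)).
apply: (@mg_iso _ _ (cuntz_splice v) ph).
  exists (fun w => match w with Some (Some x) => inl (psi x) | Some None => inr new_v2 | None => inr new_v1 end).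
    by case=> [x|[]] //=; rewrite h1.
  by case=> [[x|]|] //=; rewrite h2.
have one (x y : option (option V)) (e : splice_edge) :
  (forall e', ph (splice_src v e') = x /\ ph (splice_rng v e') = y <-> e' = inr e) ->
  has_card [set e : edge (cuntz_splice v) | ph (src e) = x /\ ph (rng e) = y] (Some 1).
  move=> h; exists [:: inr e]; split=> // e'; rewrite inE.
  by split=> [/h ->|/eqP ->]; rewrite ?eqxx //; apply/h.
have zero (x y : option (option V)) :
  (forall e', ~ (ph (splice_src v e') = x /\ ph (splice_rng v e') = y)) ->
  has_card [set e : edge (cuntz_splice v) | ph (src e) = x /\ ph (rng e) = y] (Some 0).
  by move=> h; exists [::]; split=> // e; split=> // /h.
case=> [[x|]|] [[y|]|]; rewrite [splice_mx _ _ _ _ _]/=.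
- apply: (@has_card_image _ _ (fun e : edge E => inl e : edge (cuntz_splice v)) _ _ _ _ _ (hA x y)).
    by move=> ? ? _ _ [].
  case=> [e|[]] /=; try by split=> [[]|[]].
  by split=> [[[<-] [<-]]|[e' [<- <-] [<-]] //]; exists e.
- by apply: zero => -[e|[]] [].
- case: eqP => [->|xv].
    by apply: (@one _ _ new_e1) => -[e|[]] /=; split=> //; case.
  by apply: zero => -[e|[]] [] //= [] /esym.
- by apply: zero => -[e|[]] [].
- by apply: (@one _ _ new_h2) => -[e|[]] /=; split=> //; case.
- by apply: (@one _ _ new_f2) => -[e|[]] /=; split=> //; case.
- case: eqP => [->|xv].
    by apply: (@one _ _ new_e2) => -[e|[]] /=; split=> //; case.
  by apply: zero => -[e|[]] [] //= _ [] /esym.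
- by apply: (@one _ _ new_f1) => -[e|[]] /=; split=> //; case.
- by apply: (@one _ _ new_h1) => -[e|[]] /=; split=> //; case.
Qed.

(** * Saturating the infinite rows *)

Lemma mg_reindex (V W : finType) (A : mx W) (phi : V -> W) : bijective phi ->
  graph_iso (mg (fun x y => A (phi x) (phi y))) (mg A).
Proof.
move=> phi_bij; have [psi h1 h2] := phi_bij.
apply: (@mg_iso _ A (mg (fun x y => A (phi x) (phi y))) phi phi_bij) => x y.
have := @mg_hom _ (fun x y => A (phi x) (phi y)) (psi x) (psi y); rewrite !h2.
apply: eq_has_card => e; split=> -[e1 e2]; split.
- exact: canLR h2 e1.
- exact: canLR h2 e2.
- exact: canRL h1 e1.
- exact: canRL h1 e2.
Qed.

Section Saturation.
Context (V : finType).
Implicit Types A : mx V.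

Definition collapse_at A (y0 : V) : mx {x : V | x != y0} := fun p q =>
  eadd (A (val p) (val q)) (emul (A (val p) y0) (odflt 0 (A y0 (val q)))).

Arguments collapse_at : clear implicits.

Lemma collapse_at_mg A y0 : A y0 y0 = Some 0 -> (forall y, A y0 y <> None) ->
  (exists y, A y0 y != Some 0) -> meq (mg A) (mg (collapse_at A y0)).
Proof.
move=> loopless fin [y hy].
pose phi (x : option {x : V | x != y0}) : V := if x is Some x then val x else y0.
have phi_bij : bijective phi.
  exists (fun x => insub x) => [[x|]|x] /=; first by rewrite valK.
    by rewrite insubF // eqxx.
  by case: insubP => [u _ <- //|]; rewrite negbK => /eqP ->.
apply: meq_trans (meq_sym (meq_iso (mg_reindex A phi_bij))) _.
apply: (@collapse_mg _ (fun x y => A (phi x) (phi y)) (fun q => odflt 0 (A y0 (val q)))) => //.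
- by move=> q /=; case: (A y0 (val q)) (fin (val q)).
- have yy : y != y0 by apply: contraNneq hy => ->; rewrite loopless.
  exists (exist _ y yy) => /=.
  by case: (A y0 y) (fin y) hy.
Qed.

Definition set_inf A (u x : V) : mx V := fun p q =>
  if (p == u) && (q == x) then None else A p q.

(** The two graphs are compared through their common collapse at [y0]. *)
Lemma set_inf_collapse A u x y0 : A y0 y0 = Some 0 -> (forall y, A y0 y <> None) ->
  (exists y, A y0 y != Some 0) -> u != y0 ->
  (forall p q, collapse_at (set_inf A u x) y0 p q = collapse_at A y0 p q) ->
  meq (mg A) (mg (set_inf A u x)).
Proof.
move=> loopless fin nz uy h.
have row y : set_inf A u x y0 y = A y0 y by rewrite /set_inf eq_sym (negbTE uy).
apply: meq_trans (collapse_at_mg loopless fin nz) _; apply: meq_sym.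
apply: meq_trans (@collapse_at_mg (set_inf A u x) y0 _ _ _) (meq_iso _).
- by rewrite row.
- by move=> y; rewrite row.
- by case: nz => y hy; exists y; rewrite row.
- exact: mg_eq.
Qed.

(** Collapsing [x] turns the edges from [u] to [x] into edges from [u] to successors of [x], of
    which there are infinitely many already; so their number is immaterial. *)
Lemma set_inf_source A u x : A x x = Some 0 -> (forall y, A x y <> None) ->
  (exists y, A x y != Some 0) -> u != x ->
  (forall y, A x y != Some 0 -> A u y = None) -> meq (mg A) (mg (set_inf A u x)).
Proof.
move=> loopless fin nz ux hu; apply: (set_inf_collapse loopless fin nz ux) => -[p hp] [q hq].
rewrite /collapse_at /set_inf /= (negbTE hq) andbF (eq_sym x) (negbTE ux) /= eqxx andbT.
case: eqP => [->|//]; have := hu q; have := fin q.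
by case: (A x q) => [[|n]|] //= _ ->.
Qed.

(** Adding column [p] to column [x] makes the entry at [(u, x)] infinite whatever it was. When [p]
    has neither a loop nor an infinite entry, it may lack the second edge that this addition
    requires, and [p] is collapsed instead. *)
Lemma set_inf_edge A u p x : A u p = None -> p != x -> A p x != Some 0 ->
  meq (mg A) (mg (set_inf A u x)).
Proof.
move=> up px hpx.
have [pu|pu] := pselect ((A p p != Some 0) \/ exists y, A p y = None); last first.
  have pp : A p p = Some 0 by apply/eqP/negPn/negP => h; apply: pu; left.
  have fin y : A p y <> None by move=> h; apply: pu; right; exists y.
  have unp : u != p by apply/eqP => e; move: up; rewrite e pp.
  apply: (set_inf_collapse pp fin _ unp); first by exists x.
  move=> [r hr] [q hq]; rewrite /collapse_at /set_inf /= (negbTE px) !andbF (eq_sym p) (negbTE unp) /=.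
  case: eqP => [->|//] /=; case: eqP => [->|//] /=; rewrite up.
  by case: (A p x) hpx (fin x) => [[|n]|] //= _ _; rewrite eaddN.
have b0 : below 0 (A p x) by rewrite below_ex.
have e1 : exists c k, (c, k) != (x, 0%N) /\ below k (A p c).
  case: pu => [h|[y hy]]; first by exists p, 0; rewrite xpair_eqE (negbTE px) below_ex.
  by exists y, 1; rewrite hy xpair_eqE andbF.
have sub r c k : below k (A r c) -> below k (set_inf A u x r c).
  by rewrite /set_inf; case: ifP.
apply: meq_trans (colshift_mg px b0 e1) _; apply: meq_sym.
apply: meq_trans (@colshift_mg _ (set_inf A u x) p x px _ _) (meq_iso _).
- exact: sub.
- by case: e1 => c [k [h1 h2]]; exists c, k; split=> //; apply: sub.
apply: mg_eq => r q; rewrite /colshift_mx /set_inf (negbTE px) !andbF eqxx !andbT.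
case: (q =P x) => _; last by rewrite andbF.
rewrite ?andbT; case: (r =P p) => [->|_]; case: (_ =P u) => // h.
  by move: up; rewrite -h => ->; rewrite !eaddN.
by rewrite h up !eaddN.
Qed.

Definition inf_row A x := [exists z, A x z == None].
Definition sat A : mx V := fun x y => if inf_row A x then None else A x y.
Definition adj A : rel V := fun x y => A x y != Some 0.

Lemma inf_row_set_inf A u x y : inf_row A u -> inf_row (set_inf A u x) y = inf_row A y.
Proof.
move=> /existsP[z /eqP hz]; apply/existsP/existsP => -[t]; rewrite /set_inf.
  by case: ifP => [/andP[/eqP -> _] _|_ h]; [exists z; rewrite hz|exists t].
by move=> h; exists t; rewrite (eqP h) if_same.
Qed.

Lemma adj_set_inf A u x : subrel (adj A) (adj (set_inf A u x)).
Proof. by move=> p q; rewrite /adj /set_inf; case: ifP. Qed.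

Lemma connect_mono (T : finType) (e e' : rel T) :
  subrel e e' -> subrel (connect e) (connect e').
Proof. by move=> h; apply: connect_sub => x y xy; apply: connect1; apply: h. Qed.

Lemma closed_connect_pred (T : finType) (e : rel T) (P : pred T) x y :
  (forall a b, P a -> e a b -> P b) -> P x -> connect e x y -> P y.
Proof.
move=> cl Px /connectP[p pp ->] {y}.
elim: p x Px pp => //= z p IH x Px /andP[xz pz]; apply: IH pz; exact: cl Px xz.
Qed.

Section Induction.
Context (v : V) (R : pred V) (h : V -> nat).

(** [R] will be the set of vertices reachable from [v], and [h] a rank certifying that no cycle lies
    outside [R]. Both are fixed independently of [A]: they survive changes in infinite rows, because
    those rows belong to [R]. *)
Record sat_inv A : Prop := SatInv {
  si_inf : forall u, inf_row A u -> R u;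
  si_rank : forall x y, ~~ R x -> ~~ R y -> adj A x y -> (h y < h x)%N;
  si_to : forall x, connect (adj A) x v;
  si_from : forall x, R x -> connect (adj A) v x
}.

Lemma sat_inv_set_inf A u x : inf_row A u -> sat_inv A -> sat_inv (set_inf A u x).
Proof.
move=> iu [h1 h2 h3 h4]; split.
- by move=> y; rewrite inf_row_set_inf //; apply: h1.
- move=> p q hp hq; rewrite /adj /set_inf; case: ifP => [/andP[/eqP pu _]|_].
    by move: hp; rewrite pu h1.
  exact: h2.
- move=> p; apply: connect_mono (h3 p); exact: adj_set_inf.
- move=> p hp; apply: connect_mono (h4 p hp); exact: adj_set_inf.
Qed.

Lemma sat_set_inf A u x : inf_row A u -> sat (set_inf A u x) =2 sat A.
Proof.
move=> iu p q; rewrite /sat inf_row_set_inf //; case: ifP => // ip.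
by rewrite /set_inf; case: ifP => // /andP[/eqP pu _]; move: ip; rewrite pu iu.
Qed.

(** The induction is on the number of finite entries in infinite rows. If row [u] is infinite at [p]
    but not at some successor of [p], [set_inf_edge] applies. Otherwise its infinite entries are
    closed under successors, hence include [v] and all of [R], and a finite entry of least rank
    falls to [set_inf_source]. *)
Lemma sat_mg_inv A : sat_inv A -> meq (mg A) (mg (sat A)).
Proof.
pose bad A (t : V * V) := inf_row A t.1 && (A t.1 t.2 != None).
have [N] := ubnP #|bad A|; elim: N => // N IH in A * => hN inv.
have [/existsP[[u x] /= /andP[iu ux]]|nobad] := boolP [exists t, bad A t]; last first.
  apply/meq_iso/mg_eq => x y; rewrite /sat; case: ifP => // ix.
  by move/existsPn: nobad => /(_ (x, y)); rewrite /bad /= ix negbK => /eqP.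
have step y : A u y != None -> meq (mg A) (mg (set_inf A u y)) -> meq (mg A) (mg (sat A)).
  move=> uy m; apply: meq_trans m _; apply: meq_trans (IH _ _ _) (meq_iso _).
  - rewrite ltnS in hN; apply: leq_trans hN; apply: proper_card.
    apply/properP; split; last first.
      exists (u, y); first by rewrite /in_mem /= /bad /= iu uy.
      by rewrite /in_mem /= /bad /= /set_inf !eqxx andbF.
    apply/fintype.subsetP => -[p q]; rewrite /in_mem /= /bad /= inf_row_set_inf // => /andP[->].
    by rewrite /set_inf; case: ifP.
  - exact: sat_inv_set_inf.
  - by apply: mg_eq; apply: sat_set_inf.
have [/existsP[p /existsP[q /and3P[/eqP up pq uq]]]|nopq] :=
    boolP [exists p, exists q, [&& A u p == None, adj A p q & A u q != None]].
  apply: (step q uq); apply: (set_inf_edge up _ pq).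
  by apply: contraNneq uq => <-; rewrite up.
have cl a b : A u a == None -> adj A a b -> A u b == None.
  move=> ua ab; move/existsPn: nopq => /(_ a)/existsPn/(_ b).
  by rewrite ua ab /= negbK.
have uv : A u v == None.
  have /existsP[z uz] := iu.
  exact: (closed_connect_pred cl uz (si_to inv z)).
have uR y : R y -> A u y == None.
  by move=> Ry; apply: (closed_connect_pred cl uv (si_from inv Ry)).
pose x0 := [arg min_(y < x | A u y != None) h y].
have [ux0 hx0] : A u x0 != None /\ forall y, A u y != None -> (h x0 <= h y)%N.
  by rewrite /x0; case: arg_minnP.
have Rx0 : ~~ R x0 by apply: contra ux0 => /uR.
have succ y : adj A x0 y -> A u y = None.
  move=> xy; have [/uR/eqP //|Ry] := boolP (R y); apply/eqP/negPn/negP => uy.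
  by have := si_rank inv Rx0 Ry xy; rewrite ltnNge hx0.
apply: (step x0 ux0); apply: set_inf_source.
- by apply/eqP/negPn/negP => /(si_rank inv Rx0 Rx0); rewrite ltnn.
- by move=> y xy; move: Rx0; rewrite (si_inf inv) //; apply/existsP; exists y; rewrite xy.
- have /connectP[[|y p] /= pp ev] := si_to inv x0.
    by move: ux0; rewrite -ev uv.
  by exists y; case/andP: pp.
- by apply: contraNneq Rx0 => <-; apply: si_inf inv _ iu.
- exact: succ.
Qed.
End Induction.

(** The rank of [x] is the number of vertices it reaches. Along an edge from [x] to [y] it drops
    unless [y] leads back to [x], and then [x] lies on a cycle and is reachable from [v]. *)
Lemma sat_mg A v :
  (forall x, connect (adj A) x v) -> (forall u, inf_row A u -> connect (adj A) v u) ->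
  (forall x y, adj A x y -> connect (adj A) y x -> connect (adj A) v x) ->
  meq (mg A) (mg (sat A)).
Proof.
move=> h1 h2 h3.
apply: (@sat_mg_inv v (connect (adj A) v) (fun x => #|connect (adj A) x|)); split=> //.
move=> x y xR yR xy; apply: proper_card; apply/properP; split.
  by apply/fintype.subsetP => z; rewrite !inE; apply: connect_trans; apply: connect1.
exists x; rewrite !inE; first exact: connect0.
by apply: contra xR; apply: h3 xy.
Qed.

End Saturation.

(** * Integer matrices *)

Import Order.TTheory Num.Theory.

Local Open Scope ring_scope.

Section IntMatrix.
Context (V : finType) (I : pred V).
Implicit Types (B : V -> V -> int).

(** [B] stands for [A - 1]. Its entries in rows of [I] are ignored, and [absz] is harmless under
    [nn]. *)
Definition sg B : graph :=
  mg (fun x y => if I x then None else Some (absz (B x y + (x == y)%:Z))).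

Definition nn B := forall x y, ~~ I x -> 0 <= B x y + (x == y)%:Z.

Definition colop B (a b : V) (n : nat) : V -> V -> int :=
  fun x y => if y == b then B x b + n%:Z * B x a else B x y.

Lemma sg_eq B B' : (forall x y, ~~ I x -> B x y = B' x y) -> meq (sg B) (sg B').
Proof.
by move=> h; apply/meq_iso/mg_eq => x y; case: (boolP (I x)) => // Ix; rewrite h.
Qed.

(** A regular [a] needs the edge to [b] that the shift consumes, and a loop, since [0 <= B a a] says
    [1 <= A a a]. The loop is the second edge required by [colshift_mg], and it keeps the condition
    true when the addition is repeated. *)
Definition can_add B (a b : V) := ~~ I a -> (1 <= B a b) /\ (0 <= B a a).

Lemma nn_neq B x y : nn B -> ~~ I x -> x != y -> 0 <= B x y.
Proof. by move=> h Ix /negbTE xy; have := h x y Ix; rewrite xy addr0. Qed.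

Lemma nn_colop B a b n : a != b -> nn B -> can_add B a b -> nn (colop B a b n).
Proof.
move=> ab hB hab x y Ix; rewrite /colop; case: eqP => [->|_]; last exact: hB.
have hx : 0 <= B x a.
  have [xa|] := eqVneq x a; last exact: nn_neq.
  by rewrite xa in Ix *; have [] := hab Ix.
by rewrite addrAC addr_ge0 ?hB // mulr_ge0.
Qed.

Lemma sg_colop1 B a b : a != b -> nn B -> can_add B a b ->
  meq (sg B) (sg (colop B a b 1)).
Proof.
move=> ab hB hab; have ba : (b == a) = false by rewrite eq_sym (negbTE ab).
rewrite /sg; set A := (fun x y => _).
have b0 : below 0 (A a b).
  by rewrite /A; case: (boolP (I a)) => // /hab[h _] /=; rewrite (negbTE ab); lia.
have e1 : exists c k, (c, k) != (b, 0%N) /\ below k (A a c).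
  rewrite /A; case: (boolP (I a)) => [Ia|/hab[_ h]].
    by exists b, 1%N; rewrite xpair_eqE andbF.
  by exists a, 0%N; rewrite xpair_eqE (negbTE ab) !eqxx /=; split=> //; lia.
apply: meq_trans (colshift_mg ab b0 e1) (meq_iso (mg_eq _)) => x y.
rewrite /colshift_mx /A /colop; case: (y =P b) => [->|_] //.
have [xa|xa] := eqVneq x a.
  rewrite xa; case: (boolP (I a)) => // /hab[h1 h2] /=.
  by rewrite (negbTE ab) ?eqxx; congr Some; lia.
case: (boolP (I x)) => // Ix /=; rewrite ?(negbTE xa) ?addr0.
by have := hB x b Ix; have := nn_neq hB Ix xa; move=> h1 h2; congr Some; lia.
Qed.

Lemma sg_colop B a b n : a != b -> nn B -> can_add B a b ->
  meq (sg B) (sg (colop B a b n)).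
Proof.
move=> ab; elim: n B => [|n IH] B hB hab.
  by apply: sg_eq => x y _; rewrite /colop; case: eqP => [->|//]; rewrite mul0r addr0.
have ab' : (a == b) = false by apply/negbTE.
apply: meq_trans (sg_colop1 ab hB hab) _; apply: meq_trans (IH _ _ _) _.
- exact: nn_colop.
- by move=> /hab[h1 h2]; rewrite /colop eqxx ab'; split=> //; lia.
apply: sg_eq => x y _; rewrite /colop; case: eqP => [_|//]; rewrite eqxx ab'.
by rewrite mul1r -addrA -[X in _ + (X + _)]mul1r -mulrDl; congr (_ + _ * _); lia.
Qed.

(** A saturated infinite emitter sends edges everywhere, so its column can be added to any other
    one; [n w = 0] keeps column [w] itself fixed meanwhile. *)
Lemma sg_multi B w (n : V -> nat) : I w -> n w = 0%N -> nn B ->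
  meq (sg B) (sg (fun x y => B x y + (n y)%:Z * B x w)).
Proof.
move=> Iw nw hB.
pose C (s : seq V) : V -> V -> int := fun x y => if y \in s then B x y + (n y)%:Z * B x w else B x y.
have hx x : ~~ I x -> 0 <= B x w by move=> Ix; apply: nn_neq => //; apply: contraNneq Ix => ->.
have nnC s : nn (C s).
  move=> x y Ix; rewrite /C; case: ifP => _; last exact: hB.
  by rewrite addrAC addr_ge0 ?hB // mulr_ge0 ?hx.
have key s : uniq s -> meq (sg B) (sg (C s)).
  elim: s => [|y s IH] /=; first by move=> _; apply: sg_eq.
  case/andP => ys us; apply: meq_trans (IH us) _.
  have [yw|yw] := eqVneq y w.
    apply: sg_eq => x y' _; rewrite /C inE; case: (y' =P y) => [->|//] /=.
    by rewrite (negbTE ys) yw nw mul0r addr0.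
  have wy : w != y by rewrite eq_sym.
  apply: meq_trans (sg_colop (n y) wy (nnC s) _) _; first by rewrite /can_add Iw.
  apply: sg_eq => x y' _; rewrite /colop /C inE; case: (y' =P y) => [->|//] /=.
  by rewrite (negbTE ys); case: ifP => //; rewrite nw mul0r addr0.
apply: meq_trans (key _ (enum_uniq V)) _.
by apply: sg_eq => x y _; rewrite /C mem_enum.
Qed.

End IntMatrix.

(** A loopless regular vertex has pivot -1 in [B], and its collapse is the Schur complement with
    respect to this pivot. *)
Lemma sg_collapse (V : finType) (I : pred (option V)) B :
  ~~ I None -> nn I B -> B None None = -1 -> (exists y, B None (Some y) != 0) ->
  meq (sg I B) (sg (fun x => I (Some x))
    (fun x y => B (Some x) (Some y) + B (Some x) None * B None (Some y))).
Proof.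
move=> IN hB hN [y0 hy0].
apply: meq_trans (@collapse_mg V _ (fun y => absz (B None (Some y))) _ _ _) (meq_iso (mg_eq _)).
- by rewrite (negbTE IN) hN eqxx.
- by move=> y; rewrite (negbTE IN) addr0.
- by exists y0; rewrite absz_eq0.
move=> x y; rewrite /collapse_mx (inj_eq Some_inj).
case: (boolP (I (Some x))) => //= Ix.
have h1 := hB (Some x) (Some y) Ix; have h2 := @nn_neq _ _ _ (Some x) None hB Ix isT.
have h3 := @nn_neq _ _ _ None (Some y) hB IN isT; rewrite (inj_eq Some_inj) in h1.
have -> : emul (Some (absz (B (Some x) None + 0))) (absz (B None (Some y))) =
          Some (absz (B (Some x) None * B None (Some y))).
  by rewrite addr0 abszM; case: (absz (B None (Some y))) => [|k] //=; rewrite muln0.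
have := mulr_ge0 h2 h3; move: (_ * _) => p hp /=; congr Some; lia.
Qed.

Lemma sg_reindex (V W : finType) (I : pred W) B (phi : V -> W) : bijective phi ->
  meq (sg (fun x => I (phi x)) (fun x y => B (phi x) (phi y))) (sg I B).
Proof.
move=> phi_bij; apply: meq_trans (meq_iso _) (meq_iso (mg_reindex _ phi_bij)).
by apply: mg_eq => x y; rewrite (inj_eq (bij_inj phi_bij)).
Qed.

(** * Extensions by a vertex with pivot +1 *)

Section Extension.
Context (V : finType) (I : pred V).
Implicit Types (B : V -> V -> int) (zeta m : V -> nat).

Definition ext B zeta m : option V -> option V -> int := fun x y =>
  match x, y with
  | Some x, Some y => B x y + (m x)%:Z * (zeta y)%:Z
  | Some x, None => (m x)%:Z
  | None, Some y => (zeta y)%:Z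
  | None, None => 1
  end.
Definition extI : pred (option V) := fun x => if x is Some x then I x else false.

Definition ext_equiv B zeta m := meq (sg I B) (sg extI (ext B zeta m)).

Lemma nn_ext B zeta m : nn I B -> nn extI (ext B zeta m).
Proof.
move=> hB [x|] [y|] Ix //=; rewrite ?addr0 //.
by rewrite addrAC addr_ge0 ?mulr_ge0 // (inj_eq Some_inj) hB.
Qed.

(** [zeta] is part of a row and follows the column addition, whereas [m] is a column of its own and
    stays; hence [zeta] varies and [m] is fixed. *)
Lemma ext_equiv_colop B zeta m a b n : a != b -> nn I B -> can_add I B a b ->
  ext_equiv (colop B a b n) (fun y => if y == b then zeta b + n * zeta a else zeta y)%N m ->
  ext_equiv B zeta m.
Proof.
move=> ab hB hab h; apply: meq_trans (sg_colop n ab hB hab) _.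
apply: meq_trans h _; apply: meq_sym.
have ab' : Some a != Some b by rewrite (inj_eq Some_inj).
apply: meq_trans (sg_colop n ab' (nn_ext zeta m hB) _) _.
  move=> /hab [h1 h2] /=; split; last by rewrite addr_ge0 // mulr_ge0.
  by apply: le_trans h1 _; rewrite lerDl mulr_ge0.
apply: sg_eq => -[x|] [y|] _; rewrite /colop /= ?(inj_eq Some_inj) //; case: eqP => [_|//].
  by rewrite PoszD PoszM; ring.
by rewrite PoszD PoszM.
Qed.

Lemma ext_equiv_multi B zeta m w n : I w -> n w = 0%N -> nn I B ->
  ext_equiv (fun x y => B x y + (n y)%:Z * B x w) (fun y => zeta y + n y * zeta w)%N m ->
  ext_equiv B zeta m.
Proof.
move=> Iw nw hB h; apply: meq_trans (sg_multi Iw nw hB) _.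
apply: meq_trans h _; apply: meq_sym.
apply: meq_trans (@sg_multi _ extI _ (Some w) (fun y => if y is Some y then n y else 0%N) Iw nw (nn_ext zeta m hB)) _.
apply: sg_eq => -[x|] [y|] _ /=; rewrite ?mul0r ?addr0 //.
by rewrite PoszD PoszM; ring.
Qed.

(** Adding the new column to column [y] changes row [x] by [m x], exactly what raising [zeta y]
    demands. So [zeta] can be increased at will wherever it is positive. *)
Lemma ext_zeta B zeta m y n : nn I B -> (0 < zeta y)%N ->
  meq (sg extI (ext B zeta m)) (sg extI (ext B (fun u => zeta u + (u == y) * n)%N m)).
Proof.
move=> hB hy; apply: meq_trans (@sg_colop _ extI _ None (Some y) n isT (nn_ext zeta m hB) _) _.
  by move=> _ /=; split=> //; lia.
apply: sg_eq => -[x|] [u|] _; rewrite /colop //= ?(inj_eq Some_inj).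
  have [->|_] := eqVneq u y; rewrite ?mul0n ?addn0 // mul1n PoszD mulrDr.
  by ring.
by have [->|_] := eqVneq u y; rewrite ?mul0n ?addn0 // mul1n PoszD mulr1.
Qed.

End Extension.

Section Comparison.
Context (V : finType) (I : pred V).
Implicit Types (B : V -> V -> int) (zeta m : V -> nat).

(* Column [w] of the extension is the sum of the columns [b] and [None]; [X1] is
   the extension before that addition.  [X3] differs from [X1] in column [None],
   chosen so that [X1] with column [b] added to [None] is [X3] with [zeta b + 2]
   times column [w] added to [None], and [X3] admits a collapse of [None]. *)
Lemma ext_equiv_twin_succ B zeta m w b : I w -> ~~ I b -> nn I B ->
  (forall x, ~~ I x -> B x w = B x b /\ 1 <= B x b) ->
  zeta w = (zeta b).+1 -> (0 < m b)%N -> (forall x, ~~ I x -> (m x)%:Z <= B x b) ->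
  ext_equiv I B zeta m.
Proof.
move=> Iw Ib hB hwb hz mb hm; have wb : w != b by apply: contraNneq Ib => <-.
have bw : b != w by rewrite eq_sym.
pose X1 (x y : option V) : int :=
  if y == Some w then ext B zeta m x None else ext B zeta m x y.
pose X3 (x y : option V) : int :=
  if y is Some _ then X1 x y else if x is Some x then B x b - (m x)%:Z else -1.
have nw x : ~~ I x -> (x == w) = false by move=> Ix; apply: contraNF Ix => /eqP ->.
have nn1 : nn (extI I) X1.
  move=> x y Ix; rewrite /X1; case: (y =P Some w) => [->|_]; last exact: (nn_ext zeta m hB).
  by case: x Ix => [x|] Ix //=; rewrite (inj_eq Some_inj) nw // addr0.
have nn3 : nn (extI I) X3.
  move=> [x|] [y|] Ix //; try exact: nn1.
  by rewrite /= addr0 subr_ge0 hm.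
have bw' : Some b != Some w by rewrite (inj_eq Some_inj).
have Xbb : 0 <= X1 (Some b) (Some b).
  rewrite /X1 (negbTE bw') /= addr_ge0 ?mulr_ge0 //.
  by have [_ h] := hwb b Ib; apply: le_trans h.
pose Y x y := B x y + (if y == w then 0%N else zeta y)%:Z * B x w.
have s1 : meq (sg I B) (sg I Y) by apply: sg_multi; rewrite ?eqxx.
have s2 : meq (sg (extI I) X3) (sg I Y).
  apply: meq_trans (sg_collapse _ nn3 _ _) (sg_eq _) => //.
    by exists w; rewrite /X3 /X1 eqxx.
  move=> x y Ix; rewrite /X3 /X1 /Y /= !(inj_eq Some_inj); have [-> _] := hwb x Ix.
  have [-> {y}|_] := eqVneq y w; last by ring.
  by have [-> _] := hwb x Ix; ring.
have s3 : meq (sg (extI I) X1) (sg (extI I) (colop X1 (Some b) None 1)).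
  by apply: sg_colop => // _; split=> //=; rewrite lez_nat.
have s4 : meq (sg (extI I) X3) (sg (extI I) (colop X1 (Some b) None 1)).
  apply: meq_trans (@sg_colop _ (extI I) X3 (Some w) None (zeta b).+2 isT nn3 _) (sg_eq _).
    by rewrite /can_add /= Iw.
  move=> [x|] [y|] Ix //; rewrite /colop /= /X1 /= !(inj_eq Some_inj) eqxx (negbTE bw).
    by rewrite -[(zeta b).+2]addn2 PoszD; ring.
  by rewrite -[(zeta b).+2]addn2 PoszD; ring.
have s5 : meq (sg (extI I) X1) (sg (extI I) (ext B zeta m)).
  apply: meq_trans (@sg_colop _ (extI I) X1 (Some b) (Some w) 1 bw' nn1 _) (sg_eq _).
    by move=> _; split=> //; rewrite /X1 eqxx /= lez_nat.
  move=> x y Ix; rewrite /colop /X1 eqxx (negbTE bw'); case: (y =P Some w) => // ->.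
  case: x Ix => [x|] Ix /=; last by rewrite hz -addn1 PoszD; ring.
  by have [-> _] := hwb x Ix; rewrite hz -addn1 PoszD; ring.
apply: meq_trans s1 _; apply: meq_trans (meq_sym s2) _; apply: meq_trans s4 _.
exact: meq_trans (meq_sym s3) s5.
Qed.

(** Positive values of [zeta] may be raised: [zeta b] goes to [zeta b + zeta w], and [zeta w] to one
    more than that, which is the normalization required by [ext_equiv_twin_succ]. *)
Lemma ext_equiv_twin B zeta m w b : I w -> ~~ I b -> nn I B ->
  (forall x, ~~ I x -> B x w = B x b /\ 1 <= B x b) ->
  (0 < zeta w)%N -> (0 < zeta b)%N -> (0 < m b)%N ->
  (forall x, ~~ I x -> (m x)%:Z <= B x b) -> ext_equiv I B zeta m.
Proof.
move=> Iw Ib hB hwb zw zb mb hm; have wb : (w == b) = false by apply: contraNF Ib => /eqP <-.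
pose z1 u := (zeta u + (u == b) * zeta w)%N.
apply: (meq_trans (ext_equiv_twin_succ Iw Ib hB hwb (zeta := fun u => z1 u + (u == w) * (zeta b).+1)%N _ mb hm)).
  by rewrite /z1 !eqxx wb (eq_sym b) wb; lia.
apply: meq_sym; apply: meq_trans (ext_zeta _ (zeta w) hB zb) (ext_zeta _ _ hB _).
by rewrite addn_gt0 zw.
Qed.

(** Adding column [x] to column [c] [n] times replaces [phi x] by [phi x - n phi c] in the kernel
    relation. As only nonnegative multiples are available, positive entries are cancelled against
    [w] and negative ones against [b]. Once no other entry is left, the relation says that columns
    [w] and [b] agree on regular rows. *)
Lemma ext_equiv_balance B zeta m w b (phi : V -> int) :
  I w -> ~~ I b ->
  (forall x y, ~~ I x -> 0 <= B x y) -> (forall x, ~~ I x -> 1 <= B x w) ->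
  (forall x, ~~ I x -> x != b -> 1 <= B x b) ->
  (forall x, ~~ I x -> \sum_y B x y * phi y = 0) -> phi w = 1 -> phi b = -1 ->
  (0 < zeta w)%N -> (0 < zeta b)%N -> (0 < m b)%N ->
  (forall x, ~~ I x -> (m x)%:Z <= B x w) -> ext_equiv I B zeta m.
Proof.
move=> Iw Ib; have wb : w != b by apply: contraNneq Ib => <-.
have [N] := ubnP #|[pred x | [&& x != w, x != b & phi x != 0]]|.
elim: N => // N IH in B zeta phi * => hN h0 hw hb hphi pw pb zw zb mb hm.
have hnn : nn I B by move=> x y Ix; rewrite addr_ge0 ?h0.
have [/existsP[x /and3P[xw xb px]]|] := boolP [exists x, [&& x != w, x != b & phi x != 0]]; last first.
  rewrite negb_exists => /forallP z.
  have e x : ~~ I x -> B x w = B x b.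
    move=> Ix; have := hphi x Ix; rewrite (bigD1 w) //= (bigD1 b) ?[b == w]eq_sym //=.
    rewrite big1; last first.
      move=> y /andP[yw yb]; have := z y; rewrite yw yb /= negbK => /eqP ->.
      by rewrite mulr0.
    rewrite pw pb mulr1 mulrN1 addr0; exact: subr0_eq.
  apply: (@ext_equiv_twin _ _ _ w b) => // x Ix; rewrite -?e //.
  - by split=> //; apply: hw.
  - exact: hm.
pose phi' y := if y == x then 0 else phi y.
have sN : (#|[pred x | [&& x != w, x != b & phi' x != 0]]| < N)%N.
  rewrite ltnS in hN; apply: leq_trans hN; apply: proper_card; apply/properP; split.
    apply/fintype.subsetP => y; rewrite !inE /phi' => /and3P[-> ->] /=.
    by case: ifP => // _; rewrite eqxx.
  by exists x; rewrite !inE ?xw ?xb //= /phi' eqxx eqxx.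
(* Cancelling [phi x] against a column [c] with [phi c = s = +-1]. *)
have step (c : V) (n : nat) (s : int) : x != c -> c = w \/ c = b -> phi c = s -> phi x = n%:Z * s ->
    ext_equiv I B zeta m.
  move=> xc hc pc pxn.
  have hx : can_add I B x c.
    move=> Ix; split; last exact: h0.
    by case: hc => ->; [apply: hw|apply: hb].
  apply: (ext_equiv_colop (n := n) xc hnn hx); apply: (IH _ _ phi') => //.
  - move=> u y Iu; rewrite /colop; case: eqP => _; last exact: h0.
    by rewrite addr_ge0 ?mulr_ge0 ?h0.
  - move=> u Iu; rewrite /colop; case: eqP => [<-|_]; last exact: hw.
    by apply: le_trans (hw u Iu) _; rewrite lerDl mulr_ge0 ?h0.
  - move=> u Iu ub; rewrite /colop; case: eqP => [<-|_]; last exact: hb.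
    by apply: le_trans (hb u Iu ub) _; rewrite lerDl mulr_ge0 ?h0.
  - move=> u Iu; apply: etrans (hphi u Iu); rewrite (bigD1 x) //= (bigD1 c) //=; last by rewrite eq_sym.
    rewrite [RHS](bigD1 x) //= [in RHS](bigD1 c) //=; last by rewrite eq_sym.
    rewrite /phi' eqxx mulr0 (eq_sym c x) (negbTE xc) /colop eqxx pc pxn add0r addrA.
    congr (_ + _); first by ring.
    apply: eq_bigr => y /andP[yx yc]; by rewrite (negbTE yx) (negbTE yc).
  - by rewrite /phi' eq_sym (negbTE xw).
  - by rewrite /phi' eq_sym (negbTE xb).
  - by case: ifP => // /eqP <-; rewrite addn_gt0 zw.
  - by case: ifP => // /eqP <-; rewrite addn_gt0 zb.
  - move=> u Iu; rewrite /colop; case: eqP => [<-|_]; last exact: hm.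
    by apply: le_trans (hm u Iu) _; rewrite lerDl mulr_ge0 ?h0.
have [p0|p0] := lerP 0 (phi x).
  apply: (step w (absz (phi x)) 1 xw _ pw); first by left.
  by rewrite mulr1; lia.
apply: (step b (absz (phi x)) (-1) xb _ pb); first by right.
by rewrite mulrN1; lia.
Qed.

End Comparison.

(** * The auxiliary vertex and integral kernel vectors *)

Section AddVertex.
Context (V : finType) (I : pred V).
Implicit Types (B : V -> V -> int) (zeta m rho : V -> nat).

Definition add_vertex B rho : option V -> option V -> int := fun x y =>
  match x, y with
  | Some x, Some y => B x y
  | Some x, None => 0
  | None, Some y => (rho y)%:Z
  | None, None => -1
  end.
Definition add_entry (m : V -> nat) (k : nat) : option V -> nat :=
  fun x => if x is Some x then m x else k.

Lemma nn_add_vertex B rho : nn I B -> nn (extI I) (add_vertex B rho).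
Proof. by move=> hB [x|] [y|] Ix //=; rewrite ?(inj_eq Some_inj) ?addr0 //; apply: hB. Qed.

(** Nothing enters the attached vertex, not even in the extension, where its [zeta] is 0; so
    collapsing it merely deletes it. Its entry in [m] is 1 because the absorption of [z] asks for a
    positive [m b]. *)
Lemma ext_equiv_add_vertex B zeta m rho y0 : nn I B -> rho y0 != 0%N ->
  ext_equiv (extI I) (add_vertex B rho) (add_entry zeta 0) (add_entry m 1) ->
  ext_equiv I B zeta m.
Proof.
move=> hB hr h.
have h1 : meq (sg (extI I) (add_vertex B rho)) (sg I B).
  apply: meq_trans (sg_collapse _ (nn_add_vertex rho hB) _ _) (sg_eq _) => //.
    by exists y0; rewrite /= eqz_nat.
  by move=> x y _ /=; rewrite mul0r addr0.
apply: meq_trans (meq_sym h1) _; apply: meq_trans h _.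
(* Exchanges the attached vertex with [z], as [sg_collapse] eliminates the outermost [None]. *)
pose sw (x : option (option V)) : option (option V) :=
  match x with None => Some None | Some None => None | Some (Some x) => Some (Some x) end.
have sw_bij : bijective sw by exists sw; case=> [[x|]|].
apply: meq_trans (meq_sym (@sg_reindex (option (option V)) (option (option V)) _ _ sw sw_bij)) _.
set B2 := ext _ _ _; set I2 := extI (extI I).
have hn : nn I2 B2 by apply: nn_ext; apply: nn_add_vertex.
have hn' : nn (fun x => I2 (sw x)) (fun x y => B2 (sw x) (sw y)).
  by move=> x y Ix; have := hn (sw x) (sw y) Ix; rewrite (inj_eq (bij_inj sw_bij)).
rewrite (_ : extI I = fun x => I2 (sw (Some x))); last by apply/funext; case.
apply: meq_trans (sg_collapse _ hn' _ _) (sg_eq _) => //.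
  by exists (Some y0); rewrite /B2 /= mul1r -PoszD eqz_nat addn_eq0 negb_and hr.
by move=> [x|] [y|] _ //=; rewrite ?mulr0 ?addr0 ?mul0r ?addr0.
Qed.
End AddVertex.

Section Kernel.
Context (V : finType) (I : pred V).
Implicit Types (B : V -> V -> int) (phi : V -> int).

(** With the rows in [I] replaced by zero the square matrix is singular, since row [w] vanishes.
    [det0P] speaks of left kernels, whence the transposed arrangement of [M]. *)
Lemma kernel_vector B w : I w -> exists phi, (exists y, phi y != 0) /\
  forall x, ~~ I x -> \sum_y B x y * phi y = 0.
Proof.
move=> Iw; pose M : 'M[int]_#|V| :=
  \matrix_(i, j) if I (enum_val j) then 0 else B (enum_val j) (enum_val i).
have : \det M^T == 0.
  apply/det0P; exists (delta_mx 0 (enum_rank w)).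
    by apply/eqP => /matrixP/(_ 0 (enum_rank w)); rewrite !mxE !eqxx.
  by rewrite -rowE; apply/rowP => j; rewrite !mxE enum_rankK Iw.
rewrite det_tr => /det0P[u u0 uM].
exists (fun y => u 0 (enum_rank y)); split.
  apply: contrapT => h; case/negP: u0; apply/eqP/rowP => j; rewrite mxE.
  by apply/eqP/negPn/negP => hj; apply: h; exists (enum_val j); rewrite enum_valK.
move=> x Ix; move/rowP: uM => /(_ (enum_rank x)); rewrite !mxE => e.
rewrite -[RHS]e (reindex (@enum_val V V)) /=; last exact/onW_bij/enum_val_bij.
by apply: eq_bigr => i _; rewrite !mxE enum_rankK (negbTE Ix) enum_valK mulrC.
Qed.

(** The least positive integer combination of the entries of [phi] divides them all, because a
    nonzero remainder would be a smaller one. It is their gcd, [rho] holds Bezout coefficients and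
    [psi] is the primitive vector. *)
Lemma unimodular_factor phi : (exists y, phi y != 0) ->
  exists psi rho : V -> int, (exists2 d : int, d != 0 & forall y, phi y = psi y * d) /\
    \sum_y rho y * psi y = 1.
Proof.
move=> [y0 hy0].
pose P d := `[< exists rho : V -> int, (0 < d)%N /\ \sum_y rho y * phi y = d%:Z >].
have exP : exists d, P d.
  exists (absz (phi y0)); apply/asboolP.
  exists (fun y => if y == y0 then Num.sg (phi y0) else 0); rewrite absz_gt0 hy0; split=> //.
  rewrite (bigD1 y0) //= eqxx big1 ?addr0; last by move=> y /negbTE ->; rewrite mul0r.
  by rewrite abszE normrEsg.
have [d /asboolP[rho [d0 hd]] hmin] := ex_minnP exP.
have dvd y : phi y = (phi y %/ d%:Z)%Z * d%:Z.
  have dn0 : d%:Z != 0 by rewrite eqz_nat -lt0n.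
  suff r0 : (phi y %% d%:Z)%Z = 0 by rewrite {1}(divz_eq (phi y) d) r0 addr0.
  apply/eqP; apply: contraT => rn0.
  have r_ge0 := modz_ge0 (phi y) dn0.
  have : (d <= absz (phi y %% d%:Z)%Z)%N.
    apply: hmin; apply/asboolP.
    exists (fun z => (if z == y then 1 else 0) - (phi y %/ d%:Z)%Z * rho z).
    rewrite absz_gt0 rn0; split=> //.
    transitivity (\sum_z ((if z == y then 1 else 0) * phi z) -
                  (phi y %/ d%:Z)%Z * \sum_z rho z * phi z).
      rewrite mulr_sumr -sumrB; apply: eq_bigr => z _; by ring.
    rewrite (bigD1 y) //= eqxx big1 ?addr0 ?mul1r; last by move=> z /negbTE ->; rewrite mul0r.
    by rewrite hd abszE ger0_norm // {1}(divz_eq (phi y) d); ring.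
  have := ltz_mod (phi y) dn0; rewrite -lez_nat abszE ger0_norm //; lia.
exists (fun y => (phi y %/ d%:Z)%Z), rho; split.
  by exists d%:Z => //; rewrite eqz_nat -lt0n.
apply: (@mulIf _ d%:Z); first by rewrite eqz_nat -lt0n.
rewrite mul1r -[RHS]hd mulr_suml; apply: eq_bigr => y _.
by rewrite [in RHS]dvd mulrA.
Qed.

(** Negating either the primitive vector or its Bezout row gives [phi w <= 0] and pairing -1. Adding
    a large multiple of a regular row [r], which is positive and pairs to 0 with [phi], makes the
    Bezout row positive without changing the pairing. *)
Lemma kernel_pairing B w : I w -> (forall x y, ~~ I x -> 1 <= B x y) ->
  exists phi (rho : V -> nat), [/\ forall x, ~~ I x -> \sum_y B x y * phi y = 0,
    phi w <= 0, \sum_y (rho y)%:Z * phi y = -1 & (0 < rho w)%N].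
Proof.
move=> Iw hB; have [/existsP[r Ir]|] := boolP [exists r, ~~ I r]; last first.
  rewrite negb_exists => /forallP noI.
  (* No regular row constrains [phi], so [- e_w] will do. *)
  exists (fun y => if y == w then -1 else 0), (fun y => y == w : nat).
  split; rewrite ?eqxx //.
    by move=> x Ix; have := noI x; rewrite Ix.
  by rewrite (bigD1 w) //= eqxx big1 ?addr0 // => y /negbTE ->; rewrite mulr0.
have [phi0 [/unimodular_factor[psi [rho0 [[d d0 hd] h1]]] ker0]] := kernel_vector B Iw.
have ker x : ~~ I x -> \sum_y B x y * psi y = 0.
  move=> Ix; apply: (mulIf d0); rewrite mul0r mulr_suml; apply: etrans (ker0 x Ix).
  by apply: eq_bigr => y _; rewrite hd mulrA.
have [phi [rho1 [ker1 hw h2]]] : exists phi (rho1 : V -> int),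
    [/\ forall x, ~~ I x -> \sum_y B x y * phi y = 0, phi w <= 0 & \sum_y rho1 y * phi y = -1].
  have [pw|pw] := lerP (psi w) 0.
    exists psi, (fun y => - rho0 y); split=> //.
    by rewrite -h1 -sumrN; apply: eq_bigr => y _; rewrite mulNr.
  exists (fun y => - psi y), rho0; split; last 1 first.
  - by rewrite -h1 -sumrN; apply: eq_bigr => y _; rewrite mulrN.
  - move=> x Ix; apply: oppr_inj; rewrite oppr0; apply: etrans (ker x Ix); rewrite -sumrN.
    by apply: eq_bigr => y _; rewrite mulrN opprK.
  - by rewrite oppr_le0 ltW.
(* Row [r] is at least 1 everywhere, so [N] times it outweighs every entry of [rho1]. *)
pose N := 1 + \sum_y `|rho1 y|.
have pos y : 1 <= rho1 y + N * B r y.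
  have h3 : `|rho1 y| <= \sum_y `|rho1 y|.
    by rewrite (bigD1 y) //= lerDl sumr_ge0.
  have h4 : N <= N * B r y by rewrite ler_peMr ?hB // addr_ge0 ?sumr_ge0.
  by rewrite /N in h4 *; lia.
exists phi, (fun y => absz (rho1 y + N * B r y)); split=> //; last first.
  by have := pos w; lia.
transitivity (\sum_y rho1 y * phi y + N * \sum_y B r y * phi y).
  rewrite mulr_sumr -big_split; apply: eq_bigr => y _ /=.
  by rewrite abszE ger0_norm; [ring|apply: le_trans (pos y)].
by rewrite h2 ker1 // mulr0 addr0.
Qed.

End Kernel.

Lemma sum_option (V : finType) (f : option V -> int) :
  \sum_x f x = f None + \sum_x f (Some x).
Proof.
rewrite (bigD1 None) //=; congr (_ + _).
rewrite (reindex_omap Some id) /=; last by case.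
by apply: eq_bigl => x; rewrite eqxx.
Qed.

(** * Making the regular rows positive and absorbing the extension *)

Section Main.
Context (V : finType) (I : pred V).
Implicit Types (B : V -> V -> int) (zeta m : V -> nat).

Lemma nn_multi B w (n : V -> nat) : I w -> nn I B -> nn I (fun x y => B x y + (n y)%:Z * B x w).
Proof.
move=> Iw hB x y Ix; rewrite addrAC addr_ge0 ?hB // mulr_ge0 // (nn_neq hB) //.
by apply: contraNneq Ix => ->.
Qed.

(** It suffices to make column [w] positive on the regular rows, since it can then be added to all
    other columns. A row outside [S] with an edge to some [c] in [S] gains a positive entry at [w]
    once column [c] is added to column [w], so each round shrinks the complement of [S]. *)
Lemma ext_equiv_densify B zeta m w v :
  I w -> nn I B -> (0 < zeta v)%N ->
  (forall x, connect (fun x y => I x || (1 <= B x y + (x == y)%:Z)) x w) ->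
  (forall B' zeta', (forall x y, ~~ I x -> 1 <= B' x y) -> (0 < zeta' w)%N ->
     ext_equiv I B' zeta' m) ->
  ext_equiv I B zeta m.
Proof.
move=> Iw + + + hQ; pose S B := [pred x | I x || (1 <= B x w)].
have xw x : ~~ I x -> x != w by move=> Ix; apply: contraNneq Ix => ->.
have hw B1 x : nn I B1 -> ~~ I x -> 0 <= B1 x w by move=> hB Ix; apply: (nn_neq hB) => //; apply: xw.
have [N] := ubnP #|[predC S B]|.
elim: N => // N IH in B zeta * => hN hB zv conn.
pose n y : nat := if y == w then 0%N else 1%N.
have nw : n w = 0%N by rewrite /n eqxx.
have nE y : (y == w) = false -> n y = 1%N by rewrite /n => ->.
have [/existsP[a aS]|] := boolP [exists a, ~~ S B a]; last first.
  rewrite negb_exists => /forallP allS.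
  have Bw x : ~~ I x -> 1 <= B x w by have := allS x; rewrite negbK /= => /orP[->|].
  (* Twice column [w], because a diagonal entry of [B] may be -1. *)
  pose n2 y := (2 * n y)%N.
  apply: (@ext_equiv_multi _ _ _ _ _ w n2) => //; first by rewrite /n2 nw.
  set B1 := (fun x y => _); set z1 := (fun y => _).
  have B1d x y : ~~ I x -> 1 <= B1 x y.
    move=> Ix; rewrite /B1; have := Bw x Ix.
    have [->|/negbTE yw] := eqVneq y w; first by rewrite /n2 nw mul0r addr0.
    by rewrite /n2 nE //; have := hB x y Ix; case: (x == y) => /=; lia.
  have z1v : (0 < z1 v)%N by rewrite addn_gt0 zv.
  (* Column [v] is added to column [w] in order to carry the positive [zeta v] over to [w]. *)
  have [vw|vw] := eqVneq v w; first by apply: hQ => //; rewrite -vw.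
  apply: (ext_equiv_colop (n := 1) vw).
  - by move=> x y Ix; rewrite addr_ge0 //; apply: le_trans (B1d x y Ix).
  - by move=> Iv; split; [|apply: le_trans (B1d v v Iv)]; rewrite ?B1d.
  apply: hQ; last by rewrite eqxx mul1n addn_gt0 z1v orbT.
  move=> x y Ix; rewrite /colop; case: eqP => _; last exact: B1d.
  by rewrite mul1r; have := B1d x w Ix; have := B1d x v Ix; lia.
have [a1 [c [a1S cS /orP ac]]] : exists a1 c, [/\ ~~ S B a1, S B c & I a1 || (1 <= B a1 c + (a1 == c)%:Z)].
  apply: contrapT => h; have : ~~ S B w; last by rewrite /= Iw.
  apply: (@closed_connect_pred _ _ (fun x => ~~ S B x) _ _ _ aS (conn a)) => p q pS pq.
  by apply/negP => qS; apply: h; exists p, q.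
have /andP[Ia1 a1w] : ~~ I a1 && (B a1 w < 1) by move: a1S; rewrite /= negb_or ltNge.
have a1c : a1 != c by apply: contraNneq a1S => ->.
have Bac : 1 <= B a1 c by case: ac; [rewrite (negbTE Ia1)|rewrite (negbTE a1c) addr0].
have cw : c != w by apply: contraTneq a1w => <-; rewrite -leNgt.
(* Column [w] is first added to all others: if [c] is regular, its row is positive at [w], so this
   raises the entry at [(c, c)] to at least 0, as adding column [c] requires. *)
apply: (@ext_equiv_multi _ _ _ _ _ w n) => //.
set B1 := (fun x y => _); set z1 := (fun y => _).
have nn1 : nn I B1 by apply: nn_multi.
have B1w x : B1 x w = B x w by rewrite /B1 nw mul0r addr0.
have B1le x y : ~~ I x -> B x y <= B1 x y by move=> Ix; rewrite lerDl mulr_ge0 ?hw.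
have B1c : can_add I B1 c w.
  move=> Ic; rewrite B1w; have Bc : 1 <= B c w by move: cS; rewrite /= (negbTE Ic).
  split=> //; have := hB c c Ic; rewrite /B1 eqxx nE ?(negbTE cw) //; lia.
have cole x y : ~~ I x -> B x y <= colop B1 c w 1 x y.
  move=> Ix; apply: le_trans (B1le x y Ix) _; rewrite /colop; case: eqP => [->|//].
  rewrite lerDl mul1r; have [xc|] := eqVneq x c; last exact: (nn_neq nn1 Ix).
  by rewrite xc; rewrite xc in Ix; have [] := B1c Ix.
apply: (ext_equiv_colop (n := 1) cw nn1 B1c); apply: IH.
- rewrite ltnS in hN; apply: leq_trans hN; apply: proper_card; apply/properP; split.
    apply/fintype.subsetP => x; rewrite !inE /= !negb_or => /andP[Ix]; rewrite Ix /=.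
    by apply: contra => h; apply: le_trans h _; apply: cole.
  exists a1; first by rewrite !inE.
  rewrite !inE negbK (negbTE Ia1) /= /colop eqxx B1w mul1r.
  by have := B1le a1 c Ia1; have := hw B a1 hB Ia1; lia.
- exact: nn_colop.
- by case: eqP => [<-|_]; rewrite ?addn_gt0 /z1 ?addn_gt0 zv.
- move=> x; apply: connect_mono (conn x) => p q /orP[-> //|pq].
  have [//|Ip /=] := boolP (I p); apply: le_trans pq _.
  by rewrite lerD2r cole.
Qed.

Lemma ext_equiv_delta B w v : I w -> nn I B ->
  (forall x, connect (fun x y => I x || (1 <= B x y + (x == y)%:Z)) x w) ->
  ext_equiv I B (delta v) (delta v).
Proof.
move=> Iw hB conn; apply: (ext_equiv_densify (v := v) Iw hB _ conn); first by rewrite /delta eqxx.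
move=> {}B zeta {}hB zw {conn}.
have hnn : nn I B by move=> x y Ix; rewrite addr_ge0 //; apply: le_trans (hB x y Ix).
have [phi [rho [ker pw hrho rw]]] := kernel_pairing Iw hB.
apply: (@ext_equiv_add_vertex _ _ _ _ _ rho w hnn); first by rewrite -lt0n.
(* The kernel vector is -1 at the attached vertex [b = None], so adding column [w] to column [b] [n]
   times turns [phi w] into [phi w + n = 1]. Since [phi w <= 0], [n] is positive, and column [b]
   becomes positive on the old regular rows. *)
pose n := absz (1 - phi w).
have nE : n%:Z = 1 - phi w by rewrite /n; lia.
have n0 : (0 < n)%N by rewrite -ltz_nat nE; lia.
have wN : Some w != None by [].
apply: (ext_equiv_colop (n := n) wN (nn_add_vertex rho hnn)); first by rewrite /can_add /= Iw.
pose phi' (y : option V) := if y is Some y then (if y == w then 1 else phi y) else -1.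
apply: (@ext_equiv_balance _ _ _ _ _ (Some w) None phi') => //=.
- move=> [x|] [y|] Ix; rewrite /colop //=.
  + by apply: le_trans (hB x y Ix).
  + by rewrite add0r mulr_ge0 //; apply: le_trans (hB x w Ix).
  + have : 1 <= n%:Z * (rho w)%:Z by rewrite -PoszM lez_nat muln_gt0 n0.
    lia.
- by move=> [x|] Ix; rewrite /colop //=; apply: hB.
- move=> [x|] Ix // _; rewrite /colop /= add0r.
  by have := hB x w Ix; have : 1 <= n%:Z by []; nia.
- move=> x Ix; rewrite sum_option (bigD1 w) //= eqxx.
  rewrite (eq_bigr (fun y => add_vertex B rho x (Some y) * phi y)); last first.
    by move=> y /negbTE yw; rewrite yw.
  have -> : colop (add_vertex B rho) (Some w) None n x None =
      add_vertex B rho x None + (1 - phi w) * add_vertex B rho x (Some w).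
    by rewrite -nE.
  suff : \sum_y add_vertex B rho x (Some y) * phi y - add_vertex B rho x None = 0.
    rewrite (bigD1 w) //= => e; rewrite -[RHS]e /colop /=; by ring.
  case: x Ix => [x|] Ix /=; last by rewrite hrho.
  by rewrite ker // subr0.
- by rewrite eqxx.
- by rewrite add0n muln_gt0 n0.
- case=> [x|] Ix; rewrite /colop //=; apply: le_trans (hB x w Ix).
  by rewrite /delta; case: eqP.
Qed.

End Main.

(** * From simple graphs to matrices *)

Local Close Scope ring_scope.

Section AdjacencyMatrix.
Context (E : graph) (V : finType) (phi : vert E -> V) (A : mx V).
Hypothesis phi_bij : bijective phi.
Hypothesis hA : forall x y, has_card [set e : edge E | phi (src e) = x /\ phi (rng e) = y] (A x y).

Lemma adj_edge x y : adj A x y <-> exists e : edge E, phi (src e) = x /\ phi (rng e) = y.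
Proof.
have := hA x y; rewrite /adj; case: (A x y) => [n|] h.
  case: h => s [_ <- hs]; split=> [|[e /hs]]; last by case: s {hs}.
  by case: s hs => // e s hs _; exists e; apply/hs; rewrite mem_head.
by split=> // _; have [e] := infinite_setN0 h; exists e.
Qed.

Lemma connect_path u w : has_path u w -> connect (adj A) (phi u) (phi w).
Proof.
case=> [->|[e [p [pp <- <-]]]]; first exact: connect0.
elim: p e pp => [|f p IH] e /=.
  by move=> _; apply/connect1/adj_edge; exists e.
case/andP => /eqP ef pp; apply: connect_trans (IH f pp).
by apply/connect1/adj_edge; exists e; rewrite ef.
Qed.

(** An infinite path is built from [x] by choosing at each vertex an edge that stays in the strong
    component [C] of [x]. By condition (a) of simplicity [u] reaches this path, and from there
    [x]. *)
Lemma connect_cyclic x y u : simple_graph E -> adj A x y -> connect (adj A) y x ->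
  connect (adj A) u x.
Proof.
move=> [ha _ _] xy yx; pose C z := connect (adj A) x z && connect (adj A) z x.
have [psi phiK psiK] := phi_bij.
have next z : C z -> exists e : edge E, phi (src e) = z /\ C (phi (rng e)).
  case/andP => xz zx.
  suff [z' [/adj_edge[e [e1 e2]] hz']] : exists z', adj A z z' /\ C z' by exists e; rewrite e2.
  have [xe|zx'] := eqVneq z x.
    by exists y; rewrite xe; split=> //; rewrite /C yx connect1.
  move/connectP: zx => [[|z' p] /=]; first by move=> _ xz'; rewrite xz' eqxx in zx'.
  case/andP => zz' pp ex; exists z'; split=> //.
  apply/andP; split; first exact: connect_trans xz (connect1 zz').
  by apply/connectP; exists p.
have Cx : C x by rewrite /C connect0.
have f_ex (z : {z | C z}) := cid (next (val z) (valP z)).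
pose f z := projT1 (f_ex z).
have fS z : phi (src (f z)) = val z by rewrite /f; case: (f_ex z) => e [].
have fC z : C (phi (rng (f z))) by rewrite /f; case: (f_ex z) => e [].
pose st i := iter i (fun z => exist (fun z => C z) _ (fC z)) (exist (fun z => C z) _ Cx).
have [i hi] : exists i, has_path (psi u) (src (f (st i))).
  apply: (ha (fun i => f (st i))) => i; apply: (bij_inj phi_bij).
  by rewrite fS /st iterS.
have := connect_path hi; rewrite psiK fS => ui; apply: connect_trans ui _.
by case/andP: (valP (st i)).
Qed.

Lemma connect_base v : simple_graph E -> base_of_two_simple_cycles v ->
  forall x, connect (adj A) x (phi v).
Proof.
move=> sE [[|e p] [_ [/andP[cyc h] _ _]]] // x; case/andP: h => /eqP ev _.
apply: (@connect_cyclic _ (phi (rng e)) _ sE); first by apply/adj_edge; exists e; rewrite ev.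
apply: connect_path; move: cyc; rewrite /is_cycle /= rcons_path => /andP[pp /eqP hl].
case: p pp hl => [|f p] /=; first by move=> _ ->; left.
case/andP => /eqP ef pp hl; right; exists f, p; split=> //; by rewrite hl ev.
Qed.

Lemma connect_inf_row u w : simple_graph E -> inf_row A w -> connect (adj A) u w.
Proof.
move=> [_ _ hc] /existsP[z /eqP hz]; have [psi phiK psiK] := phi_bij.
rewrite -(psiK u) -(psiK w); apply/connect_path/hc; right.
have := hA w z; rewrite hz /=; apply: sub_infinite_set => e [he _].
by rewrite /out_edges /= -he phiK.
Qed.

Lemma ex_inf_row : infinite_set [set: edge E] -> exists w, inf_row A w.
Proof.
move=> infE; apply: contrapT => h; apply: infE.
pose S (t : V * V) := [set e : edge E | phi (src e) = t.1 /\ phi (rng e) = t.2].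
have -> : [set: edge E] = \bigcup_(t in [set: V * V]) S t.
  by apply/seteqP; split=> // e _; exists (phi (src e), phi (rng e)).
apply: bigcup_finite => [|[x y] _]; first exact: finite_finset.
have := hA x y; case e : (A x y) => [n|] hn; first exact: has_card_finite hn.
by case: h; exists x; apply/existsP; exists y; rewrite e.
Qed.
End AdjacencyMatrix.

Section Extended.
Context (V : finType) (A : mx V) (v : V).
Local Notation A1 := (ext_mx A (delta v) (delta v)).

Lemma adj_ext x y : adj A x y -> adj A1 (Some x) (Some y).
Proof. by rewrite /adj /=; case: (A x y) => [[|n]|]. Qed.

Lemma connect_ext x y : connect (adj A) x y -> connect (adj A1) (Some x) (Some y).
Proof.
move/connectP => [p pp ->] {y}; elim: p x pp => [|z p IH] x /=; first by rewrite connect0.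
by case/andP => /adj_ext/connect1 xz pp; apply: connect_trans xz (IH z pp).
Qed.

Lemma adj_ext_inv x y : adj A1 (Some x) (Some y) -> adj A x y \/ x = v /\ y = v.
Proof.
rewrite /adj /= /delta; case: (x =P v) => [->|_]; case: (y =P v) => [->|_]; first by right.
all: by rewrite ?muln0 eaddn0; left.
Qed.

Lemma adj_ext_None : adj A1 None (Some v).
Proof. by rewrite /adj /= /delta eqxx. Qed.

Lemma adj_ext_to_None : adj A1 (Some v) None.
Proof. by rewrite /adj /= /delta eqxx. Qed.

(** A path between old vertices that uses anything new passes through [v]: the new vertex is joined
    to no old vertex but [v], and the only old entry that changes is at [(v, v)]. *)
Lemma connect_ext_inv x y : connect (adj A1) (Some x) (Some y) ->
  connect (adj A) x y || connect (adj A1) (Some v) (Some y).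
Proof.
pose P (z : option V) := if z is Some z then connect (adj A) x z || connect (adj A1) (Some v) (Some z) else true.
move=> h; apply: (@closed_connect_pred _ _ P _ _ _ _ h); last by rewrite /= connect0.
move=> [p|] [q|] //=.
  case/orP => [xp /adj_ext_inv[/connect1 pq|[_ ->]]|vp pq].
  - by rewrite (connect_trans xp pq).
  - by rewrite connect0 orbT.
  - by rewrite (connect_trans vp (connect1 pq)) orbT.
move=> _; rewrite /adj /= /delta; case: (q =P v) => [->|//]; by rewrite connect0 orbT.
Qed.

Lemma inf_row_ext x : inf_row A1 x = extI (inf_row A) x.
Proof.
case: x => [x|]; last by apply/existsP => -[[y|]].
apply/existsP/existsP => -[z].
  by case: z => [z|] //= hz; exists z; case: (A x z) hz.
by move/eqP => hz; exists (Some z); rewrite /= hz.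
Qed.

Hypothesis to_v : forall x, connect (adj A) x v.
Hypothesis inf_v : forall u, inf_row A u -> connect (adj A) v u.
Hypothesis cyc_v : forall x y, adj A x y -> connect (adj A) y x -> connect (adj A) v x.

Lemma sat_ext_mg : meq (mg A1) (mg (sat A1)).
Proof.
apply: (@sat_mg _ A1 (Some v)).
- move=> [x|]; first exact/connect_ext.
  exact/connect1/adj_ext_None.
- by move=> x; rewrite inf_row_ext; case: x => //= x /inf_v/connect_ext.
- move=> [x|] [y|] xy yx.
  + have /orP[yx'|//] := connect_ext_inv yx.
    by have [xy'|[-> _]] := adj_ext_inv xy; rewrite ?connect0 // connect_ext // (cyc_v xy').
  + by apply: connect_trans yx; apply/connect1/adj_ext_to_None.
  + exact/connect1/adj_ext_to_None.
  + exact/connect1/adj_ext_to_None.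
Qed.

Local Open Scope ring_scope.

Lemma mg_ext w : inf_row A w -> meq (mg A) (mg A1).
Proof.
(* The default 0 is taken only in infinite rows, which [sg] ignores. *)
move=> iw; pose B x y : int := (odflt 0%N (A x y))%:Z - (x == y)%:Z.
have rowS x y : ~~ inf_row A x -> exists k, A x y = Some k.
  by move/existsPn => /(_ y); case: (A x y) => // k _; exists k.
have BE x y : B x y + (x == y)%:Z = (odflt 0%N (A x y))%:Z by rewrite /B GRing.subrK.
have s1 : meq (mg (sat A)) (sg (inf_row A) B).
  apply/meq_iso/mg_eq => x y; rewrite /sat; case: (boolP (inf_row A x)) => // ix.
  by rewrite BE; have [k ->] := rowS x y ix.
have s2 : meq (mg (sat A1)) (sg (extI (inf_row A)) (ext B (delta v) (delta v))).
  apply/meq_iso/mg_eq => x y; rewrite /sat inf_row_ext; case: ifP => // /negbT ix.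
  case: x y ix => [x|] [y|] ix /=; rewrite ?GRing.addr0 /= ?addn0 //.
  have [k kE] := rowS x y ix; rewrite GRing.addrAC (inj_eq Some_inj) BE kE /=.
  by congr Some; lia.
apply: meq_trans (sat_mg to_v inf_v cyc_v) _; apply: meq_trans s1 _.
apply: meq_trans _ (meq_sym (meq_trans sat_ext_mg s2)).
apply: (@ext_equiv_delta _ _ _ w) => //; first by move=> x y _; rewrite BE.
move=> x; apply: connect_trans (_ : connect _ x v) _.
  apply: connect_mono (to_v x) => p q; rewrite /adj BE.
  have [//|ip /=] := boolP (inf_row A p).
  by have [[|k] ->] := rowS p q ip.
apply: connect_mono (inf_v iw) => p q; rewrite /adj BE.
have [//|ip /=] := boolP (inf_row A p).
by have [[|k] ->] := rowS p q ip.
Qed.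
End Extended.

Theorem proposition9p5 (E : graph) (v : vert E)
    (E_simple : simple_graph E)
    (fin_vert : finite_set [set: vert E])
    (inf_edge : infinite_set [set: edge E])
    (hv : base_of_two_simple_cycles v) :
  move_equivalent E (cuntz_splice v) /\
  forall K : fieldType, morita_equivalent (lpa K E) (lpa K (cuntz_splice v)).
Proof.
have [V [phi [A [phi_bij hA]]]] := graph_matrix fin_vert.
have [w iw] := ex_inf_row hA inf_edge.
apply: (meq_trans (meq_iso (mg_iso phi_bij hA))).
apply: meq_trans (mg_ext _ _ _ iw) _.
- exact: (connect_base phi_bij hA E_simple hv).
- by move=> u; apply: (connect_inf_row phi_bij hA).
- by move=> x y xy yx; apply: (connect_cyclic phi_bij hA _ E_simple xy yx).
apply: meq_trans (meq_sym (splice_ext A (phi v))) _.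
exact/meq_sym/meq_iso/splice_matrix.
Qed.
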